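(* (i) Let $E$ be an equivalence relation on $\mathbb N$ with infinitely many classes, each infinite. The universal minimal flow of $\mathrm{Aut}(\langle\mathbb N,E\rangle)$ is the space of all linear orderings on $\mathbb N$ for which each $E$-class is convex. (ii) Let $\boldsymbol V_F$ be the $\aleph_0$-dimensional vector space over a finite field $F$. The universal minimal flow of its automorphism group $\mathrm{GL}(\boldsymbol V_F)$ is the space of all linear orderings on $V_F$ whose restrictions to finite-dimensional subspaces are natural. (iii) Let $\boldsymbol B_\infty$ be the countable atomless Boolean algebra. The universal minimal flow of $\mathrm{Aut}(\boldsymbol B_\infty)$ is the space of all linear orderings on $B_\infty$ whose restrictions to finite subalgebras are natural.
   Context: All automorphism groups carry the topology of pointwise convergence (on the underlying countable set taken discrete); the spaces of orderings are closed subspaces of $2^{X\times X}$ with the product topology, acted on by $a\,(g\cdot\prec)\,b\Leftrightarrow g^{-1}(a)\prec g^{-1}(b)$. The universal minimal flow of a topological group $G$ is the unique (up to isomorphism) minimal compact $G$-flow (all orbits dense) that maps by a continuous equivariant map onto every minimal $G$-flow. Fix a linear ordering of the finite field $F$ in which $0$ is least. For a finite-dimensional vector space $V$ over $F$ with an ordered basis $b_1<\dots<b_n$, the induced antilexicographic ordering is $\sum\alpha_ib_i<\sum\beta_ib_i$ iff $\alpha_j<\beta_j$ for the largest $j$ with $\alpha_j\ne\beta_j$; an ordering of $V$ is natural if it arises this way from some ordered basis. For a finite Boolean algebra with ordered atoms $a_1<\dots<a_n$, each element is uniquely $\bigvee_{i}\delta_ia_i$ with $\delta_i\in\{0,1\}$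 (where $\delta a=a$ if $\delta=1$ and $0$ otherwise), and the induced antilexicographic ordering compares $\bigvee\delta_ia_i<\bigvee\epsilon_ia_i$ iff $\delta_j<\epsilon_j$ for the largest $j$ with $\delta_j\ne\epsilon_j$; an ordering of a finite Boolean algebra is natural if it arises this way from an ordering of its atoms. *)

(* Defs.v *)
From HB Require Import structures.
From mathcomp Require Import all_boot all_order all_algebra.
From mathcomp Require Import all_classical topology.

Set Implicit Arguments.
Unset Strict Implicit.
Unset Printing Implicit Defensive.

Import Order.TTheory GRing.Theory.

Local Open Scope classical_set_scope.

HB.mixin Record isTopologicalGroup G of Group G & Topological G := {
  mulg_continuous : continuous (fun gh : G * G => (gh.1 * gh.2)%g);
  invg_continuous : continuous (fun g : G => (g^-1)%g)
}.

#[short(type="topologicalGroupType")]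
HB.structure Definition TopologicalGroup :=
  {G of Group G & Topological G & isTopologicalGroup G}.

Section Flows.
Variable G : topologicalGroupType.

Record is_flow (X : topologicalType) (act : G -> X -> X) : Prop := IsFlow {
  flow_compact : compact [set: X];
  flow_hausdorff : hausdorff_space X;
  flow_act1 : forall x, act 1%g x = x;
  flow_actM : forall g h x, act (g * h)%g x = act g (act h x);
  flow_continuous : continuous (fun gx : G * X => act gx.1 gx.2)
}.

(** Nonemptiness is not implied by the last clause: the empty space satisfies it
    vacuously, and no nonempty flow maps to it. *)
Definition is_minimal_flow (X : topologicalType) (act : G -> X -> X) : Prop :=
  [/\ is_flow act, [set: X] !=set0 &
      forall x : X, dense [set act g x | g in [set: G]]].

Definition flow_surjection (X Y : topologicalType)
    (actX : G -> X -> X) (actY : G -> Y -> Y) (f : X -> Y) : Prop :=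
  [/\ continuous f, forall g x, f (actX g x) = actY g (f x) & range f = setT].

Definition is_universal_minimal_flow
    (X : topologicalType) (act : G -> X -> X) : Prop :=
  is_minimal_flow act /\
  forall (Y : topologicalType) (actY : G -> Y -> Y),
    is_minimal_flow actY -> exists f : X -> Y, flow_surjection act actY f.

End Flows.

Record symg (T : Type) := Symg {
  symg_fun :> T -> T;
  symg_bij : bijective symg_fun
}.

Lemma symg_ext (T : Type) (g h : symg T) : g =1 h -> g = h.
Proof.
case: g h => [g gb] [h hb] /= /funext gh; subst h.
by congr Symg; exact: Prop_irrelevance.
Qed.

Section SymGroup.
Variable T : Type.

HB.instance Definition _ := gen_eqMixin (symg T).
HB.instance Definition _ := gen_choiceMixin (symg T).

(** Products compose from right to left, so that groups act on the left. *)
Definition symg_one : symg T := @Symg T id (Bijective (frefl id) (frefl id)).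

Definition symg_mul (g h : symg T) : symg T :=
  Symg (bij_comp (symg_bij g) (symg_bij h)).

Lemma symg_inv_ex (g : symg T) :
  {h : symg T | cancel g h /\ cancel h g}.
Proof.
apply: cid; case: (symg_bij g) => h gh hg.
by exists (Symg (Bijective hg gh)).
Qed.

Definition symg_inv (g : symg T) : symg T := sval (symg_inv_ex g).

Lemma symg_mulA : associative symg_mul.
Proof. by move=> f g h; exact: symg_ext. Qed.

Lemma symg_mul1g : left_id symg_one symg_mul.
Proof. by move=> g; exact: symg_ext. Qed.

Lemma symg_mulg1 : right_id symg_one symg_mul.
Proof. by move=> g; exact: symg_ext. Qed.

Lemma symg_mulVg : left_inverse symg_one symg_inv symg_mul.
Proof.
move=> g; apply: symg_ext => x /=; rewrite /symg_inv.
by case: symg_inv_ex => h [gh _] /=; exact: gh.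
Qed.

Lemma symg_mulgV : right_inverse symg_one symg_inv symg_mul.
Proof.
move=> g; apply: symg_ext => x /=; rewrite /symg_inv.
by case: symg_inv_ex => h [_ hg] /=; exact: hg.
Qed.

HB.instance Definition _ := isGroup.Build (symg T)
  symg_mulA symg_mul1g symg_mulg1 symg_mulVg symg_mulgV.

Lemma symg1E x : (1%g : symg T) x = x. Proof. by []. Qed.

Lemma symgME (g h : symg T) x : (g * h)%g x = g (h x). Proof. by []. Qed.

Lemma symgK (g : symg T) : cancel g (g^-1)%g.
Proof. by move=> x; rewrite -symgME mulVg. Qed.

Lemma symgVK (g : symg T) : cancel (g^-1)%g g.
Proof. by move=> x; rewrite -symgME mulgV. Qed.

End SymGroup.

Section SymTopology.
Variable T : choiceType.

HB.instance Definition _ := Topological.copy (symg T)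
  (initial_topology (@symg_fun T : symg T -> {ptws T -> discrete_topology T})).

End SymTopology.

Section SymTopologicalGroup.
Variable T : choiceType.

Lemma symg_eval_continuous (x : T) :
  continuous (fun g : symg T => (g x : discrete_topology T)).
Proof.
move=> g; apply: (@continuous_comp _ {ptws T -> discrete_topology T} _
  (@symg_fun T) (fun f => f x)); first exact: initial_continuous.
exact: (@proj_continuous T (fun=> discrete_topology T) x).
Qed.

Lemma symg_eval_near (g : symg T) (x : T) : \forall h \near g, (h : symg T) x = g x.
Proof.
have /(_ [set g x]) := @symg_eval_continuous x g.
apply; exact: (@discrete_set1 (discrete_topology T)).
Qed.

Lemma continuous_to_symg (Z : topologicalType) (f : Z -> symg T) :
  (forall z x, \forall w \near z, f w x = f z x) -> continuous f.
Proof.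
move=> fP; apply: continuous_comp_initial => z.
apply/cvg_sup => x; apply: (@continuous_comp_initial _ _ _
  (fun h : {ptws T -> discrete_topology T} => h x)) z => z.
by apply/discrete_cvg; exact: fP.
Qed.

Lemma symg_mulg_continuous :
  continuous (fun gh : symg T * symg T => (gh.1 * gh.2)%g).
Proof.
apply: continuous_to_symg => -[g h] x /=.
have gP : \forall gh \near (g, h), (gh.1 : symg T) (h x) = g (h x).
  exact: cvg_fst (symg_eval_near g (h x)).
have hP : \forall gh \near (g, h), (gh.2 : symg T) x = h x.
  exact: cvg_snd (symg_eval_near h x).
apply: filterS2 gP hP => gh e1 e2.
by change (gh.1 (gh.2 x) = g (h x)); rewrite e2.
Qed.

Lemma symg_invg_continuous : continuous (fun g : symg T => (g^-1)%g).
Proof.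
apply: continuous_to_symg => g x.
apply: filterS (symg_eval_near g ((g^-1)%g x)) => h.
by rewrite symgVK => e; rewrite -{1}e symgK.
Qed.

HB.instance Definition _ := isTopologicalGroup.Build (symg T)
  symg_mulg_continuous symg_invg_continuous.

End SymTopologicalGroup.

Record subgroup (G : groupType) := Subgroup {
  subgroup_set :> set G;
  subgroup1 : subgroup_set 1%g;
  subgroupM : forall g h,
    subgroup_set g -> subgroup_set h -> subgroup_set (g * h)%g;
  subgroupV : forall g, subgroup_set g -> subgroup_set (g^-1)%g
}.

Section SubgroupGroup.
Variables (G : groupType) (H : subgroup G).

Lemma subgroupP (g : H) : subgroup_set H (val g). Proof. exact: set_mem (valP g). Qed.

Definition subgroup_one : H := exist _ 1%g (mem_set (subgroup1 H)).

Definition subgroup_mul (g h : H) : H :=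
  exist _ (val g * val h)%g (mem_set (subgroupM (subgroupP g) (subgroupP h))).

Definition subgroup_inv (g : H) : H :=
  exist _ (val g)^-1%g (mem_set (subgroupV (subgroupP g))).

Lemma subgroup_mulA : associative subgroup_mul.
Proof. by move=> f g h; apply: val_inj; rewrite /= mulgA. Qed.

Lemma subgroup_mul1g : left_id subgroup_one subgroup_mul.
Proof. by move=> g; apply: val_inj; rewrite /= mul1g. Qed.

Lemma subgroup_mulg1 : right_id subgroup_one subgroup_mul.
Proof. by move=> g; apply: val_inj; rewrite /= mulg1. Qed.

Lemma subgroup_mulVg : left_inverse subgroup_one subgroup_inv subgroup_mul.
Proof. by move=> g; apply: val_inj; rewrite /= mulVg. Qed.

Lemma subgroup_mulgV : right_inverse subgroup_one subgroup_inv subgroup_mul.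
Proof. by move=> g; apply: val_inj; rewrite /= mulgV. Qed.

HB.instance Definition _ := isGroup.Build (set_type H)
  subgroup_mulA subgroup_mul1g subgroup_mulg1 subgroup_mulVg subgroup_mulgV.

End SubgroupGroup.

Section SubgroupTopologicalGroup.
Variables (G : topologicalGroupType) (H : subgroup G).

Let val_continuous : continuous (set_val : H -> G).
Proof. exact: initial_continuous. Qed.

Lemma subgroup_mulg_continuous : continuous (fun gh : H * H => (gh.1 * gh.2)%g).
Proof.
apply: continuous_comp_initial => -[g h].
apply: (@continuous_comp _ (G * G)%type _
  (fun gh : H * H => (set_val gh.1, set_val gh.2))
  (fun gh : G * G => (gh.1 * gh.2)%g)); last exact: mulg_continuous.
apply: cvg_pair => /=.
  apply: (@continuous_comp (H * H)%type H G fst set_val (g, h)).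
    exact: cvg_fst.
  exact: val_continuous.
apply: (@continuous_comp (H * H)%type H G snd set_val (g, h)).
  exact: cvg_snd.
exact: val_continuous.
Qed.

Lemma subgroup_invg_continuous : continuous (fun g : H => (g^-1)%g).
Proof.
apply: continuous_comp_initial => g.
apply: (@continuous_comp _ G _ set_val (fun g : G => (g^-1)%g)).
  exact: val_continuous.
exact: invg_continuous.
Qed.

HB.instance Definition _ := isTopologicalGroup.Build (set_type H)
  subgroup_mulg_continuous subgroup_invg_continuous.

End SubgroupTopologicalGroup.

Definition strict_linear_order (T : Type) (lt : rel T) : Prop :=
  [/\ irreflexive lt, transitive lt &
      forall x y, x <> y -> lt x y \/ lt y x].

(** The product space 2^(T * T); [r (a, b)] reads "a precedes b" (strictly), so
    an ordering is represented by its strict part. *)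
Definition relspace (T : Type) : Type := {ptws (T * T)%type -> bool}.

HB.instance Definition _ (T : choiceType) := Topological.on (relspace T).

Definition rel_of (T : Type) (r : relspace T) : rel T := fun a b => r (a, b).

Definition relspace_act (T : choiceType) (g : symg T) (r : relspace T) :
  relspace T := fun ab => r ((g^-1)%g ab.1, (g^-1)%g ab.2).

Section InvariantSubspace.
Variables (T : choiceType) (H : subgroup (symg T)) (A : set (relspace T)).
Hypothesis A_invariant :
  forall g r, subgroup_set H g -> A r -> A (relspace_act g r).

Definition restricted_act (g : H) (r : A) : A :=
  exist _ (relspace_act (val g) (val r))
    (mem_set (A_invariant (subgroupP g) (set_mem (valP r)))).

End InvariantSubspace.

Lemma strict_linear_order_act (T : choiceType) (g : symg T) (r : relspace T) :
  strict_linear_order (rel_of r) ->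
  strict_linear_order (rel_of (relspace_act g r)).
Proof.
rewrite /relspace_act /rel_of => -[irr tr tot]; split => /=.
- by move=> x; exact: irr.
- by move=> y x z; exact: tr.
- by move=> x y xy; apply: tot => /(can_inj (symgVK g)).
Qed.

Definition antilex (K : Type) (lt : rel K) (n : nat)
    (alpha beta : 'I_n -> K) : Prop :=
  exists j : 'I_n, [/\ alpha j <> beta j,
    forall i : 'I_n, (j < i)%N -> alpha i = beta i & lt (alpha j) (beta j)].

Section EquivalenceRelation.
Variables (T : choiceType) (E : rel T).

Definition eqrel_aut_set : set (symg T) :=
  [set g | forall x y, E (g x) (g y) = E x y].

Lemma eqrel_aut1 : eqrel_aut_set 1%g. Proof. by []. Qed.

Lemma eqrel_autM g h :
  eqrel_aut_set g -> eqrel_aut_set h -> eqrel_aut_set (g * h)%g.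
Proof. by move=> gE hE x y; rewrite !symgME gE hE. Qed.

Lemma eqrel_autV g : eqrel_aut_set g -> eqrel_aut_set (g^-1)%g.
Proof. by move=> gE x y; rewrite -gE !symgVK. Qed.

Definition eqrel_aut : subgroup (symg T) :=
  Subgroup eqrel_aut1 eqrel_autM eqrel_autV.

Definition convex_orderings : set (relspace T) :=
  [set r | strict_linear_order (rel_of r) /\
    forall x y z, E x z -> rel_of r x y -> rel_of r y z -> E x y].

Lemma convex_orderings_invariant g r :
  eqrel_aut_set g -> convex_orderings r -> convex_orderings (relspace_act g r).
Proof.
move=> /eqrel_autV gE [rlin rconv]; split; first exact: strict_linear_order_act.
by move=> x y z Exz xy yz; rewrite -gE; apply: rconv xy yz; rewrite gE.
Qed.

Definition convex_act : eqrel_aut -> convex_orderings -> convex_orderings :=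
  restricted_act (H := eqrel_aut) convex_orderings_invariant.

End EquivalenceRelation.

Section VectorSpace.
Variables (F : fieldType) (V : lmodType F).

Local Open Scope ring_scope.

Definition lincomb n (b : 'I_n -> V) (a : 'I_n -> F) : V :=
  \sum_(i < n) a i *: b i.

Definition lin_indep n (b : 'I_n -> V) : Prop :=
  forall a : 'I_n -> F, lincomb b a = 0 -> forall i, a i = 0.

Definition finite_basis n (b : 'I_n -> V) (W : set V) : Prop :=
  lin_indep b /\ range (lincomb b) = W.

Definition fin_dim_subspace (W : set V) : Prop :=
  exists n (b : 'I_n -> V), finite_basis b W.

Definition dim_aleph0 : Prop :=
  exists b : nat -> V,
    (forall n, lin_indep (fun i : 'I_n => b i)) /\
    (forall v, exists n, range (lincomb (fun i : 'I_n => b i)) v).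

Definition gl_set : set (symg V) := [set g | linear (g : V -> V)].

Lemma gl1 : gl_set 1%g. Proof. by []. Qed.

Lemma glM g h : gl_set g -> gl_set h -> gl_set (g * h)%g.
Proof. by move=> glin hlin a u v; rewrite !symgME hlin glin. Qed.

Lemma glV g : gl_set g -> gl_set (g^-1)%g.
Proof.
by move=> glin a u v; apply: (can_inj (symgK g)); rewrite glin !symgVK.
Qed.

Definition gl : subgroup (symg V) := Subgroup gl1 glM glV.

Variable ltF : rel F.

Definition natural_vect_on (r : rel V) (W : set V) : Prop :=
  exists n (b : 'I_n -> V), finite_basis b W /\
    forall alpha beta : 'I_n -> F,
      r (lincomb b alpha) (lincomb b beta) <-> antilex ltF alpha beta.

Definition natural_vect_orderings : set (relspace V) :=
  [set r | strict_linear_order (rel_of r) /\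
    forall W, fin_dim_subspace W -> natural_vect_on (rel_of r) W].

Lemma gl_lincomb g n (b : 'I_n -> V) a :
  gl_set g -> g (lincomb b a) = lincomb (g \o b) a.
Proof.
move=> glin; have g0 : g 0 = 0.
  by have := glin (-1) 0 0; rewrite scaler0 addr0 scaleN1r addNr.
have gD : {morph g : u v / u + v}.
  by move=> u v; have := glin 1 u v; rewrite !scale1r.
rewrite /lincomb (big_morph g gD g0); apply: eq_bigr => i _.
by have := glin (a i) (b i) 0; rewrite g0 !addr0.
Qed.

Lemma gl_finite_basis g n (b : 'I_n -> V) W :
  gl_set g -> finite_basis b W -> finite_basis (g \o b) (g @` W).
Proof.
move=> glin [bfree <-]; split.
  move=> a; rewrite -gl_lincomb // => /(congr1 (g^-1)%g); rewrite symgK => ba0.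
  apply: bfree; rewrite ba0 -[0 in LHS](_ : lincomb b (fun=> 0) = 0).
    rewrite gl_lincomb; last exact: glV.
    by rewrite /lincomb !big1 // => i _; rewrite scale0r.
  by rewrite /lincomb big1 // => i _; rewrite scale0r.
apply/seteqP; split => v /=.
  by move=> [a _ <-]; exists (lincomb b a); [exists a|exact: gl_lincomb].
by move=> [_ [a _ <-] <-]; exists a => //; rewrite gl_lincomb.
Qed.

Lemma natural_vect_orderings_invariant g r :
  gl_set g -> natural_vect_orderings r ->
  natural_vect_orderings (relspace_act g r).
Proof.
move=> glin [rlin rnat]; split; first exact: strict_linear_order_act.
move=> W [n [b bW]].
have [m [c [cW' cP]]] : natural_vect_on (rel_of r) ((g^-1)%g @` W).
  apply: rnat; exists n, ((g^-1)%g \o b).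
  by apply: gl_finite_basis => //; exact: glV.
exists m, (g \o c); split.
  rewrite (_ : W = g @` ((g^-1)%g @` W)); first exact: gl_finite_basis.
  by rewrite image_comp (_ : g \o _ = id) ?image_id//; apply/funext/symgVK.
move=> alpha beta; rewrite -!gl_lincomb // -cP.
by rewrite /rel_of /relspace_act /= !symgK.
Qed.

Definition natural_vect_act :
    gl -> natural_vect_orderings -> natural_vect_orderings :=
  restricted_act (H := gl) natural_vect_orderings_invariant.

End VectorSpace.

Section BooleanAlgebra.
Context {d : Order.disp_t} (B : ctbDistrLatticeType d).

Local Open Scope order_scope.

Definition atomless : Prop :=
  forall x : B, \bot < x -> exists y : B, \bot < y /\ y < x.

Definition finite_subalgebra (S : set B) : Prop :=
  [/\ finite_set S, S \bot /\ S \top,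
      forall x y, S x -> S y -> S (x `&` y),
      forall x y, S x -> S y -> S (x `|` y) &
      forall x, S x -> S (~` x)].

Definition atoms (S : set B) : set B :=
  [set a | [/\ S a, \bot < a &
     forall x, S x -> \bot < x -> x <= a -> x = a]].

Definition boolalg_aut_set : set (symg B) :=
  [set g | [/\ g \bot = \bot, g \top = \top,
     {morph g : x y / x `&` y},
     {morph g : x y / x `|` y} &
     {morph g : x / ~` x}]].

Lemma boolalg_aut1 : boolalg_aut_set 1%g. Proof. by split. Qed.

Lemma boolalg_autM g h :
  boolalg_aut_set g -> boolalg_aut_set h -> boolalg_aut_set (g * h)%g.
Proof.
move=> [g0 g1 gI gU gC] [h0 h1 hI hU hC].
by split => [| |x y|x y|x]; rewrite !symgME ?h0 ?h1 ?hI ?hU ?hC.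
Qed.

Lemma boolalg_autV g : boolalg_aut_set g -> boolalg_aut_set (g^-1)%g.
Proof.
move=> [g0 g1 gI gU gC].
by split => [| |x y|x y|x]; apply: (can_inj (symgK g));
  rewrite ?(gI, gU, gC) !symgVK.
Qed.

Definition boolalg_aut : subgroup (symg B) :=
  Subgroup boolalg_aut1 boolalg_autM boolalg_autV.

Definition natural_bool_on (r : rel B) (S : set B) : Prop :=
  exists n (a : 'I_n -> B),
    [/\ injective a, range a = atoms S &
        forall delta eps : 'I_n -> bool,
          r (\join_(i < n | delta i) a i) (\join_(i < n | eps i) a i) <->
          antilex <%O delta eps].

Definition natural_bool_orderings : set (relspace B) :=
  [set r | strict_linear_order (rel_of r) /\
    forall S, finite_subalgebra S -> natural_bool_on (rel_of r) S].

Lemma boolalg_aut_le g x y : boolalg_aut_set g -> (g x <= g y) = (x <= y).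
Proof.
by case=> _ _ gI _ _; rewrite !leEmeet -gI (can_eq (symgK g)).
Qed.

Lemma boolalg_aut_gt0 g x : boolalg_aut_set g -> (\bot < g x) = (\bot < x).
Proof.
case=> g0 _ _ _ _; rewrite !lt0x.
by rewrite -[X in _ != X]g0 (can_eq (symgK g)).
Qed.

Lemma boolalg_aut_subalgebra g S :
  boolalg_aut_set g -> finite_subalgebra S -> finite_subalgebra (g @` S).
Proof.
case=> [g0 g1 gI gU gC] [Sfin [S0 S1] SI SU SC]; split.
- exact: finite_image.
- by split; [exists \bot|exists \top].
- by move=> _ _ [x Sx <-] [y Sy <-]; exists (x `&` y); [exact: SI|].
- by move=> _ _ [x Sx <-] [y Sy <-]; exists (x `|` y); [exact: SU|].
- by move=> _ [x Sx <-]; exists (~` x); [exact: SC|].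
Qed.

Lemma boolalg_aut_atoms g S :
  boolalg_aut_set g -> atoms (g @` S) = g @` atoms S.
Proof.
move=> gaut; apply/seteqP; split => y /=.
  move=> [[x Sx <-] x0 xmin]; exists x => //; split => //.
    by rewrite -(boolalg_aut_gt0 _ gaut).
  move=> z Sz z0 zx; apply: (can_inj (symgK g)); apply: xmin.
  - by exists z.
  - by rewrite boolalg_aut_gt0.
  - by rewrite boolalg_aut_le.
move=> [x [Sx x0 xmin] <-]; split; first by exists x.
  by rewrite boolalg_aut_gt0.
move=> _ [z Sz <-]; rewrite boolalg_aut_gt0 // boolalg_aut_le // => z0 zx.
by rewrite (xmin z).
Qed.

Lemma natural_bool_orderings_invariant g r :
  boolalg_aut_set g -> natural_bool_orderings r ->
  natural_bool_orderings (relspace_act g r).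
Proof.
move=> gaut [rlin rnat]; split; first exact: strict_linear_order_act.
move=> S Ssub; have gVaut := boolalg_autV gaut.
have [n [a [ainj arange aP]]] := rnat _ (boolalg_aut_subalgebra gVaut Ssub).
exists n, (g \o a); split.
- exact: inj_comp (can_inj (symgK g)) ainj.
- rewrite -(image_comp a g) arange boolalg_aut_atoms // image_comp.
  by rewrite (_ : g \o _ = id) ?image_id//; apply/funext/symgVK.
move=> delta eps; rewrite -aP /rel_of /relspace_act /=.
have [V0 _ _ VU _] := gVaut.
by rewrite !(big_morph _ VU V0); under eq_bigr do rewrite symgK;
  under [X in _ (_, X)]eq_bigr do rewrite symgK.
Qed.

Definition natural_bool_act :
    boolalg_aut -> natural_bool_orderings -> natural_bool_orderings :=
  restricted_act (H := boolalg_aut) natural_bool_orderings_invariant.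

End BooleanAlgebra.

(* Main.v *)
Require Import Defs.
From mathcomp Require Import all_boot all_order all_algebra.
From mathcomp Require Import all_classical topology.
From mathcomp Require Import zify.

(** The proof follows Kechris, Pestov and Todorcevic.  Fix an ordering [r] in the
    space [A] and a minimal flow [Y].  If, for every finite piece of an ordering,
    every 2-colouring of its copies in [r] is constant on the copies inside a
    copy of a prescribed larger piece, then compactness yields a point [y] of [Y]
    such that nearby translates of [r] have nearby translates of [y]; hence
    [g r |-> g y] extends to a continuous equivariant map from [A] to [Y].

    The Ramsey property needed for finite vector spaces is the theorem of Graham,
    Leeb and Rothschild, that for finite Boolean algebras is the dual Ramsey
    theorem.  Both are instances of one theorem on parameter words: an
    order-preserving embedding is a matrix in reduced echelon form, respectively
    a rigid surjection, read row by row, and composition is substitution.  The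
    theorem is proved by induction on the number [k] of parameters.  The
    Hales-Jewett theorem makes the colour of a word depend only on the part
    before its last new parameter, which is a word with [k - 1] parameters but of
    variable length; the dependence on the length is removed by the pigeonhole
    principle.  Products of the ordinary Ramsey theorem, which handle equivalence
    relations, follow from the dual one. *)

(** What ties words to flows in (ii) and (iii) is rigidity: a finite linear order has no increasing
    self-map but the identity, so with respect to a given ordering a finite piece has exactly one
    natural frame. Hence copies of a piece inside a larger one correspond to parameter words, and a
    colouring of copies is a colouring of words. Moreover an automorphism takes any frame to any
    other frame of the same size, so each finite pattern of one ordering occurs in every other one;
    this makes the space of orderings minimal. Two colours are enough because the question asked
    about a copy is whether the corresponding translate of a point of the flow falls into an open
    set, saturated under the pointwise stabilizer of the piece. For equivalence relations,
    lexicographically ordered grids of representatives play the role of frames. *)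

Set Implicit Arguments.
Unset Strict Implicit.
Unset Printing Implicit Defensive.

Local Open Scope classical_set_scope.

(** * The Hales-Jewett theorem *)

Section HalesJewett.
Variable L : eqType.

Fixpoint words (A : seq L) n : seq (seq L) :=
  if n is m.+1 then [seq a :: w | a <- A, w <- words A m] else [:: [::]].

Lemma mem_words A n w : (w \in words A n) = (size w == n) && all (mem A) w.
Proof.
elim: n w => [|n IHn] [|a w] //=; first by apply/allpairsP => -[[]] ? ? [].
rewrite eqSS; apply/allpairsP/idP => [[[b v] /= [bA vW [-> ->]]]|].
  by move: vW; rewrite IHn bA.
by case/and3P=> sw aA wA; exists (a, w); rewrite /= IHn sw wA.
Qed.

(** Recording the colours of finitely many words as one element of a finite type lets a single
    application of a Ramsey statement treat all of them simultaneously. *)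
Definition pack (C : finType) (ws : seq (seq L)) (c : seq L -> C) :
  {ffun 'I_(size ws) -> C} := [ffun i => c (nth [::] ws (val i))].

Lemma packP (C : finType) (ws : seq (seq L)) (c c' : seq L -> C) :
  pack ws c = pack ws c' -> {in ws, c =1 c'}.
Proof.
move=> /ffunP cc' w; rewrite -index_mem => ww.
by have := cc' (Ordinal ww); rewrite !ffunE /= nth_index // -index_mem.
Qed.

(** Variable words in one variable, written [None]. *)
Definition inst (a : L) (t : seq (option L)) : seq L := [seq odflt a l | l <- t].

Definition line (A : seq L) (t : seq (option L)) : bool :=
  (None \in t) && all (fun l => if l is Some a then a \in A else true) t.

Lemma inst_Some a w : inst a (map Some w) = w.
Proof. by rewrite /inst -map_comp map_id_in. Qed.

Lemma inst_cat a s t : inst a (s ++ t) = inst a s ++ inst a t.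
Proof. exact: map_cat. Qed.

Lemma size_inst a t : size (inst a t) = size t.
Proof. exact: size_map. Qed.

Lemma inst_words A a t : a \in A -> line A t -> inst a t \in words A (size t).
Proof.
move=> aA /andP[_ /allP tA]; rewrite mem_words size_inst eqxx /=.
by apply/allP => _ /mapP[[b|] lt ->] //=; exact: (tA _ lt).
Qed.

Lemma words_Some A n w : w \in words A n ->
  all (fun l => if l is Some a then a \in A else true) (map Some w).
Proof. by rewrite mem_words all_map => /andP[_]. Qed.

Lemma sub_line (A A' : seq L) t : {subset A <= A'} -> line A t -> line A' t.
Proof.
move=> sAA' /andP[Nt /allP tA]; rewrite /line Nt; apply/allP => -[a|] //.
by move=> /tA /sAA'.
Qed.

Lemma line_catl A s w n : line A s -> w \in words A n -> line A (s ++ map Some w).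
Proof.
move=> /andP[Ns sA] /words_Some wA.
by rewrite /line mem_cat Ns all_cat sA.
Qed.

Lemma line_catr A t w n : line A t -> w \in words A n -> line A (map Some w ++ t).
Proof.
move=> /andP[Nt tA] /words_Some wA.
by rewrite /line mem_cat Nt orbT all_cat tA wA.
Qed.

Lemma line_cat A s t : line A s -> line A t -> line A (s ++ t).
Proof.
move=> /andP[Ns sA] /andP[Nt tA].
by rewrite /line mem_cat Ns all_cat sA.
Qed.

Definition hales_jewett (A : seq L) : Prop :=
  forall C : finType, exists N, forall c : seq L -> C, exists t,
    [/\ size t = N, line A t &
        exists chi, forall a, a \in A -> c (inst a t) = chi].

(** The lines in [ps] have pairwise different colours on [A] and all reach [f] when the variable
    becomes [a]. So [f] either has the colour of one of them, which makes that line monochromatic on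
    [a :: A], or its colour is new and yields one more line. The letter [b] is a reference point for
    the common colour on [A]. *)
Lemma color_focusing (A : seq L) a b (C : finType) r :
  hales_jewett A -> b \in A ->
  exists N, forall c : seq L -> C,
    (exists t, [/\ size t = N, line (a :: A) t &
       exists chi, forall y, y \in a :: A -> c (inst y t) = chi]) \/
    (exists f (ps : seq (seq (option L) * C)),
       [/\ size ps = r, uniq (map snd ps), f \in words (a :: A) N &
        forall p, p \in ps -> [/\ size p.1 = N, line (a :: A) p.1,
          inst a p.1 = f & forall y, y \in A -> c (inst y p.1) = p.2]]).
Proof.
move=> hj bA; elim: r => [|r [n IHr]].
  by exists 0 => c; right; exists [::], [::].
pose W := words (a :: A) n.
have [n' hjn'] := hj {ffun 'I_(size W) -> C}.
exists (n' + n) => c.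
(* Along [s] the letters of [A] are interchangeable, whatever word of [W] follows; so the colouring
   [c'] of the tails, taken at [b], is valid for every letter of [A]. *)
have [s [szs lines [chi schi]]] := hjn' (fun w => pack W (fun v => c (w ++ v))).
pose c' v := c (inst b s ++ v).
have sA : {subset A <= a :: A} by move=> y yA; rewrite inE yA orbT.
have lines' := sub_line sA lines.
have cs y v : y \in A -> v \in W -> c (inst y s ++ v) = c' v.
  move=> yA vW; have := schi _ yA; rewrite -(schi _ bA) => /packP.
  by move=> /(_ _ vW).
have bs : inst b s \in words (a :: A) n'.
  by rewrite -szs inst_words // sA.
have as_ : inst a s \in words (a :: A) n'.
  by rewrite -szs inst_words // inE eqxx.
have mono t : size t = n -> line (a :: A) t ->
    (exists chi, forall y, y \in a :: A -> c' (inst y t) = chi) ->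
    exists t, [/\ size t = n' + n, line (a :: A) t &
       exists chi, forall y, y \in a :: A -> c (inst y t) = chi].
  move=> szt linet [chi' tchi]; exists (map Some (inst b s) ++ t); split.
  - by rewrite size_cat size_map size_inst szs szt.
  - exact: line_catr bs.
  - by exists chi' => y yA; rewrite inst_cat inst_Some -[RHS](tchi y yA).
case: (IHr c') => [[t [szt linet tmono]]|[f [ps [szps ups fW psP]]]].
  by left; exact: mono linet tmono.
have [|fN] := boolP (c' f \in map snd ps).
  case/mapP=> p pps fp; left; have [szp linep pf pA] := psP _ pps.
  apply: (mono p.1) => //; exists p.2 => y; rewrite inE => /predU1P[->|/pA //].
  by rewrite pf.
(* The new line freezes the tail at [f]; the old ones move along [s] and along their own variable at
   once. All of them meet at [inst a s ++ f]. *)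
right; exists (inst a s ++ f).
exists ((s ++ map Some f, c' f) :: [seq (s ++ p.1, p.2) | p <- ps]); split.
- by rewrite /= size_map szps.
- by rewrite /= -map_comp (eq_map (g := snd)) // fN.
- move: as_ fW; rewrite !mem_words size_cat all_cat => /andP[/eqP-> ->].
  by case/andP=> /eqP-> ->; rewrite eqxx.
move=> p; rewrite inE => /predU1P[->|/mapP[q qps ->]] /=.
  split; first by move: fW; rewrite mem_words size_cat size_map szs => /andP[/eqP->].
  - exact: line_catl fW.
  - by rewrite inst_cat inst_Some.
  - by move=> y yA; rewrite inst_cat inst_Some cs.
have [szq lineq qf qA] := psP _ qps; split.
- by rewrite size_cat szs szq.
- exact: line_cat.
- by rewrite inst_cat qf.
move=> y yA; rewrite inst_cat cs ?qA //.
by rewrite /W -szq inst_words // sA.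
Qed.

Theorem Hales_Jewett (A : seq L) : hales_jewett A.
Proof.
elim: A => [|a A IHA] C.
  by exists 1 => c; exists [:: None]; split=> //; exists (c [::]).
case: A IHA => [|b A] IHA.
  exists 1 => c; exists [:: None]; split=> //; exists (c [:: a]) => y.
  by rewrite inE => /eqP->.
(* There cannot be more focused lines with distinct colours than colours. *)
have [N hN] := color_focusing a C #|C|.+1 IHA (mem_head b A).
exists N => c; case: (hN c) => // -[f [ps [szps ups _ _]]].
have : size (map snd ps) <= #|C| by rewrite -(card_uniqP ups) max_card.
by rewrite size_map szps ltnn.
Qed.

End HalesJewett.

(** * Ramsey theorem for parameter words *)

Section ParameterWords.
Variables (L : eqType) (x : nat -> L) (A : nat -> pred L).

(** For [A k = {0, ..., k-1}] and [x k = k] these are the rigid surjections, for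
    [A k = F^k] and [x k] the unit vectors the matrices in reduced echelon form,
    read row by row. *)
Inductive pword (i : nat) : seq L -> nat -> Prop :=
| PwNil : pword i [::] i
| PwConst S k a of pword i S k & A k a : pword i (rcons S a) k
| PwVar S k of pword i S k : pword i (rcons S (x k)) k.+1.

Lemma pword_letters i S k : (forall j a, A j a -> A j.+1 a) ->
  (forall j, A j.+1 (x j)) -> pword i S k -> all (A k) S.
Proof.
move=> mono par; have monos T j : all (A j) T -> all (A j.+1) T.
  by apply: sub_all => a; exact: mono.
elim=> // {}S {}k; first by move=> a _ IH aA; rewrite all_rcons IH andbT.
by move=> _ /monos IH; rewrite all_rcons IH andbT; exact: par.
Qed.

(** [sub S a] substitutes the entries of [S] for the parameters in [a]: a lookup in the Boolean
    case, a linear combination in the vector case. Since [x k] belongs to [A k.+1] but not to [A k],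
    the place where a parameter is introduced can be seen in the word. By [letter0] a word without
    parameters is determined by its length, which starts the induction. *)
Record parameter_system (sub : seq L -> L -> L) : Prop := {
  sub_par : forall S i, i < size S -> sub S (x i) = nth (x 0) S i;
  sub_cat : forall S S1 a, A (size S) a -> sub (S ++ S1) a = sub S a;
  sub_letter : forall S k a, pword 0 S k -> A (size S) a -> A k (sub S a);
  sub_onto : forall S k b, pword 0 S k -> A k b ->
    exists2 a, A (size S) a & sub S a = b;
  sub_comp : forall T S k a, pword 0 T (size S) -> pword 0 S k ->
    A (size T) a -> sub (map (sub S) T) a = sub S (sub T a);
  letter_fin : forall k, exists s : seq L, forall a, A k a -> a \in s;
  letter_mono : forall k a, A k a -> A k.+1 a;
  letter_par : forall k, A k.+1 (x k);
  letter_parN : forall j q, j <= q -> ~~ A j (x q);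
  letter0 : forall a b, A 0 a -> A 0 b -> a = b
}.

(** * Composition and truncation of parameter words *)

Variable sub : seq L -> L -> L.
Hypothesis sys : parameter_system sub.

(** For matrices read row by row this is the product of [R] and [S]; for rigid surjections it is [S]
    after [R]. *)
Definition wcomp (R S : seq L) : seq L := map (sub S) R.

Definition trunc (q : nat) (R : seq L) : seq L := take (index (x q) R) R.

Lemma size_wcomp R S : size (wcomp R S) = size R.
Proof. exact: size_map. Qed.

Lemma wcomp_cat R R' S : wcomp (R ++ R') S = wcomp R S ++ wcomp R' S.
Proof. exact: map_cat. Qed.

Lemma letter_le i j a : i <= j -> A i a -> A j a.
Proof.
move=> /subnK <-; elim: (j - i) => // m IHm /IHm; rewrite addSn.
exact: (letter_mono sys).
Qed.

Lemma par_inj : injective x.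
Proof.
suff lt i j : i < j -> x i <> x j.
  by move=> i j xij; case: (ltngtP i j) => // /lt; rewrite xij.
move=> ij xij; have := letter_parN sys ij.
by rewrite -xij (letter_par sys).
Qed.

Lemma pword_le i S k : pword i S k -> i <= k.
Proof. by elim=> // {}S {}k _ /leqW. Qed.

Lemma pword_size i S k : pword i S k -> k <= i + size S.
Proof.
elim=> [|{}S {}k a _ IH _|{}S {}k _ IH]; first by rewrite addn0.
  by rewrite size_rcons addnS (leq_trans IH).
by rewrite size_rcons addnS ltnS.
Qed.

Lemma pword_cat i S j S' k : pword i S j -> pword j S' k -> pword i (S ++ S') k.
Proof.
move=> Sij; elim=> [|{}S' {}k a _ IH ak|{}S' {}k _ IH]; first by rewrite cats0.
  by rewrite -rcons_cat; apply: PwConst.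
by rewrite -rcons_cat; apply: PwVar.
Qed.

Lemma pword_cons i S k : pword i.+1 S k -> pword i (x i :: S) k.
Proof.
rewrite -cat1s; apply: pword_cat.
by rewrite -[_ :: _]/(rcons [::] _); apply: PwVar; apply: PwNil.
Qed.

Lemma pword_const i S : all (A i) S -> pword i S i.
Proof.
elim/last_ind: S => [_|S a IHS]; first exact: PwNil.
by rewrite all_rcons => /andP[aA /IHS]; move/PwConst; apply.
Qed.

Lemma pword_iota i n : pword i [seq x j | j <- iota i n] (i + n).
Proof.
elim: n => [|n IHn]; first by rewrite addn0; apply: PwNil.
by rewrite -addn1 iotaD map_cat cats1 addnA addn1; apply: PwVar.
Qed.

Lemma pwordP i S k q : pword i S k -> i <= q < k ->
  exists S1 S2, [/\ S = S1 ++ x q :: S2, pword i S1 q & pword q.+1 S2 k].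
Proof.
elim=> [|{}S {}k a _ IH ak|{}S {}k Sk IH] iq; first by lia.
  have [S1 [S2 [-> S1q S2k]]] := IH iq.
  by exists S1, (rcons S2 a); rewrite -rcons_cons rcons_cat; split => //; exact: PwConst.
have [qk|kq] := ltnP q k.
  have [|S1 [S2 [-> S1q S2k]]] := IH; first by case/andP: iq => ->.
  by exists S1, (rcons S2 (x k)); rewrite -rcons_cons rcons_cat; split => //; exact: PwVar.
have -> : q = k by lia.
by exists S, [::]; rewrite cats1; split => //; exact: PwNil.
Qed.

Lemma pword_notin i S k q : k <= q -> pword i S k -> x q \notin S.
Proof.
move=> + Sk; elim: Sk => // {}S {}k.
  move=> a _ IH ak kq; rewrite mem_rcons inE negb_or IH // andbT.
  by apply: contraTneq ak => <-; exact: (letter_parN sys).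
move=> _ IH kq; rewrite mem_rcons inE negb_or IH ?(ltnW kq) // andbT.
by apply: contraTneq kq => /par_inj ->; rewrite ltnn.
Qed.

Lemma trunc_cat q i S1 S2 : pword i S1 q -> trunc q (S1 ++ x q :: S2) = S1.
Proof.
move=> /(pword_notin (leqnn q)) xS1.
by rewrite /trunc index_cat (negPf xS1) /= eqxx addn0 take_size_cat.
Qed.

Lemma pword_trunc R k q : pword 0 R k -> q < k ->
  pword 0 (trunc q R) q /\ exists R2, R = trunc q R ++ x q :: R2 /\ pword q.+1 R2 k.
Proof.
move=> Rk qk; have [|S1 [S2 [-> S1q S2k]]] := pwordP Rk (q := q); first by rewrite qk.
by rewrite (trunc_cat _ S1q); split=> //; exists S2.
Qed.

(** Only parameters below [k] occur in [R], so the entries of [S1] are never looked up. *)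
Lemma eq_comp_cat q R k S S1 : pword q R k -> size S = k ->
  wcomp R (S ++ S1) = wcomp R S.
Proof.
move=> Rk; elim: Rk S S1 => [//|{}R {}k a _ IH ak|{}R {}k _ IH] S S1 sS.
  by rewrite /wcomp !map_rcons -!/(wcomp _ _) IH // (sub_cat sys) // sS.
rewrite /wcomp !map_rcons -!/(wcomp _ _).
case/lastP: S sS => // S s; rewrite size_rcons => -[sS].
rewrite cat_rcons -(cats1 S s) !IH // !(sub_par sys) ?size_cat ?sS /=; last 2 first.
- by rewrite addn1.
- by rewrite addnS ltnS leq_addr.
by rewrite !nth_cat sS ltnn subnn.
Qed.

Lemma pword_last S s k : pword 0 (rcons S s) k ->
  (pword 0 S k /\ A k s) \/ (exists k', [/\ k = k'.+1, pword 0 S k' & s = x k']).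
Proof.
move eS': (rcons S s) => S' Sk; case: Sk eS' => [|S0 k0 a S0k ak|S0 k0 S0k].
- by case: (S).
- by move=> /rcons_inj[-> ->]; left.
- by move=> /rcons_inj[-> ->]; right; exists k0.
Qed.

Lemma pword_comp R q S k : pword 0 R q -> pword 0 S k -> size S = q ->
  pword 0 (wcomp R S) k.
Proof.
move=> Rq; elim: Rq S k => [|{}R {}q a Rq IH aq|{}R {}q Rq IH] S k Sk sS.
- by case: S sS Sk.
- rewrite /wcomp map_rcons -/(wcomp _ _); apply: PwConst; first exact: IH.
  by apply: (sub_letter sys) => //; rewrite sS.
case/lastP: S sS Sk => // S s; rewrite size_rcons => -[sS] Sk.
rewrite /wcomp map_rcons -/(wcomp _ _) -(cats1 S s) (eq_comp_cat _ Rq) // cats1.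
rewrite (sub_par sys) ?size_rcons ?sS // nth_rcons sS ltnn eqxx.
case/pword_last: Sk => [[Sk sk]|[k' [-> Sk' ->]]].
  by apply: PwConst => //; exact: IH.
by apply: PwVar; exact: IH.
Qed.

(** The parameters that [R] introduces are numbered from [q] on, so they are replaced by entries of
    [u], which bring in no parameter beyond the first [j]. *)
Lemma wcomp_const q R k S1 u j : pword q R k -> size S1 = q -> size (S1 ++ u) = k ->
  pword 0 S1 j -> all (A j) u -> all (A j) (wcomp R (S1 ++ u)).
Proof.
move=> Rk sS1 + S1j; elim: Rk u => [//|{}R {}k a Rk IH ak|{}R {}k Rk IH] u su uA.
  rewrite /wcomp map_rcons all_rcons -/(wcomp _ _) IH // andbT.
  apply: (sub_letter sys); last by rewrite su.
  by apply: pword_cat S1j _; exact: pword_const.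
case/lastP: u su uA => [|u s].
  move=> + _; rewrite cats0 sS1 => qk.
  by have := pword_le Rk; rewrite qk ltnn.
rewrite -rcons_cat size_rcons all_rcons => -[su] /andP[sA uA].
rewrite /wcomp map_rcons all_rcons -/(wcomp _ _) -(cats1 (S1 ++ u) s) (eq_comp_cat _ Rk) // IH // andbT.
by rewrite cats1 (sub_par sys) ?size_rcons ?su // nth_rcons su ltnn eqxx.
Qed.

Lemma wcompA T R S k : pword 0 T (size R) -> pword 0 R (size S) -> pword 0 S k ->
  wcomp (wcomp T R) S = wcomp T (wcomp R S).
Proof.
move=> TR RS Sk.
suff H T' q : pword 0 T' q -> q <= size R -> wcomp (wcomp T' R) S = wcomp T' (wcomp R S).
  exact: H TR (leqnn _).
have RD : forall a, A (size R) a -> sub (wcomp R S) a = sub S (sub R a).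
  by move=> a; apply: (sub_comp sys) Sk.
elim=> [//|{}T' {}q a _ IH aq|{}T' {}q _ IH] qR.
  by rewrite /wcomp !map_rcons -!/(wcomp _ _) IH // RD // (letter_le qR).
rewrite /wcomp !map_rcons -!/(wcomp _ _) IH ?(ltnW qR) //.
rewrite !(sub_par sys) ?size_wcomp //.
by congr rcons; rewrite /wcomp (nth_map (x 0)).
Qed.

Lemma size_pars n : size [seq x j | j <- iota 0 n] = n.
Proof. by rewrite size_map size_iota. Qed.

Lemma wcomp_pars n S : size S = n -> wcomp [seq x j | j <- iota 0 n] S = S.
Proof.
move=> <-; apply: (@eq_from_nth _ (x 0)); first by rewrite size_wcomp size_pars.
move=> i; rewrite size_wcomp size_pars => iS.
rewrite (nth_map (x 0)) ?size_pars // (nth_map 0) ?size_iota // nth_iota //.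
exact: (sub_par sys).
Qed.

Lemma wcomp_pars_cat n S S1 : size S = n ->
  wcomp [seq x j | j <- iota 0 n] (S ++ S1) = S.
Proof.
by move=> sS; rewrite (eq_comp_cat _ (pword_iota 0 n)) ?wcomp_pars.
Qed.

(** Letters of [R] before its parameter number [size T1] look up entries of [T1] only, where [x q]
    does not occur; that parameter itself becomes [x q]. The lemma shows how the lengths of
    truncations change under composition. *)
Lemma trunc_comp R m T1 q T2 k : pword 0 R m -> size (T1 ++ x q :: T2) = m ->
  pword 0 (T1 ++ x q :: T2) k -> pword 0 T1 q ->
  trunc q (wcomp R (T1 ++ x q :: T2)) = wcomp (trunc (size T1) R) T1.
Proof.
move=> Rm sT Tk T1q.
have lt : size T1 < m by rewrite -sT size_cat /= addnS ltnS leq_addr.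
have [R1 [R2 [eR _]]] := pword_trunc Rm lt.
rewrite [in LHS]eR wcomp_cat (eq_comp_cat _ R1) // /wcomp /= -!/(wcomp _ _).
rewrite (sub_par sys) ?sT // nth_cat ltnn subnn /=.
by apply: trunc_cat; apply: pword_comp R1 T1q _.
Qed.

Lemma pword_split S k : pword 0 S k.+1 ->
  exists S' u, [/\ S = S' ++ x k :: u, pword 0 S' k & all (A k.+1) u].
Proof.
move=> Sk; have [|S1 [S2 [-> S1k S2k]]] := pwordP Sk (q := k).
  by rewrite leqnn.
exists S1, S2; split => //.
suff H j T : pword k.+1 T j -> j <= k.+1 -> all (A k.+1) T by exact: H S2k _.
elim=> // {}T {}j.
  by move=> a _ IH aj jk; rewrite all_rcons IH // (letter_le jk).
by move=> Tj _ jk; have := pword_le Tj; lia.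
Qed.

Local Notation pars i n := [seq x j | j <- iota i n].

Lemma pword_all i S k : pword i S k -> all (A k) S.
Proof. by apply: pword_letters; [exact: (letter_mono sys)|exact: (letter_par sys)]. Qed.

Lemma letter_par0 q : 0 < q -> A q (x 0).
Proof. by move=> q0; apply: (letter_le q0); exact: (letter_par sys). Qed.

Lemma letter_seq k : exists s : seq L, forall a, (a \in s) = A k a.
Proof.
have [s sA] := letter_fin sys k; exists [seq a <- s | A k a] => a.
by rewrite mem_filter; case: (boolP (A k a)) => // /sA ->.
Qed.

Lemma pword_fin k n : exists ws : seq (seq L), forall S,
  size S = n -> pword 0 S k -> S \in ws.
Proof.
have [s sA] := letter_seq k; exists (words s n) => S sS Sk.
rewrite mem_words sS eqxx /=; apply: sub_all (pword_all Sk) => a.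
by rewrite /= sA.
Qed.

(** Words with parameters numbered from [0], written [inr j]. *)
Definition sinst (b : nat -> L) (t : seq (L + nat)) : seq L :=
  [seq match l with inl a => a | inr j => b j end | l <- t].

Lemma pword_line j s : None \in s ->
  all (fun l => if l is Some a then A j a else true) s ->
  pword j (inst (x j) s) j.+1.
Proof.
elim: s => // -[a|] s IHs; rewrite inE /=.
  move=> sN /andP[ja js]; rewrite -cat1s; apply: pword_cat (IHs sN js).
  by apply: pword_const; rewrite /= ja.
move=> _ js; apply/pword_cons/pword_const/allP => b /mapP[[a|] lt ->] /=.
  by apply: (letter_mono sys); exact: (allP js _ lt).
exact: (letter_par sys).
Qed.

(** Each variable gets a block of its own, so the variables first occur in the order of their
    numbers, as [pword] demands. The last block is found for all words over the earlier blocks at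
    once, by packing their colours. *)
Lemma Hales_Jewett_multi q d : 0 < q -> forall C : finType, exists N,
  forall c : seq L -> C, exists t,
  [/\ size t = N,
      all (fun l => match l with inl a => A q a | inr j => j < d end) t,
      pword q (sinst (fun j => x (q + j)) t) (q + d) &
      exists chi, forall b, (forall j, j < d -> A q (b j)) -> c (sinst b t) = chi].
Proof.
move=> q0; elim: d => [|d IHd] C.
  exists 0 => c; exists [::]; split => //; first by rewrite addn0; exact: PwNil.
  by exists (c [::]).
have [N hN] := IHd C; have [s sA] := letter_seq q.
pose W := words s N.
have [N' hN'] := Hales_Jewett s {ffun 'I_(size W) -> C}.
exists (N + N') => c.
have [l [szl /andP[Nl lA] [chi lchi]]] := hN' (fun v => pack W (fun w => c (w ++ v))).
have xs : x 0 \in s by rewrite sA letter_par0.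
have [t [szt tA tw [chi' tchi]]] := hN (fun w => c (w ++ inst (x 0) l)).
pose l' := [seq (if o is Some a then inl a else inr d : L + nat) | o <- l].
have l'E b : sinst b l' = inst (b d) l.
  by rewrite /sinst /inst -map_comp; apply: eq_map => -[].
exists (t ++ l'); split.
- by rewrite size_cat szt size_map szl.
- rewrite all_cat; apply/andP; split.
    by apply: sub_all tA => -[//|j] /ltnW.
  by rewrite all_map; apply: sub_all lA => -[a|] //=; rewrite sA.
- rewrite /sinst map_cat -!/(sinst _ _) l'E addnS.
  apply: pword_cat tw _; apply: pword_line => //; apply: sub_all lA => -[a|] //=.
  by rewrite sA; apply: letter_le; exact: leq_addr.
exists chi' => b bA; rewrite /sinst map_cat -!/(sinst _ _) l'E.
rewrite -(tchi b) => [|j /ltnW]; last exact: bA.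
have bds : b d \in s by rewrite sA bA.
have /packP := etrans (lchi _ bds) (esym (lchi _ xs)); apply.
rewrite mem_words size_map szt eqxx; apply/allP => a /mapP[[a'|j] lt ->] /=.
  by rewrite sA; exact: (allP tA _ lt).
by rewrite sA bA //; apply/ltnW/(allP tA _ lt).
Qed.

Lemma sub_onto_seq S k u : pword 0 S k -> all (A k) u ->
  exists bs, [/\ size bs = size u, all (A (size S)) bs & map (sub S) bs = u].
Proof.
move=> Sk; elim: u => [|b u IHu]; first by exists [::].
case/andP=> /(sub_onto sys Sk)[a aA ab] /IHu[bs [sbs bsA bsu]].
by exists (a :: bs); rewrite /= sbs aA bsA ab bsu.
Qed.

(** The letters of [A k.+1] after the last parameter come from different letters
    of [A q.+1] for different [S], but [sub_onto] gives a preimage for each [S];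
    so Hales-Jewett over [A q.+1] handles all [S] at once. *)
Lemma stabilize_step k q (C : finType) M : q < M -> exists M', forall c : seq L -> C,
  exists t, [/\ q.+1 + size t = M', pword q.+1 t M &
    forall S u1 u2, size S = q -> pword 0 S k -> size u1 = M - q.+1 ->
      size u2 = size u1 -> all (A k.+1) u1 -> all (A k.+1) u2 ->
      c (wcomp (pars 0 q.+1 ++ t) (S ++ x k :: u1)) =
      c (wcomp (pars 0 q.+1 ++ t) (S ++ x k :: u2))].
Proof.
move=> qM; have [ws hws] := pword_fin k q.
have [N hN] := Hales_Jewett_multi (M - q.+1) (ltn0Sn q) {ffun 'I_(size ws) -> C}.
exists (q.+1 + N) => c.
have [t [szt tA tw [chi tchi]]] := hN (fun w => pack ws
  (fun S => c (S ++ x k :: map (sub (rcons S (x k))) w))).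
exists (sinst (fun j => x (q.+1 + j)) t); split.
- by rewrite size_map szt.
- by move: tw; rewrite subnKC.
move=> S u1 u2 sS Sk su1 su2 u1A u2A.
have E u : size u = M - q.+1 -> all (A k.+1) u -> exists2 b,
    forall j, j < M - q.+1 -> A q.+1 (b j) &
    wcomp (pars 0 q.+1 ++ sinst (fun j => x (q.+1 + j)) t) (S ++ x k :: u) =
    S ++ x k :: map (sub (rcons S (x k))) (sinst b t).
  move=> su uA; have Sk' : pword 0 (rcons S (x k)) k.+1 by exact: PwVar.
  have [bs [sbs bsA bsu]] := sub_onto_seq Sk' uA.
  have szS : size (rcons S (x k)) = q.+1 by rewrite size_rcons sS.
  exists (nth (x 0) bs) => [j jq|].
    by rewrite -szS; apply: (allP bsA); rewrite mem_nth // sbs su.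
  rewrite -cat_rcons wcomp_cat wcomp_pars_cat //.
  rewrite -[in RHS]cat_rcons; congr cat.
  rewrite /wcomp /sinst -!map_comp; apply/eq_in_map => -[a|j] /(allP tA) /=.
    by move=> aA; rewrite (sub_cat sys) // szS.
  move=> jM; rewrite (sub_par sys); last first.
    by rewrite size_cat szS su ltn_add2l.
  rewrite nth_cat szS ltnNge leq_addr /= addKn -bsu.
  by rewrite (nth_map (x 0)) // sbs su.
have [b1 b1A ->] := E _ su1 u1A.
have [|b2 b2A ->] := E u2 _ u2A; first by rewrite su2.
have /packP := etrans (tchi _ b1A) (esym (tchi _ b2A)).
by move=> /(_ S); apply; exact: hws.
Qed.

(** The positions [size S] of the last new parameter are treated one by one. The word [Ts] that
    handles position [q] begins with the bare parameters up to [x q], so composing with it leaves a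
    shorter [S] and its [x k] unchanged; it alters only the tail, to which the word [T] for the
    smaller positions is already indifferent. *)
Lemma stabilize k (C : finType) M : exists n, forall c : seq L -> C,
  exists T, [/\ size T = n, pword 0 T M &
    forall S u1 u2, pword 0 S k -> size (S ++ x k :: u1) = M -> size u2 = size u1 ->
      all (A k.+1) u1 -> all (A k.+1) u2 ->
      c (wcomp T (S ++ x k :: u1)) = c (wcomp T (S ++ x k :: u2))].
Proof.
suff H q : forall M, exists n, forall c : seq L -> C,
  exists T, [/\ size T = n, pword 0 T M &
    forall S u1 u2, size S < q -> pword 0 S k -> size (S ++ x k :: u1) = M ->
      size u2 = size u1 -> all (A k.+1) u1 -> all (A k.+1) u2 ->
      c (wcomp T (S ++ x k :: u1)) = c (wcomp T (S ++ x k :: u2))].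
  have [n hn] := H M M; exists n => c; have [T [sT Tw TP]] := hn c.
  exists T; split=> // S u1 u2 Sk sM; apply: TP => //.
  by rewrite -sM size_cat /= addnS ltnS leq_addr.
elim: q => [|q IHq] {}M.
  by exists M => c; exists (pars 0 M); split => //; [exact: size_pars | exact: pword_iota].
have [qM|Mq] := ltnP q M; last first.
  have [n hn] := IHq M; exists n => c; have [T [sT Tw TP]] := hn c.
  exists T; split=> // S u1 u2 Sq Sk sM; apply: TP => //.
  by move: sM; rewrite size_cat /=; lia.
have [M1 hM1] := stabilize_step k C qM.
have [n hn] := IHq M1; exists n => c; have [T [sT Tw TP]] := hn c.
have [t [st tw tP]] := hM1 (fun w => c (wcomp T w)).
pose Ts := pars 0 q.+1 ++ t.
have sTs : size Ts = M1 by rewrite size_cat size_pars.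
have Tsw : pword 0 Ts M by apply: pword_cat tw; exact: pword_iota.
exists (wcomp T Ts); split; [by rewrite size_wcomp|exact: pword_comp Tw Tsw _|].
move=> S u1 u2 Sq Sk sM su u1A u2A.
have wS u : all (A k.+1) u -> pword 0 (S ++ x k :: u) k.+1.
  by move=> uA; apply: pword_cat Sk _; apply/pword_cons/pword_const.
have sM2 : size (S ++ x k :: u2) = M by rewrite -sM !size_cat /= su.
rewrite !(@wcompA _ _ _ k.+1) ?sTs ?sM ?sM2 //; [|exact: wS|exact: wS].
move: Sq; rewrite ltnS leq_eqVlt => /orP[/eqP Sq|Sq].
  apply: tP => //; rewrite -sM size_cat /= Sq; lia.
have E u : all (A k.+1) u -> size (S ++ x k :: u) = M ->
    exists v, [/\ wcomp Ts (S ++ x k :: u) = S ++ x k :: v, all (A k.+1) v &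
                  size S + size v = M1.-1].
  move=> uA su'; pose n' := q - size S.
  have eS : S ++ x k :: u = (S ++ x k :: take n' u) ++ drop n' u.
    by rewrite -catA /= cat_take_drop.
  have su'' : size (S ++ x k :: take n' u) = q.+1.
    move: su'; rewrite !size_cat /= size_take_min /n'; lia.
  have tuA : all (A k.+1) (take n' u) by apply/allP => a /mem_take /(allP uA).
  have eT : wcomp Ts (S ++ x k :: u) = S ++ x k :: (take n' u ++ wcomp t (S ++ x k :: u)).
    by rewrite wcomp_cat {1}eS wcomp_pars_cat // -catA.
  exists (take n' u ++ wcomp t (S ++ x k :: u)); split=> //.
    rewrite all_cat tuA; rewrite eS; apply: wcomp_const tw _ _ _ _ => //.
    - by rewrite -eS.
    - exact: wS.
    - by apply/allP => a /mem_drop /(allP uA).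
  have := congr1 size eT; rewrite size_wcomp sTs size_cat /= => ->; lia.
have [v1 [-> v1A sv1]] := E u1 u1A sM.
have [v2 [-> v2A sv2]] := E u2 u2A sM2.
have M10 : 0 < M1 by rewrite -st addSn.
apply: TP => //; last by lia.
by rewrite size_cat /=; lia.
Qed.

(** * The induction on the number of parameters *)

Definition ramsey_words k : Prop := forall (C : finType) m, exists n,
  forall c : seq L -> C, exists R, [/\ size R = n, pword 0 R m &
    exists chi, forall S, size S = m -> pword 0 S k -> c (wcomp R S) = chi].

(** The higher levels are made monochromatic first, by [R], and then level [M1] of [R] by [Q].
    Continuing [Q] with fresh parameters turns level [M1] into level [M] and shifts the higher ones
    along without disturbing them. *)
Lemma ramsey_levels k : ramsey_words k -> forall (C : finType) i M, exists m,
  forall c : seq L -> C, exists R, [/\ size R = m, pword 0 R (M + i) &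
    exists chi : nat -> C, forall q S, M <= q < M + i -> size S = q -> pword 0 S k ->
      c (wcomp (trunc q R) S) = chi q].
Proof.
move=> rk C; elim=> [|i IHi] M.
  exists M => c; exists (pars 0 M); rewrite addn0; split.
  - exact: size_pars.
  - exact: pword_iota.
  - by exists (fun=> c [::]) => q S; lia.
have [M1 hM1] := rk C M; have [m hm] := IHi M1.+1; exists m => c.
have [R [sR Rw [chi hchi]]] := hm c.
have [|R1w [R2 [eR R2w]]] := pword_trunc Rw (q := M1); first by lia.
have [Q [sQ Qw [chi0 hchi0]]] := hM1 (fun S => c (wcomp (trunc M1 R) S)).
pose T := Q ++ pars M i.+1.
have sT : size T = M1.+1 + i by rewrite size_cat sQ size_map size_iota addnS.
have Tw : pword 0 T (M + i.+1) by apply: pword_cat Qw _; exact: pword_iota.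
exists (wcomp R T); split; [by rewrite size_wcomp|exact: pword_comp Rw Tw _|].
exists (fun q => if q == M then chi0 else chi (q - M + M1)) => q S /andP[Mq qM] sS Sk.
have eT : T = (Q ++ pars M (q - M)) ++ x q :: pars q.+1 (M + i.+1 - q.+1).
  rewrite /T -catA; congr cat; rewrite -map_cons -map_cat; congr map.
  have {1}-> : i.+1 = (q - M) + (1 + (M + i.+1 - q.+1)) by lia.
  by rewrite !iotaD /= subnKC // addn1; congr (_ ++ _ :: iota _ _); lia.
have T1w : pword 0 (Q ++ pars M (q - M)) q.
  by apply: pword_cat Qw _; rewrite -{2}(subnKC Mq); exact: pword_iota.
have sT1 : size (Q ++ pars M (q - M)) = q - M + M1.
  by rewrite size_cat sQ size_map size_iota addnC.
rewrite eT (trunc_comp (k := M + i.+1) Rw) -?eT // sT1.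
have [|P1w _] := pword_trunc Rw (q := q - M + M1); first by lia.
rewrite (@wcompA _ _ _ k) ?sT1 ?sS //.
case: eqP => [eq|neq].
  by rewrite eq subnn add0n cats0; apply: hchi0; rewrite ?sS.
apply: hchi; first by lia.
  by rewrite size_wcomp.
exact: pword_comp T1w Sk sS.
Qed.

(** Composing a word with [T] drops its parameters at the levels outside [P], where [T] has the
    letter [a0]. The others are renumbered consecutively, and [size T1] is the old number of the
    parameter now called [q]. *)
Lemma select_levels q0 a0 (P : pred nat) i : A q0 a0 -> exists T,
  [/\ size T = q0 + i, pword 0 T (q0 + count P (iota q0 i)) &
   forall q, q0 <= q < q0 + count P (iota q0 i) -> exists T1 T2,
   [/\ T = T1 ++ x q :: T2, pword 0 T1 q, q0 <= size T1 < q0 + i & P (size T1)]].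
Proof.
move=> a0A; elim: i => [|i [T [sT Tw TP]]].
  exists (pars 0 q0); rewrite /= !addn0; split.
  - exact: size_pars.
  - exact: pword_iota.
  - by move=> q; lia.
rewrite -[i.+1]addn1 iotaD count_cat /= addn0.
have sub_old l q : q0 <= q < q0 + count P (iota q0 i) -> exists T1 T2,
   [/\ rcons T l = T1 ++ x q :: T2, pword 0 T1 q, q0 <= size T1 < q0 + (i + 1) &
       P (size T1)].
  case/TP => T1 [T2 [-> T1w sT1 PT1]]; exists T1, (rcons T2 l).
  by rewrite rcons_cat; split => //; lia.
have [Pi|Pi] := boolP (P (q0 + i)) => /=.
  exists (rcons T (x (q0 + count P (iota q0 i)))); split.
  - by rewrite size_rcons sT addnA addn1.
  - by rewrite addnA addn1; exact: PwVar.
  move=> q; rewrite addnA addn1 ltnS => /andP[q0q].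
  rewrite leq_eqVlt => /orP[/eqP->|qn]; last by apply: sub_old; rewrite q0q.
  by exists T, [::]; rewrite cats1 sT; split => //; lia.
exists (rcons T a0); rewrite addn0; split => //.
- by rewrite size_rcons sT addnA addn1.
- by apply: PwConst => //; apply: letter_le a0A; exact: leq_addr.
- exact: sub_old.
Qed.

Lemma pigeonhole (C : finType) (c0 : C) (chi : nat -> C) q0 m :
  exists z, m <= count (fun q => chi q == z) (iota q0 (#|C| * m)).
Proof.
have [/existsP[z zP]|/existsPn H] := boolP [exists z,
    m <= count (fun q => chi q == z) (iota q0 (#|C| * m))]; first by exists z.
have : \sum_(z : C) count (fun q => chi q == z) (iota q0 (#|C| * m)) = #|C| * m.
  rewrite -[RHS](size_iota q0); elim: (iota _ _) => [|q s IHs] /=.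
    by rewrite big1.
  by rewrite big_split /= IHs (bigD1 (chi q)) //= eqxx big1 // => z; rewrite eq_sym => /negPf->.
have m0 : 0 < m by have := H c0; rewrite -ltnNge; exact: leq_ltn_trans.
have : \sum_(z : C) count (fun q => chi q == z) (iota q0 (#|C| * m)) <= #|C| * m.-1.
  have -> : #|C| * m.-1 = \sum_(z : C) m.-1.
    by rewrite big_const iter_addn_0 mulnC.
  apply: leq_sum => z _.
  by have := H z; rewrite -ltnNge; lia.
have : 0 < #|C| by apply/card_gt0P; exists c0.
by nia.
Qed.

(** Unwanted levels are dropped by replacing their parameter by a letter; when
    [A 0] is empty this is impossible for the first parameter, which is kept
    ([q0 = 1]). *)
Lemma ramsey_variable_length k : ramsey_words k -> forall (C : finType) M, exists m,
  forall c : seq L -> C, exists R, [/\ size R = m, pword 0 R M &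
    exists chi, forall q S, q < M -> size S = q -> pword 0 S k ->
      c (wcomp (trunc q R) S) = chi].
Proof.
move=> rk C [|M].
  exists 0 => c; exists [::]; split=> //; [exact: PwNil | by exists (c [::])].
suff [|[q0 [a0 [q01 a0A q0N]]]] : (k = 0 /\ forall S, pword 0 S k -> S = [::]) \/
  exists q0 a0, [/\ q0 <= 1, A q0 a0 &
    forall q S, q < q0 -> size S = q -> ~ pword 0 S k].
- case=> -> kN; exists M.+1 => c; exists (pars 0 M.+1); split.
  + exact: size_pars.
  + exact: pword_iota.
  exists (c [::]) => q S qM sS /kN S0; move: sS; rewrite S0 /= => q0.
  have [|Rw _] := pword_trunc (pword_iota 0 M.+1) (q := q); first by lia.
  by rewrite -q0 in Rw *; rewrite (kN _ Rw).
- pose i := #|C| * (M.+1 - q0).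
  have [m hm] := ramsey_levels rk C i q0; exists m => c.
  have [R [sR Rw [chi hchi]]] := hm c.
  have [z hz] := pigeonhole (c [::]) chi q0 (M.+1 - q0).
  have [T [sT Tw TP]] := select_levels (fun q => chi q == z) i a0A.
  pose n := q0 + count (fun q => chi q == z) (iota q0 i).
  have Mn : M.+1 <= n by rewrite /n /i; lia.
  (* More than [M.+1] parameters may survive the selection; [Z] keeps the first [M.+1] and replaces
     the surplus by [x 0]. *)
  pose Z := pars 0 M.+1 ++ nseq (n - M.+1) (x 0).
  have sZ : size Z = n by rewrite size_cat size_pars size_nseq subnKC.
  have nA j : all (A M.+1) (nseq j (x 0)).
    by apply/allP => a /nseqP[-> _]; exact: letter_par0.
  have Zw : pword 0 Z M.+1 by apply: pword_cat (pword_iota 0 M.+1) _; exact: pword_const.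
  have TZw := pword_comp Tw Zw sZ.
  exists (wcomp R (wcomp T Z)); split.
  + by rewrite size_wcomp.
  + by apply: pword_comp Rw TZw _; rewrite size_wcomp.
  exists z => q S qM sS Sk.
  have q0q : q0 <= q by rewrite leqNgt; apply/negP => /q0N /(_ sS).
  have eZ : Z = pars 0 q ++ x q :: (pars q.+1 (M - q) ++ nseq (n - M.+1) (x 0)).
    rewrite /Z -cat_cons catA -map_cons -map_cat; congr (map _ _ ++ _).
    have {1}-> : M.+1 = q + (1 + (M - q)) by lia.
    by rewrite !iotaD /= add0n addn1.
  have [|T1 [T2 [eT T1w sT1 PT1]]] := TP q.
    by rewrite q0q; apply: leq_trans qM Mn.
  have [T3 [T4 [eTZ T3w]]] : exists T3 T4, wcomp T Z = T3 ++ x q :: T4 /\ pword 0 T3 q.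
    have [|T3w [T4 [eT3 _]]] := pword_trunc TZw (q := q) => //.
    by exists (trunc q (wcomp T Z)), T4.
  have eT3 : T3 = wcomp T1 (pars 0 q).
    have <- : trunc q (wcomp T Z) = T3 by rewrite eTZ (trunc_cat _ T3w).
    rewrite eZ (trunc_comp (k := M.+1) Tw) -?eZ //; last exact: pword_iota.
    by rewrite size_pars eT (trunc_cat _ T1w).
  have sT3 : size T3 = size T1 by rewrite eT3 size_wcomp.
  rewrite eTZ (trunc_comp (k := M.+1) Rw) -?eTZ //; last by rewrite size_wcomp.
  have [|P1w _] := pword_trunc Rw (q := size T1); first by case/andP: sT1.
  rewrite sT3 (@wcompA _ _ _ k) ?sT3 ?sS //.
  rewrite hchi ?(eqP PT1) ?size_wcomp //.
  exact: pword_comp T3w Sk sS.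
have [s sA] := letter_seq 0.
have [/hasP[a0 _ a0A]|/hasPn A0] := boolP (has (A 0) s).
  by right; exists 0, a0; split.
(* If [A 0] is empty, a nonempty word must begin with a parameter. For [k = 0] only the empty word
   remains; for positive [k] no word has length 0, so level 0 can be left out. *)
case: k rk => [|k] _.
  left; split=> // S; case/lastP: S => // S a /pword_last[[_ a0]|[k' []//]].
  by have := A0 a; rewrite sA a0 => /(_ isT).
right; exists 1, (x 0); split => // [|[|//] S _ /size0nil -> /pword_size //].
exact: letter_par0.
Qed.

Theorem Ramsey_words k : ramsey_words k.
Proof.
elim: k => [|k rk] C M.
  exists M => c; exists (pars 0 M); split.
  - exact: size_pars.
  - exact: pword_iota.
  have inj S1 S2 : pword 0 S1 0 -> pword 0 S2 0 -> size S1 = size S2 -> S1 = S2.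
    elim/last_ind: S1 S2 => [|S1 a IH] S2; first by move=> _ _ /esym/size0nil.
    case/lastP: S2 => [|S2 b]; first by rewrite size_rcons.
    move=> /pword_last[[S1w a0]|[? []//]] /pword_last[[S2w b0]|[? []//]].
    by rewrite !size_rcons => -[/IH ->] //; rewrite (letter0 sys a0 b0).
  have [[S0 [sS0 S0w]]|nS] := EM (exists S0, size S0 = M /\ pword 0 S0 0); last first.
    by exists (c [::]) => S sS Sw; case: nS; exists S.
  exists (c (wcomp (pars 0 M) S0)) => S sS Sw.
  by rewrite (inj S S0) // sS.
have [m hm] := ramsey_variable_length rk C M.
have [n hn] := stabilize k C m; exists n => c.
have [T [sT Tw TP]] := hn c.
(* By the choice of [T] the letters after the last new parameter do not matter; padding with [x 0]
   therefore gives a meaningful colour to words with [k] parameters of every length below [m]. *)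
pose c' S := c (wcomp T (S ++ x k :: nseq (m - (size S).+1) (x 0))).
have [R [sR Rw [chi hchi]]] := hm c'.
exists (wcomp T R); split; [by rewrite size_wcomp|exact: pword_comp Tw Rw _|].
exists chi => S sS Sk.
have [S' [u [eS S'k uA]]] := pword_split Sk.
rewrite (@wcompA _ _ _ k.+1) ?sR ?sS //.
pose q := size S'.
have qM : q < M by rewrite -sS eS size_cat /= addnS ltnS leq_addr.
have [R1w [R2 [eR R2w]]] := pword_trunc Rw qM.
have eRS : wcomp R S = wcomp (trunc q R) S' ++ x k :: wcomp R2 S.
  rewrite {1}eR wcomp_cat {1}eS (eq_comp_cat _ R1w) //=; congr (_ ++ _ :: _).
  by rewrite (sub_par sys) ?sS // eS nth_cat ltnn subnn.
have R1S : pword 0 (wcomp (trunc q R) S') k by exact: pword_comp R1w S'k _.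
rewrite eRS -(hchi q S' qM erefl S'k) /c'.
have sRS : size (wcomp R S) = m by rewrite size_wcomp.
apply: TP => //.
- by rewrite -eRS.
- by move: sRS; rewrite size_nseq eRS size_cat /= => <-; lia.
- rewrite eS -cat_rcons; apply: wcomp_const R2w _ _ _ uA; rewrite ?size_rcons //.
    by rewrite cat_rcons -eS.
  exact: PwVar.
- by apply/allP => a /nseqP[-> _]; exact: letter_par0.
Qed.

End ParameterWords.

(** * Universal minimal flows of orderings *)

Lemma nbhs_ptws (I : choiceType) (K : topologicalType) (f : {ptws I -> K})
    (U : set {ptws I -> K}) : nbhs f U ->
  exists s : seq I, forall g, (forall i, i \in s -> g i = f i) -> U g.
Proof.
pose F : set_system {ptws I -> K} := fun V =>
  exists s : seq I, forall g, (forall i, i \in s -> g i = f i) -> V g.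
have FF : Filter F.
  split; first by exists [::].
  - move=> P Q [s sP] [t tQ]; exists (s ++ t) => g gst; split.
      by apply: sP => i si; apply: gst; rewrite mem_cat si.
    by apply: tQ => i ti; apply: gst; rewrite mem_cat ti orbT.
  - by move=> P Q PQ [s sP]; exists s => g /sP /PQ.
suff : F --> f by apply.
apply/cvg_sup => i V; rewrite nbhsE => -[_ [[O Oo <-] Of] OV].
exists [:: i] => g gi; apply: OV => /=.
by rewrite /preimage /= gi ?inE.
Qed.

Lemma nbhs_set_val (X : topologicalType) (A : set X) (x : A) (U : set A) :
  nbhs x U -> exists2 V, nbhs (set_val x) V & forall y : A, V (set_val y) -> U y.
Proof.
rewrite nbhsE => -[_ [[O Oo <-] Ox] OU]; exists O; last by move=> y; exact: OU.
by exists O.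
Qed.

Lemma set_val_continuous (X : topologicalType) (A : set X) :
  continuous (set_val : A -> X).
Proof. exact: initial_continuous. Qed.

Lemma compact_set_type (X : topologicalType) (A : set X) :
  compact A -> compact [set: A].
Proof.
move=> cA F FF _.
have GA : F (set_val @^-1` A).
  have: F setT by exact: filterT.
  by apply: filterS => y _; exact: set_valP.
have [p [Ap clp]] := cA (set_val @ F) _ GA.
exists (exist _ p (mem_set Ap)); split => // V N FV /nbhs_set_val[O Op ON].
have FV' : F (set_val @^-1` (set_val @` V)).
  by apply: filterS FV => v Vv; exists v.
have [_ [[v Vv <-] Ov]] := clp (set_val @` V) O FV' Op.
by exists v; split => //; exact: ON.
Qed.

Lemma hausdorff_set_type (X : topologicalType) (A : set X) :
  hausdorff_space X -> hausdorff_space A.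
Proof.
move=> hX p q clpq; apply: val_inj; apply: hX => U V Up Vq.
have [y [Uy Vy]] := clpq _ _ (set_val_continuous Up) (set_val_continuous Vq).
by exists (set_val y).
Qed.

Section Orderings.
Variable T : choiceType.
Implicit Types (r : relspace T) (D : set T).

Lemma relspace_compact : compact [set: relspace T].
Proof.
have := @tychonoff (T * T)%type (fun=> bool) (fun=> setT) (fun=> bool_compact).
by congr compact; apply/seteqP; split.
Qed.

Lemma relspace_hausdorff : hausdorff_space (relspace T).
Proof. by apply: hausdorff_product => _; exact: discrete_hausdorff. Qed.

Definition agree D r r' : Prop := forall a b, D a -> D b -> r (a, b) = r' (a, b).

Lemma nbhs_relspace r (U : set (relspace T)) : nbhs r U ->
  exists s : seq T, forall r', agree [set` s] r' r -> U r'.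
Proof.
move=> /nbhs_ptws[s sU]; exists (map fst s ++ map snd s) => r' rr'.
apply: sU => -[a b] abs; apply: rr' => /=; rewrite mem_cat.
  by apply/orP; left; apply/mapP; exists (a, b).
by apply/orP; right; apply/mapP; exists (a, b).
Qed.

Lemma near_eval r (ab : T * T) : \forall r' \near r, r' ab = r ab.
Proof.
have /(_ [set r ab]) := @proj_continuous (T * T)%type (fun=> bool) ab r.
apply; exact: discrete_set1.
Qed.

Lemma near_agree r D : finite_set D -> \forall r' \near r, agree D r' r.
Proof.
move=> /finite_seqP[s ->].
suff : \forall r' \near r, forall ab, ab \in [seq (a, b) | a <- s, b <- s] -> r' ab = r ab.
  apply: filterS => r' rr' a b /= sa sb; apply: rr'.
  by apply/allpairsP; exists (a, b).
elim: [seq _ | _ <- _, _ <- _] => [|ab t IHt].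
  by apply: filterS filterT => r' _ ab.
apply: filterS2 (near_eval r ab) IHt => r' rab rt cd.
by rewrite inE => /predU1P[->|/rt].
Qed.

Lemma agree_closed (P : set (relspace T)) D : finite_set D ->
  (forall r r', agree D r r' -> P r -> P r') -> closed P.
Proof.
move=> Dfin PD r clr; have [r' [Pr' rr']] := clr _ (near_agree r Dfin).
exact: PD rr' Pr'.
Qed.

End Orderings.

Lemma compact_fip (X : topologicalType) (I : eqType) (P : set I) (f : I -> set X) :
  compact [set: X] -> (forall i, P i -> closed (f i)) ->
  (forall s : seq I, (forall i, i \in s -> P i) ->
     exists x, forall i, i \in s -> f i x) ->
  exists x, forall i, P i -> f i x.
Proof.
move=> cX fcl fip.
pose F : set_system X := fun V => exists2 s : seq I, forall i, i \in s -> P i &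
  forall x, (forall i, i \in s -> f i x) -> V x.
have FF : ProperFilter F.
  split; first by move=> [s sP s0]; have [x /s0] := fip s sP.
  split; first by exists [::].
  - move=> V W [s sP sV] [t tP tW]; exists (s ++ t).
      by move=> i; rewrite mem_cat => /orP[/sP|/tP].
    move=> x xst; split; [apply: sV => i si|apply: tW => i ti]; apply: xst.
      by rewrite mem_cat si.
    by rewrite mem_cat ti orbT.
  - by move=> V W VW [s sP sV]; exists s => // x /sV /VW.
have [x [_ clx]] := cX F FF filterT.
exists x => i Pi; apply: (fcl i Pi) => U Ux.
apply: clx Ux; exists [:: i] => [j|y]; first by rewrite inE => /eqP->.
by apply; rewrite inE.
Qed.

(** * A Ramsey criterion for universality *)

Section Criterion.
Variables (T : choiceType) (H : subgroup (symg T)) (A : set (relspace T)).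
Hypothesis A_inv :
  forall g r, subgroup_set H g -> A r -> A (relspace_act g r).
Variable fam : set (set T).

(** For [B = setT] this means that [h^-1] moves [r] to an ordering that agrees with [t] on [D]. *)
Definition is_copy (r t : relspace T) (D B : set T) (h : symg T) : Prop :=
  [/\ subgroup_set H h, forall a, D a -> B (h a) &
      forall a b, D a -> D b -> r (h a, h b) = t (a, b)].

(** [fam_copy] relates arbitrary orderings of [A], which makes all orbits dense. In [fam_ramsey] a
    colouring of group elements that sees only their restriction to [D] stands for a colouring of
    embeddings of [D]. *)
Record ramsey_family : Prop := {
  fam_finite : forall D, fam D -> finite_set D;
  fam_cofinal : forall s : seq T, exists2 D, fam D & forall a, a \in s -> D a;
  fam_copy : forall r t D, A r -> A t -> fam D -> exists h, is_copy r t D setT h;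
  fam_ramsey : forall r t D B, A r -> A t -> fam D -> fam B ->
    exists2 C, fam C & forall c : symg T -> bool,
      (forall h h', subgroup_set H h -> subgroup_set H h' ->
         (forall a, D a -> h a = h' a) -> c h = c h') ->
      exists2 g, is_copy r r B C g &
        forall h h', is_copy r t D B h -> is_copy r t D B h' -> c (g * h)%g = c (g * h')%g
}.

Local Notation act := (restricted_act A_inv).

Lemma val_subgroupM (g h : H) : val (g * h)%g = (val g * val h)%g.
Proof. by []. Qed.

Lemma val_subgroupV (g : H) : val (g^-1)%g = ((val g)^-1)%g.
Proof. by []. Qed.

Lemma actE g (x : A) a b : val (act g x) (a, b) =
  val x (((val g)^-1)%g a, ((val g)^-1)%g b).
Proof. by []. Qed.

Definition in_subgroup (h : symg T) (Hh : subgroup_set H h) : H := exist _ h (mem_set Hh).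

Lemma restricted_act1 x : act 1%g x = x.
Proof.
by apply/val_inj/funext => -[a b]; rewrite actE /= invg1.
Qed.

Lemma restricted_actM g h x : act (g * h)%g x = act g (act h x).
Proof.
by apply/val_inj/funext => -[a b]; rewrite !actE val_subgroupM invgM.
Qed.

Lemma near_subgroup (g : H) (a : T) : \forall h \near g, val (h : H) a = val g a.
Proof. exact: set_val_continuous (symg_eval_near (val g) a). Qed.

Lemma near_subgroupV (g : H) (a : T) :
  \forall h \near g, ((val (h : H))^-1)%g a = ((val g)^-1)%g a.
Proof.
apply: filterS (near_subgroup g (((val g)^-1)%g a)) => h.
by rewrite symgVK => e; rewrite -{1}e symgK.
Qed.

Lemma near_ordering (x : A) (ab : T * T) : \forall y \near x, val (y : A) ab = val x ab.
Proof. exact: set_val_continuous (near_eval (val x) ab). Qed.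

Lemma restricted_act_continuous : continuous (fun gx : H * A => act gx.1 gx.2).
Proof.
apply: continuous_comp_initial => -[g x]; apply/cvg_sup => -[a b].
apply: (@continuous_comp_initial _ _ _ (fun r : {ptws (T * T) -> bool} => r (a, b)))
  (g, x) => -[{}g {}x].
apply/discrete_cvg => /=.
have ga : \forall hy \near (g, x), ((val ((hy : H * A).1 : H))^-1)%g a = ((val g)^-1)%g a.
  exact: cvg_fst (near_subgroupV g a).
have gb : \forall hy \near (g, x), ((val ((hy : H * A).1 : H))^-1)%g b = ((val g)^-1)%g b.
  exact: cvg_fst (near_subgroupV g b).
have xab : \forall hy \near (g, x),
    val ((hy : H * A).2 : A) (((val g)^-1)%g a, ((val g)^-1)%g b) =
    val x (((val g)^-1)%g a, ((val g)^-1)%g b).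
  exact: cvg_snd (near_ordering x (((val g)^-1)%g a, ((val g)^-1)%g b)).
apply: filterS2 (filterI ga gb) xab => hy [ea eb] exy.
by change (val (act hy.1 hy.2) (a, b) = val (act g x) (a, b)); rewrite !actE ea eb.
Qed.

Lemma nbhs_subgroup1 (U : set H) : nbhs (1%g : H) U ->
  exists s : seq T, forall h : H, (forall a, a \in s -> val h a = a) -> U h.
Proof.
move=> /nbhs_set_val[V V1 VU].
have [W W1 WV] : exists2 W : set {ptws T -> discrete_topology T},
    nbhs (id : {ptws T -> discrete_topology T}) W &
    forall h : symg T, W (symg_fun h) -> V h.
  move: V1; rewrite nbhsE => -[_ [[O Oo <-] O1] OV].
  by exists O; [exact: open_nbhs_nbhs (conj Oo O1)|move=> h; exact: OV].
have [s sW] := nbhs_ptws W1.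
by exists s => h hs; apply/VU/WV/sW.
Qed.

Lemma nbhs_ordering (x : A) (U : set A) : nbhs x U ->
  exists s : seq T, forall y : A, agree [set` s] (val y) (val x) -> U y.
Proof.
move=> /nbhs_set_val[V /nbhs_relspace[s sV] VU].
by exists s => y ys; apply/VU/sV.
Qed.

Hypotheses (A_closed : closed A) (A_ne : A !=set0) (rf : ramsey_family).

Lemma ordering_flow : is_flow act.
Proof.
split.
- by apply: compact_set_type; apply: subclosed_compact A_closed (@relspace_compact T) _.
- by apply: hausdorff_set_type; exact: relspace_hausdorff.
- exact: restricted_act1.
- exact: restricted_actM.
- exact: restricted_act_continuous.
Qed.

Lemma act_agree (x y : A) D : fam D -> exists g : H, agree D (val (act g x)) (val y).
Proof.
move=> fD; have [h [Hh _ hxy]] := fam_copy rf (set_valP x) (set_valP y) fD.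
exists ((in_subgroup Hh)^-1)%g => a b Da Db.
by rewrite actE val_subgroupV invgK hxy.
Qed.

Lemma ordering_minimal_flow : is_minimal_flow act.
Proof.
split; [exact: ordering_flow | by case: A_ne => r Ar; exists (exist _ r (mem_set Ar)) |].
move=> x U [y Uy] Uo.
have [s sU] := nbhs_ordering (open_nbhs_nbhs (conj Uo Uy)).
have [D fD sD] := fam_cofinal rf s.
have [g gxy] := act_agree x y fD.
exists (act g x); split; last by exists g.
by apply: sU => a b sa sb; apply: gxy; exact: sD.
Qed.

(** * The factor map onto a minimal flow *)

Section Universality.
Variables (Y : topologicalType) (actY : H -> Y -> Y).
Hypothesis Y_min : is_minimal_flow actY.

Let actY1 y : actY 1%g y = y.
Proof. by have [[]] := Y_min. Qed.

Let actYM g h y : actY (g * h)%g y = actY g (actY h y).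
Proof. by have [[]] := Y_min. Qed.

Let actYK g y : actY (g^-1)%g (actY g y) = y.
Proof. by rewrite -actYM mulVg actY1. Qed.

Let actYVK g y : actY g (actY (g^-1)%g y) = y.
Proof. by rewrite -actYM mulgV actY1. Qed.

Let actY_cont : continuous (fun gy : H * Y => actY gy.1 gy.2).
Proof. by have [[]] := Y_min. Qed.

Lemma actY_continuous g : continuous (actY g).
Proof.
move=> y; apply: (@continuous_comp Y (H * Y)%type Y (fun y => (g, y))
  (fun gy => actY gy.1 gy.2)); last exact: actY_cont.
move=> U [[P Q] /= [gP yQ] PQ]; apply: filterS yQ => z Qz.
by apply: PQ; split => //; exact: nbhs_singleton gP.
Qed.

Definition fixes (D : set T) (g : H) : Prop := forall a, D a -> val g a = a.

(** Unlike the constancy of a colouring of copies, this is a closed condition on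
    [y], so that it can be passed to a limit. *)
Definition separated (r t : relspace T) (D : set T) (K K' : set Y) (B : set T)
    (y : Y) : Prop :=
  forall h h' : H, is_copy r t D B (val h) -> is_copy r t D B (val h') ->
    ~ (K (actY (h^-1)%g y) /\ K' (actY (h'^-1)%g y)).

Lemma separated_closed r t D K K' B : open K -> open K' ->
  closed (separated r t D K K' B).
Proof.
move=> Ko K'o y cly h h' hB h'B [Ky K'y].
have Kn : nbhs y (fun z => K (actY (h^-1)%g z)).
  exact: actY_continuous (open_nbhs_nbhs (conj Ko Ky)).
have K'n : nbhs y (fun z => K' (actY (h'^-1)%g z)).
  exact: actY_continuous (open_nbhs_nbhs (conj K'o K'y)).
have [z [zsep [Kz K'z]]] := cly _ (filterI Kn K'n).
exact: zsep hB h'B _.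
Qed.

Definition test_datum : Type := (set T * relspace T * set Y * set Y)%type.

(** The last clause keeps [K'] disjoint from the saturation of [K] under the pointwise stabilizer of
    [D], so that a colouring of embeddings of [D] can tell [K] from [K']. *)
Definition admissible (s : test_datum) : Prop :=
  let: (D, t, K, K') := s in
  [/\ fam D, A t, open K, open K' &
    forall g y, fixes D g -> K y -> ~ K' (actY g y)].

(** The data are treated successively: the larger piece [C] that the first datum asks for is handed
    to the induction, and a copy of [B] inside [C] inherits the separation achieved there for the
    other data. *)
Lemma exists_separated r (ss : seq test_datum) B y0 : A r -> fam B ->
  (forall s, s \in ss -> admissible s) ->
  exists g : H, is_copy r r B setT (val g) /\
    forall D t K K', (D, t, K, K') \in ss ->
      separated r t D K K' B (actY (g^-1)%g y0).
Proof.
move=> Ar; elim: ss B => [|[[[D t] K] K'] ss IHss] B fB ssP.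
  by exists 1%g; split=> //; split => //; exact: subgroup1.
have [fD At Ko K'o KK'] := ssP _ (mem_head _ _).
have [C fC hC] := fam_ramsey rf Ar At fD fB.
have [g1 [g1r g1ss]] := IHss C fC (fun s sss => ssP s (mem_behead (s := _ :: _) sss)).
(* Two elements with the same restriction to [D] differ by a factor fixing [D]; saturating [K] by
   such factors makes the colour depend on the restriction only. *)
pose c (h : symg T) : bool := `[< exists k k' : H, [/\ val k = h, fixes D k' &
   K (actY k' (actY (k^-1)%g (actY (g1^-1)%g y0)))] >].
have [h h' Hh Hh' hh'|g gr gc] := hC c.
  suff imp k1 k2 : subgroup_set H k1 -> subgroup_set H k2 ->
      (forall a, D a -> k1 a = k2 a) -> c k1 -> c k2.
    apply/idP/idP; first exact: imp.
    by apply: imp => // a Da; rewrite hh'.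
  move=> Hk1 Hk2 k12 /asboolP[k [k' [kk1 k'D Kk]]]; apply/asboolP.
  exists (in_subgroup Hk2), (k' * k^-1 * in_subgroup Hk2)%g; split => //.
    move=> a Da; rewrite !val_subgroupM val_subgroupV !symgME /= -k12 // -kk1.
    by rewrite symgK k'D.
  by rewrite !actYM actYVK.
have [Hg gBC gB] := gr.
exists (g1 * in_subgroup Hg)%g; split.
  have [Hg1 _ g1C] := g1r.
  split => [|//|a b Ba Bb]; first exact: subgroupP.
  by rewrite val_subgroupM !symgME /= g1C ?gB //; exact: gBC.
have step h D' t' : is_copy r t' D' B (val h) -> is_copy r t' D' C (val (in_subgroup Hg * h)%g).
  move=> [Hh hB ht]; split => [|a /hB/gBC//|a b D'a D'b]; first exact: subgroupP.
  by rewrite val_subgroupM !symgME gB ?ht //; exact: hB.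
move=> D' t' K1 K1'; rewrite inE => /predU1P[[-> -> -> ->]|in_ss] h h' hB h'B.
  move=> [Kh K'h'].
  have ch : c (g * val h)%g.
    apply/asboolP; exists (in_subgroup Hg * h)%g, 1%g; split => //.
    by rewrite actY1; move: Kh; rewrite !invgM !actYM.
  have : c (g * val h')%g by rewrite -(gc _ _ hB h'B).
  move=> /asboolP[k [k' [kE k'D Kk]]].
  apply: (KK' (k'^-1)%g _ _ Kk) => [a Da|].
    by rewrite val_subgroupV -{1}(k'D a Da) symgK.
  rewrite actYK.
  have -> : k = (in_subgroup Hg * h')%g by apply: val_inj; rewrite kE.
  by move: K'h'; rewrite !invgM !actYM.
have := g1ss _ _ _ _ in_ss _ _ (step _ _ _ hB) (step _ _ _ h'B).
by rewrite !invgM !actYM.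
Qed.

Lemma fam_cover (l : seq (set T)) : (forall B, B \in l -> fam B) ->
  exists2 C, fam C & forall B, B \in l -> B `<=` C.
Proof.
elim: l => [_|B l IHl lP]; first by have [C] := fam_cofinal rf [::]; exists C.
have [C0 fC0 C0P] := IHl (fun B' B'l => lP B' (mem_behead (s := _ :: _) B'l)).
have /finite_seqP[s0 s0E] := fam_finite rf fC0.
have /finite_seqP[s sE] := fam_finite rf (lP _ (mem_head _ _)).
have [C fC sC] := fam_cofinal rf (s ++ s0).
exists C => // B'; rewrite inE => /predU1P[->|/C0P B'C0] a.
  by rewrite sE => sa; apply: sC; rewrite mem_cat; apply/orP; left.
by move=> /B'C0; rewrite s0E => sa; apply: sC; rewrite mem_cat; apply/orP; right.
Qed.

Let Y_compact : compact [set: Y].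
Proof. by have [[]] := Y_min. Qed.

Lemma exists_separated_all r : A r -> exists y, forall D t K K' B,
  admissible (D, t, K, K') -> fam B -> separated r t D K K' B y.
Proof.
move=> Ar; have [_ [y0 _] _] := Y_min.
have [|l lP|y yP] := @compact_fip Y (test_datum * set T)%type
    [set sB | admissible sB.1 /\ fam sB.2]
    (fun sB => let: (D, t, K, K', B) := sB in separated r t D K K' B) Y_compact.
- by move=> [[[[D t] K] K'] B] [[_ _ Ko K'o _] _]; exact: separated_closed.
- have [|C fC CP] := @fam_cover [seq sB.2 | sB <- l].
    by move=> _ /mapP[sB /lP[_ fB] ->].
  have [|g [_ gP]] := @exists_separated r [seq sB.1 | sB <- l] C y0 Ar fC.
    by move=> _ /mapP[sB /lP[adm _] ->].
  exists (actY (g^-1)%g y0) => -[[[[D t] K] K'] B] sBl h h' [Hh hB ht] [Hh' h'B h't].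
  have BC : B `<=` C by apply: CP; apply/mapP; exists (D, t, K, K', B).
  apply: (gP D t K K').
  + by apply/mapP; exists (D, t, K, K', B).
  + by split=> // a /hB /BC.
  + by split=> // a /h'B /BC.
by exists y => D t K K' B adm fB; exact: (yP (D, t, K, K', B)).
Qed.

Section Factor.
Variables (r : relspace T) (y1 : Y).
Hypothesis Ar : A r.
Hypothesis y1P : forall D t K K' B,
  admissible (D, t, K, K') -> fam B -> separated r t D K K' B y1.

(** The closure of the translates of [y1] by those elements that move [r] to an ordering agreeing
    with [x] on [D]. The factor map sends [x] to the only point common to all these sets. *)
Definition fiber (D : set T) (x : A) : set Y :=
  closure [set actY (h^-1)%g y1 | h in [set h : H | is_copy r (val x) D setT (val h)]].

Lemma fiber_anti D D' x : D' `<=` D -> fiber D x `<=` fiber D' x.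
Proof.
move=> D'D; apply: closureS => _ [h [Hh _ hx] <-]; exists h => //.
by split=> // a b /D'D Da /D'D Db; exact: hx.
Qed.

Lemma fiber_agree D (x x' : A) : agree D (val x') (val x) -> fiber D x' `<=` fiber D x.
Proof.
move=> xx'; apply: closureS => _ [h [Hh _ hx] <-]; exists h => //.
by split=> // a b Da Db; rewrite hx // xx'.
Qed.

Lemma fiber_ex x : exists y, forall D, fam D -> fiber D x y.
Proof.
apply: (compact_fip Y_compact) => [D _|l lP]; first exact: closed_closure.
have [C fC CP] := fam_cover lP.
have [h hx] := fam_copy rf Ar (set_valP x) fC.
have [Hh _ _] := hx.
exists (actY ((in_subgroup Hh)^-1)%g y1) => D /CP DC; apply: (fiber_anti DC).
by apply: subset_closure; exists (in_subgroup Hh).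
Qed.

(** By continuity of the action at [(1, y)], some neighbourhood [Q] of [y] is kept inside [U] by the
    pointwise stabilizer of a finite [D]. If [U] and [U'] were disjoint, the interiors of [Q] and
    [U'] would form an admissible datum, and translates of [y1] in both would contradict the choice
    of [y1]. *)
Lemma fiber_uniq x y y' : (forall D, fam D -> fiber D x y) ->
  (forall D, fam D -> fiber D x y') -> y = y'.
Proof.
move=> yP y'P; have [[_ hY _ _ _] _ _] := Y_min; apply: hY => U U' Uy U'y'.
apply: contrapT => UU'.
have [[P Q] /= [P1 Qy] PQ] : nbhs ((1%g : H), y) (fun gy : H * Y => U (actY gy.1 gy.2)).
  by apply: actY_cont; rewrite /= actY1.
have [s sP] := nbhs_subgroup1 P1.
have [D fD sD] := fam_cofinal rf s.
have adm : admissible (D, val x, Q°, U'°).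
  split => //; [exact: set_valP|exact: open_interior|exact: open_interior|].
  move=> g z gD /interior_subset Qz /interior_subset U'z; apply: UU'.
  exists (actY g z); split => //; apply: (PQ (g, z)); split => //=.
  by apply: sP => a /sD /gD.
have Qn : nbhs y (Q°) by exact: nbhs_interior.
have U'n : nbhs y' (U'°) by exact: nbhs_interior.
have [_ [[h [Hh _ hx] <-] Qh]] := yP D fD _ Qn.
have [_ [[h' [Hh' _ h'x] <-] U'h']] := y'P D fD _ U'n.
have /finite_seqP[d dE] := fam_finite rf fD.
have [B fB dB] := fam_cofinal rf ([seq val h a | a <- d] ++ [seq val h' a | a <- d]).
apply: (y1P adm fB (h := h) (h' := h')) => //; split => // a; rewrite dE => da.
  by apply: dB; rewrite mem_cat; apply/orP; left; exact: map_f.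
by apply: dB; rewrite mem_cat; apply/orP; right; exact: map_f.
Qed.

Definition factor (x : A) : Y := projT1 (cid (fiber_ex x)).

Lemma factorP x D : fam D -> fiber D x (factor x).
Proof. by rewrite /factor; case: cid => y /= yP /yP. Qed.

Lemma factor_eq x y : (forall D, fam D -> fiber D x y) -> factor x = y.
Proof. by apply: fiber_uniq => D; exact: factorP. Qed.

(** By compactness a single [D] has its fiber over [x] inside [O], and the fiber over an ordering
    agreeing with [x] on [D] is contained in it. *)
Lemma factor_continuous : continuous factor.
Proof.
move=> x O Ox.
have [D fD DO] : exists2 D, fam D & fiber D x `<=` O.
  apply: contrapT => nD.
  have [D fD|l lP|y yP] := @compact_fip Y (set T) fam
      (fun D => fiber D x `&` ~` O°) Y_compact.
  - by apply: closedI; [exact: closed_closure | exact/open_closedC/open_interior].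
  - have [C fC CP] := fam_cover lP.
    apply: contrapT => nC; apply: nD; exists C => // y Cy.
    apply: contrapT => nOy; apply: nC; exists y => D /CP DC.
    by split; [exact: fiber_anti DC _ Cy | move=> /interior_subset].
  have yx : factor x = y by apply: factor_eq => D /yP[].
  have [C fC _] := fam_cofinal rf [::].
  by have [_] := yP C fC; apply; rewrite -yx.
have [s sE] : exists s : seq T, D = [set` s] by apply/finite_seqP; exact: fam_finite fD.
have : \forall x' \near x, agree D (val (x' : A)) (val x).
  exact: set_val_continuous (near_agree (val x) (fam_finite rf fD)).
by apply: filterS => x' xx'; apply/DO/(fiber_agree xx')/factorP.
Qed.

Lemma factor_act g x : factor (act g x) = actY g (factor x).
Proof.
apply: factor_eq => D fD U Uz.
have /finite_seqP[d dE] := fam_finite rf fD.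
have [D' fD' dD'] := fam_cofinal rf [seq ((val g)^-1)%g a | a <- d].
have [_ [[h [Hh _ hx] <-] Uh]] := @factorP x D' fD' _ (actY_continuous Uz).
have gD a : D a -> D' (((val g)^-1)%g a).
  by rewrite dE => da; apply: dD'; exact: map_f.
(* Precomposing with [g^-1] turns a copy of [x] on the preimage of [D] under [g] into a copy of
   [act g x] on [D]. *)
exists (actY ((h * g^-1)^-1)%g y1); split; last by rewrite invgM invgK actYM.
exists (h * g^-1)%g => //; split => [|//|a b Da Db]; first exact: subgroupP.
by rewrite val_subgroupM val_subgroupV !symgME hx ?actE //; exact: gD.
Qed.

(** The image is compact, hence closed, and contains a dense orbit. *)
Lemma factor_surjective : range factor = setT.
Proof.
apply/seteqP; split => // y _; apply: contrapT => ny.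
have [[cY hY _ _ _] _ dY] := Y_min; have [fX [x0 _] _] := ordering_minimal_flow.
have cl : closed (range factor).
  apply: compact_closed hY _; apply: continuous_compact.
    by apply: continuous_subspaceT => z; exact: factor_continuous.
  exact: flow_compact fX.
have [|z [nz [g _ gz]]] := dY (factor x0) (~` range factor) _ (closed_openC cl).
  by exists y.
by apply: nz; exists (act g x0); rewrite ?factor_act.
Qed.

End Factor.
End Universality.

Theorem ordering_universal_minimal_flow : is_universal_minimal_flow act.
Proof.
split; first exact: ordering_minimal_flow.
move=> Y actY Ymin; have [r Ar] := A_ne.
have [y1 y1P] := exists_separated_all Ymin Ar.
exists (factor Ymin y1 Ar); split.
- exact: factor_continuous.
- exact: factor_act.
- exact: factor_surjective.
Qed.

End Criterion.

(** * Back and forth, rigidity of finite linear orders *)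

(** [P] selects finite partial maps. The last conclusion covers [g] on each finite set by a member
    of [P], so that a property involving finitely many points at a time passes from [P] to [g]. *)
Lemma back_and_forth (T : choiceType) (P : seq (T * T) -> Prop) :
  countable [set: T] ->
  (forall s p q, P s -> p \in s -> q \in s -> (p.1 == q.1) = (p.2 == q.2)) ->
  (forall s x, P s -> exists y, P ((x, y) :: s)) ->
  (forall s y, P s -> exists x, P ((x, y) :: s)) ->
  forall s, P s -> exists g : symg T, (forall p, p \in s -> g p.1 = p.2) /\
    forall l : seq T, exists2 s', P s' & forall x, x \in l -> (x, g x) \in s'.
Proof.
move=> /countable_injP[f finj] Pfun forth back s Ps.
have f_inj x y : f x = f y -> x = y by apply: finj; rewrite inE.
(* Stage [n] puts the point numbered [n], if there is one, both into the domain and into the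
   range. *)
have step (n : nat) (t : {t | P t}) : exists t' : {t | P t},
    {subset sval t <= sval t'} /\ forall x, f x = n ->
    (exists y, (x, y) \in sval t') /\ (exists y, (y, x) \in sval t').
  case: t => t Pt; have [[x fx]|nx] := EM (exists x, f x = n); last first.
    by exists (exist _ t Pt); split => // x fx; case: nx; exists x.
  have [y Py] := forth _ x Pt; have [z Pz] := back _ x Py.
  exists (exist _ _ Pz); split => [p|x' fx'] /=; first by rewrite !inE => ->; rewrite !orbT.
  have -> : x' = x by apply: f_inj; rewrite fx.
  by split; [exists y|exists z]; rewrite !inE eqxx ?orbT.
pose S := fix S n : {t | P t} :=
  if n is m.+1 then projT1 (cid (step m (S m))) else exist _ s Ps.
have S1 n : {subset sval (S n) <= sval (S n.+1)} by move=> /=; case: cid => ? [].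
have S2 x : (exists y, (x, y) \in sval (S (f x).+1)) /\
            (exists y, (y, x) \in sval (S (f x).+1)).
  by move=> /=; case: cid => t /= [_ /(_ x erefl)].
have Sle m n : m <= n -> {subset sval (S m) <= sval (S n)}.
  move=> /subnK <-; elim: (n - m) => // k IHk p /IHk; exact: S1.
have SP m n p q : p \in sval (S m) -> q \in sval (S n) -> (p.1 == q.1) = (p.2 == q.2).
  move=> /(Sle _ _ (leq_maxl m n)) pS /(Sle _ _ (leq_maxr m n)) qS.
  exact: Pfun (svalP (S (maxn m n))) pS qS.
pose g x := projT1 (cid (S2 x).1); pose g' y := projT1 (cid (S2 y).2).
have gS x : (x, g x) \in sval (S (f x).+1) by rewrite /g; case: cid.
have g'S y : (g' y, y) \in sval (S (f y).+1) by rewrite /g'; case: cid.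
have gb : bijective g.
  exists g' => x.
    by apply/eqP; have := SP _ _ _ _ (g'S (g x)) (gS x); rewrite /= eqxx => ->.
  by apply/eqP; have := SP _ _ _ _ (gS (g' x)) (g'S x); rewrite /= eqxx => <-.
exists (Symg gb); split=> [p ps|l] /=.
  by apply/eqP; have := SP _ 0 _ _ (gS p.1) ps; rewrite /= eqxx => <-.
elim: l => [|x l [s' Ps' s'l]]; first by exists s.
pose n := \max_(y <- x :: l) (f y).+1.
exists (sval (S n)); first exact: svalP.
move=> y yl; apply: Sle (gS y); exact: (@leq_bigmax_seq _ _ predT (fun y => (f y).+1)).
Qed.

Lemma sub_count_lt (T : eqType) (a b : pred T) (d : seq T) z :
  subpred a b -> z \in d -> b z -> ~~ a z -> count a d < count b d.
Proof.
move=> ab + bz az; elim: d => // y d IHd; rewrite inE => /predU1P[<-|/IHd] /=.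
  by rewrite bz (negPf az) add0n ltnS sub_count.
move=> lt; rewrite -addnS leq_add //.
by case: (a y) (ab y) => // ->.
Qed.

Lemma strictly_increasing_id (T : eqType) (r : rel T) (d : seq T) (f : T -> T) :
  strict_linear_order r -> (forall y, y \in d -> f y \in d) ->
  (forall y z, y \in d -> z \in d -> r y z -> r (f y) (f z)) ->
  forall y, y \in d -> f y = y.
Proof.
suff H (q : rel T) : strict_linear_order q -> (forall y, y \in d -> f y \in d) ->
    (forall y z, y \in d -> z \in d -> q y z -> q (f y) (f z)) ->
    forall y, y \in d -> ~~ q y (f y).
  move=> rlin fd fr y yd; have [irr tr tot] := rlin.
  have rlin' : strict_linear_order (fun a b => r b a).
    split => // [b a c ba cb|a b]; first exact: tr cb ba.
    by move=> /tot; case; [right|left].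
  apply: contrapT => /tot [ry|ry].
    by have := H _ rlin' fd (fun a b ad bd => fr b a bd ad) y yd; rewrite ry.
  by have := H _ rlin fd fr y yd; rewrite ry.
(* Induction on the number of elements above [y]: if [y] lies below [f y], then [f y] lies below
   [f (f y)] and has fewer elements above it. *)
move=> [irr tr tot] fd fq y; move: {2}(count _ _) (leqnn (count (q y) d)) => n.
elim: n y => [|n IHn] y nd yd; apply/negP => qy.
  by move: nd; rewrite leqNgt -has_count; case/hasP; exists (f y) => //; exact: fd.
have qff := fq _ _ yd (fd _ yd) qy.
suff : ~~ q (f y) (f (f y)) by rewrite qff.
apply: IHn (fd _ yd); rewrite -ltnS; apply: leq_trans nd.
by apply: (sub_count_lt (z := f y)) => [z||//|]; [exact: tr | exact: fd | rewrite irr].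
Qed.

(** * Frames and lexicographic orderings *)

(** The most significant coordinate comes first; [antilex] reads it from the
    other end. *)
Definition lex (K : Type) (lt : rel K) (n : nat) (alpha beta : nat -> K) : Prop :=
  exists2 j, j < n &
    (forall i, i < j -> alpha i = beta i) /\ lt (alpha j) (beta j).

Section Lex.
Variables (K : eqType) (lt : rel K).
Hypothesis lt_slo : strict_linear_order lt.
Implicit Types (alpha beta gamma : nat -> K).

Lemma lex_irr n alpha beta : (forall i, i < n -> alpha i = beta i) ->
  ~ lex lt n alpha beta.
Proof.
have [irr _ _] := lt_slo; move=> ab [j jn [_]]; rewrite ab //.
by rewrite irr.
Qed.

Lemma lex_trans n alpha beta gamma :
  lex lt n alpha beta -> lex lt n beta gamma -> lex lt n alpha gamma.
Proof.
have [_ tr _] := lt_slo; move=> [j jn [ab abj]] [k kn [bc bck]].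
case: (ltngtP j k) => [jk|kj|jk].
- exists j => //; split=> [i ij|]; first by rewrite ab // bc // (ltn_trans ij).
  by rewrite -bc.
- exists k => //; split=> [i ik|]; first by rewrite ab ?bc // (ltn_trans ik).
  by rewrite ab.
subst k; exists j => //; split=> [i ij|]; first by rewrite ab ?bc.
exact: tr abj bck.
Qed.

Lemma lex_total n alpha beta :
  [\/ forall i, i < n -> alpha i = beta i, lex lt n alpha beta | lex lt n beta alpha].
Proof.
have [_ _ tot] := lt_slo.
have [/existsP[j0 j0P]|/existsPn ab] := boolP [exists j : 'I_n, alpha j != beta j].
  have ex : exists j, (j < n) && (alpha j != beta j) by exists j0; rewrite ltn_ord.
  case: (ex_minnP ex) => j /andP[jn abj] jmin.
  have lt_j i : i < j -> alpha i = beta i.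
    move=> ij; apply/eqP/negPn/negP => abi.
    by have := jmin i; rewrite abi (ltn_trans ij jn) leqNgt ij => /(_ isT).
  have [|r|r] := tot (alpha j) (beta j); first exact/eqP.
    by apply: Or32; exists j.
  by apply: Or33; exists j => //; split => // i /lt_j ->.
by apply: Or31 => i ilt; have := ab (Ordinal ilt); rewrite negbK => /eqP.
Qed.

Lemma eq_lex n alpha beta alpha' beta' :
  (forall i, i < n -> alpha i = alpha' i) -> (forall i, i < n -> beta i = beta' i) ->
  lex lt n alpha beta -> lex lt n alpha' beta'.
Proof.
move=> aa bb [j jn [ab abj]]; exists j => //; split=> [i ij|].
  by rewrite -aa ?(ltn_trans ij) // -bb ?(ltn_trans ij) // ab.
by rewrite -aa // -bb.
Qed.

End Lex.

Lemma antilex_lex (K : Type) (lt : rel K) n (a b : 'I_n -> K) (alpha beta : nat -> K) :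
  irreflexive lt -> (forall i : 'I_n, alpha i = a (rev_ord i)) ->
  (forall i : 'I_n, beta i = b (rev_ord i)) ->
  antilex lt a b <-> lex lt n alpha beta.
Proof.
move=> irr aE bE; split=> [[j [_ ab abj]]|[j jn [ab abj]]].
  exists (rev_ord j); first exact: ltn_ord.
  split=> [i ij|]; last by rewrite aE bE rev_ordK.
  have i_n := ltn_trans ij (ltn_ord _).
  rewrite (aE (Ordinal i_n)) (bE (Ordinal i_n)) ab //=.
  by move: ij => /=; have := ltn_ord j; lia.
pose o := Ordinal jn; move: abj; rewrite (aE o) (bE o) => abj.
exists (rev_ord o); split => // [e|i /= oi]; first by move: abj; rewrite e irr.
rewrite -[i]rev_ordK -aE -bE; apply: ab => /=.
by have := ltn_ord i; lia.
Qed.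

Lemma rev_coords (K : Type) (k0 : K) n (a : 'I_n -> K) : exists alpha : nat -> K,
  forall i : 'I_n, alpha i = a (rev_ord i).
Proof.
exists (fun i => if insub i is Some j then a (rev_ord j) else k0) => i.
by rewrite valK.
Qed.

Section Frames.
Variables (T : choiceType) (t0 : T) (H : subgroup (symg T)).
Variables (K : finType) (ltK : rel K) (delta : nat -> nat -> K).
Variables (L : eqType) (x : nat -> L) (Al : nat -> pred L) (sub : seq L -> L -> L).
Variables (ev : (nat -> K) -> L -> K) (lc : seq T -> (nat -> K) -> T).
Variables (Fr : set (seq T)) (Sub : set (set T)).

Local Notation pword := (pword x Al).

Definition hull (u : seq T) : set T := range (lc u).

(** With [S] read as a matrix row by row, column [j] holds the coordinates in [u] of the new frame
    element number [j]. *)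
Definition cmp (k : nat) (u : seq T) (S : seq L) : seq T :=
  mkseq (fun j => lc u (fun i => ev (delta j) (nth (x 0) S i))) k.

(** Frames are the bases of the members of [Sub] and [lc u alpha] is the element
    with coordinates [alpha] in the frame [u]. *)
Record frame_system : Prop := {
  fs_letters : parameter_system x Al sub;
  fs_countable : countable [set: T];
  fs_order : strict_linear_order ltK;
  fs_card : 1 < #|K|;
  lc_ext : forall u alpha beta, (forall i, i < size u -> alpha i = beta i) ->
    lc u alpha = lc u beta;
  lc_inj : forall u alpha beta, Fr u -> lc u alpha = lc u beta ->
    forall i, i < size u -> alpha i = beta i;
  lc_unit : forall u j, j < size u -> lc u (delta j) = nth t0 u j;
  lc_cmp : forall u S k alpha, Fr u -> pword 0 S k -> size S = size u ->
    lc (cmp k u S) alpha = lc u (fun i => ev alpha (nth (x 0) S i));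
  cmp_frame : forall u S k, Fr u -> pword 0 S k -> size S = size u -> Fr (cmp k u S);
  ev_par : forall alpha j, ev alpha (x j) = alpha j;
  ev_ext : forall k a alpha beta, Al k a -> (forall i, i < k -> alpha i = beta i) ->
    ev alpha a = ev beta a;
  ev_sub : forall S k alpha a, pword 0 S k -> Al (size S) a ->
    ev alpha (sub S a) = ev (fun l => ev alpha (nth (x 0) S l)) a;
  frame_some : exists u, Fr u;
  frame_grow : forall u n, Fr u -> size u <= n -> exists2 v, Fr v & size v = n;
  Sub_hull : forall u, Fr u -> Sub (hull u);
  Sub_finite : forall U, Sub U -> finite_set U;
  Sub_cmp : forall u U, Fr u -> Sub U -> U `<=` hull u -> exists k S,
    [/\ pword 0 S k, size S = size u & hull (cmp k u S) = U];
  frame_extend : forall u v y, Fr u -> Fr v -> size u = size v -> exists u' v',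
    [/\ Fr u', Fr v', size u' = size v',
      forall alpha, exists alpha', lc u alpha = lc u' alpha' /\ lc v alpha = lc v' alpha'
      & hull u' y];
  aut_lc : forall g u alpha, subgroup_set H g -> g (lc u alpha) = lc (map g u) alpha;
  aut_frame : forall g u, subgroup_set H g -> Fr u -> Fr (map g u);
  aut_local : forall g : symg T, (forall l : seq T, exists u v,
    [/\ Fr u, Fr v, size u = size v &
      forall y, y \in l -> exists alpha, y = lc u alpha /\ g y = lc v alpha]) ->
    subgroup_set H g
}.

Hypothesis fs : frame_system.
Let sys := fs_letters fs.
Let ltK_slo := fs_order fs.

Definition natural_on (r : relspace T) (u : seq T) : Prop :=
  forall alpha beta, r (lc u alpha, lc u beta) = `[< lex ltK (size u) alpha beta >].

Lemma lc_hull u alpha : hull u (lc u alpha).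
Proof. by exists alpha. Qed.

Lemma size_cmp k u S : size (cmp k u S) = k.
Proof. exact: size_mkseq. Qed.

(** Let [j] be the first parameter at which the assignments differ. Rows before the one introducing
    [x j] involve only earlier parameters and agree; that row evaluates to the coordinate [j]
    itself. The converse follows from totality. *)
Lemma lex_word S k alpha beta : pword 0 S k -> lex ltK k alpha beta <->
  lex ltK (size S) (fun i => ev alpha (nth (x 0) S i)) (fun i => ev beta (nth (x 0) S i)).
Proof.
move=> Sk.
have imp a b : lex ltK k a b ->
  lex ltK (size S) (fun i => ev a (nth (x 0) S i)) (fun i => ev b (nth (x 0) S i)).
  move=> [j jk [ab abj]]; have [|S1 [S2 [eS S1j _]]] := pwordP Sk (q := j).
    by rewrite jk.
  exists (size S1); first by rewrite eS size_cat /= addnS ltnS leq_addr.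
  split=> [i iS1|]; last by rewrite eS nth_cat ltnn subnn /= !(ev_par fs).
  rewrite eS nth_cat iS1; apply: (ev_ext fs) ab.
  exact: (allP (pword_all sys S1j) _ (mem_nth _ iS1)).
split; first exact: imp.
move=> ltS; case: (lex_total ltK_slo k alpha beta) => // [ab|/imp ltS'].
  exfalso; apply: (lex_irr ltK_slo) ltS => i iS; apply: (ev_ext fs) ab.
  exact: (allP (pword_all sys Sk) _ (mem_nth _ iS)).
exfalso; apply: (lex_irr ltK_slo) (lex_trans ltK_slo ltS ltS').
by [].
Qed.

Lemma natural_cmp r u S k : Fr u -> pword 0 S k -> size S = size u ->
  natural_on r u -> natural_on r (cmp k u S).
Proof.
move=> Fu Sk sS nat_u alpha beta; rewrite !(lc_cmp fs) // nat_u size_cmp.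
by apply/asbool_equiv_eq; rewrite (lex_word _ _ Sk) sS.
Qed.

Lemma eq_frame u v : size u = size v -> (forall alpha, lc u alpha = lc v alpha) -> u = v.
Proof.
move=> suv uv; apply: (@eq_from_nth _ t0) => // j ju.
by rewrite -!(lc_unit fs) -?suv.
Qed.

Lemma cmp_comp u R S m k : Fr u -> pword 0 R m -> size R = size u -> pword 0 S k ->
  size S = m -> cmp k (cmp m u R) S = cmp k u (wcomp sub R S).
Proof.
move=> Fu Rm sR Sk sS; apply: eq_mkseq => j; rewrite (lc_cmp fs) //.
apply: (lc_ext fs) => i iu; rewrite /wcomp (nth_map (x 0)) ?sR //.
rewrite (ev_sub fs _ Sk) // sS; apply: (allP (pword_all sys Rm)).
by rewrite mem_nth // sR.
Qed.

Lemma aut_cmp g k u S : subgroup_set H g -> map g (cmp k u S) = cmp k (map g u) S.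
Proof.
move=> Hg; rewrite /cmp /mkseq -map_comp; apply: eq_map => j /=.
exact: (aut_lc fs).
Qed.

Let k0 := delta 0 0.

Definition coords n (a : {ffun 'I_n -> K}) (i : nat) : K :=
  if insub i is Some j then a j else k0.

Lemma coordsP n (alpha : nat -> K) : exists a : {ffun 'I_n -> K},
  forall i, i < n -> alpha i = coords a i.
Proof.
by exists [ffun i : 'I_n => alpha i] => i ilt; rewrite /coords insubT ffunE.
Qed.

Lemma coords_inj n (a b : {ffun 'I_n -> K}) :
  (forall i, i < n -> coords a i = coords b i) -> a = b.
Proof.
by move=> ab; apply/ffunP => i; have := ab i (ltn_ord i); rewrite /coords valK.
Qed.

Lemma hull_seq u : exists d : seq T, forall y, y \in d <-> hull u y.
Proof.
exists [seq lc u (coords a) | a : {ffun 'I_(size u) -> K}] => y; split.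
  by move=> /mapP[a _ ->]; exact: lc_hull.
move=> [alpha _ <-]; have [a aP] := coordsP (size u) alpha.
by rewrite (lc_ext fs aP); apply: map_f; rewrite mem_enum.
Qed.

(** Count: a hull has [#|K| ^ size u] elements, and [K] has at least two. *)
Lemma hull_size u v : Fr u -> Fr v -> hull u = hull v -> size u = size v.
Proof.
suff le w w' : Fr w -> Fr w' -> hull w = hull w' -> size w <= size w'.
  by move=> Fu Fv uv; apply/eqP; rewrite eqn_leq !le.
move=> Fw Fw' ww'.
have ex (a : {ffun 'I_(size w) -> K}) : exists b : {ffun 'I_(size w') -> K},
    lc w (coords a) = lc w' (coords b).
  have [beta _ <-] : hull w' (lc w (coords a)) by rewrite -ww'; exact: lc_hull.
  by have [b bP] := coordsP (size w') beta; exists b; exact: (lc_ext fs).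
have [phi phiP] := choice ex.
have phi_inj : injective phi.
  move=> a b ab; apply: coords_inj; apply: (lc_inj fs) => //.
  by rewrite !phiP ab.
have := leq_card _ phi_inj; rewrite !card_ffun !card_ord leq_exp2l //.
exact: (fs_card fs).
Qed.

(** Sending the element with given coordinates in [u] to the one with the same coordinates in [v] is
    an increasing self-map of a finite linear order, hence the identity. *)
Lemma natural_unique r u v : strict_linear_order (rel_of r) -> Fr u -> Fr v ->
  hull u = hull v -> natural_on r u -> natural_on r v -> u = v.
Proof.
move=> rlin Fu Fv uv nu nv; have suv := hull_size Fu Fv uv.
apply: (eq_frame suv) => alpha0.
have ex y : exists alpha, hull u y -> y = lc u alpha.
  have [[alpha _ <-]|nh] := EM (hull u y); first by exists alpha.
  by exists (fun=> k0).
have [co coP] := choice ex.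
have [d dP] := hull_seq u.
have coE alpha : lc v (co (lc u alpha)) = lc v alpha.
  apply: (lc_ext fs) => i; rewrite -suv; apply: (lc_inj fs) => //.
  by rewrite -coP //; exact: lc_hull.
rewrite -(coE alpha0); apply/esym.
apply: (@strictly_increasing_id T (rel_of r) d (fun y => lc v (co y))) => //.
- by move=> y _; apply/dP; rewrite uv; exact: lc_hull.
- move=> y z /dP hy /dP hz; rewrite {1}(coP _ hy) {1}(coP _ hz) /rel_of.
  by rewrite nu nv suv.
- by apply/dP; exact: lc_hull.
Qed.

Lemma frames_cofinal (s : seq T) : exists2 u, Fr u & forall y, y \in s -> hull u y.
Proof.
elim: s => [|y s [u Fu us]]; first by have [u Fu] := frame_some fs; exists u.
have [u' [v' [Fu' _ _ uu' u'y]]] := frame_extend fs y Fu Fu erefl.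
exists u' => // z; rewrite inE => /predU1P[->//|/us [alpha _ <-]].
by have [alpha' [-> _]] := uu' alpha; exact: lc_hull.
Qed.

Lemma Sub_frame U : Sub U -> exists2 u, Fr u & hull u = U.
Proof.
move=> SU; have /finite_seqP[s sE] := Sub_finite fs SU.
have [u Fu us] := frames_cofinal s.
have [|k [S [Sk sS <-]]] := Sub_cmp fs Fu SU; first by rewrite sE.
by exists (cmp k u S) => //; exact: (cmp_frame fs).
Qed.

(** Back and forth with the finite partial maps that preserve coordinates with respect to some pair
    of frames of equal size; [frame_extend], with the two frames in either order, gives both
    extension steps. *)
Lemma frames_homogeneous u v : Fr u -> Fr v -> size u = size v ->
  exists2 g : symg T, subgroup_set H g & map g u = v.
Proof.
move=> Fu Fv suv.
pose P (s : seq (T * T)) := exists u v, [/\ Fr u, Fr v, size u = size v &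
  forall p, p \in s -> exists alpha, p.1 = lc u alpha /\ p.2 = lc v alpha].
have P0 : P (zip u v).
  exists u, v; split => // p /(nthP (t0, t0))[i]; rewrite size_zip suv minnn => iv <-.
  by exists (delta i); rewrite nth_zip //= !(lc_unit fs) ?suv.
have [|||g [gE gP]] := back_and_forth (P := P) (fs_countable fs) _ _ _ P0.
- move=> s p q [{u Fu suv P0}u [{Fv}v [Fu Fv suv sP]]] /sP[a [-> ->]] /sP[b [-> ->]].
  apply/eqP/eqP => /(lc_inj fs) ab; apply: (lc_ext fs) => i.
    by rewrite -suv; exact: ab.
  by rewrite suv; exact: ab.
- move=> s y [{u Fu suv P0}u [{Fv}v [Fu Fv suv sP]]].
  have [u' [v' [Fu' Fv' suv' uu' [beta _ by_]]]] := frame_extend fs y Fu Fv suv.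
  exists (lc v' beta), u', v'; split => // p; rewrite inE => /predU1P[->|/sP].
    by exists beta.
  by move=> [a [-> ->]]; exact: uu'.
- move=> s y [{u Fu suv P0}u [{Fv}v [Fu Fv suv sP]]].
  have [v' [u' [Fv' Fu' suv' uu' [beta _ by_]]]] := frame_extend fs y Fv Fu (esym suv).
  exists (lc u' beta), u', v'; split => // p; rewrite inE => /predU1P[->|/sP].
    by exists beta.
  by move=> [a [-> ->]]; have [a' [? ?]] := uu' a; exists a'.
exists g.
  apply: (aut_local fs) => l; have [s [{P0}u' [v' [Fu' Fv' suv' sP]]] ls] := gP l.
  by exists u', v'; split => // y /ls /sP.
apply: (@eq_from_nth _ t0); rewrite size_map // => i iu.
rewrite (nth_map t0) // (gE (nth t0 u i, nth t0 v i)) //.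
by rewrite -nth_zip // mem_nth // size_zip suv minnn -suv.
Qed.

(** * The space of orderings with natural frames *)

Variable A : set (relspace T).
Hypothesis A_inv : forall g r, subgroup_set H g -> A r -> A (relspace_act g r).
Hypothesis AP : forall r, A r <-> strict_linear_order (rel_of r) /\
  forall U, Sub U -> exists u, [/\ Fr u, hull u = U & natural_on r u].

Definition locally_natural (r : relspace T) (U : set T) : Prop :=
  exists u, [/\ Fr u, hull u = U & natural_on r u].

(** Any three elements lie in one hull, where [r] is lexicographic. Membership in [A] thus reduces
    to conditions on finite sets, which are closed. *)
Lemma locally_natural_linear r : (forall U, Sub U -> locally_natural r U) ->
  strict_linear_order (rel_of r).
Proof.
move=> rS.
have cof (s : seq T) : exists u, [/\ Fr u, forall y, y \in s -> hull u y & natural_on r u].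
  have [u Fu us] := frames_cofinal s.
  by have [v [Fv vu nv]] := rS _ (Sub_hull fs Fu); exists v; rewrite vu.
split.
- move=> y; have [u [_ /(_ y (mem_head _ _))[a _ <-] nu]] := cof [:: y].
  by rewrite /rel_of nu; apply/asboolP; exact: lex_irr.
- move=> y z w; have [u [_ us nu]] := cof [:: y; z; w].
  have [[a _ <-] [b _ <-] [c _ <-]] : [/\ hull u y, hull u z & hull u w].
    by split; apply: us; rewrite !inE eqxx ?orbT.
  rewrite /rel_of !nu => /asboolP ba /asboolP ac; apply/asboolP.
  exact: lex_trans ba ac.
- move=> y z yz; have [u [_ us nu]] := cof [:: y; z].
  have [[a _ ay] [b _ bz]] : hull u y /\ hull u z.
    by split; apply: us; rewrite !inE eqxx ?orbT.
  rewrite -ay -bz in yz *.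
  case: (lex_total ltK_slo (size u) a b) => [ab|ab|ba].
  + by case: yz; exact: (lc_ext fs).
  + by left; rewrite /rel_of nu; apply/asboolP.
  + by right; rewrite /rel_of nu; apply/asboolP.
Qed.

Lemma frames_cofinal_Sub (l : seq (set T)) : (forall U, U \in l -> Sub U) ->
  exists2 u, Fr u & forall U, U \in l -> U `<=` hull u.
Proof.
move=> lS.
have [s sP] : exists s : seq T, forall U, U \in l -> forall y, U y -> y \in s.
  elim: l lS => [_|U l IHl lS]; first by exists [::].
  have [s sP] := IHl (fun V Vl => lS V (mem_behead (s := _ :: _) Vl)).
  have /finite_seqP[d dE] := Sub_finite fs (lS _ (mem_head _ _)).
  exists (d ++ s) => V; rewrite inE => /predU1P[->|/sP Vs] y.
    by rewrite dE mem_cat => /= ->.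
  by move=> /Vs; rewrite mem_cat => ->; rewrite orbT.
have [u Fu us] := frames_cofinal s; exists u => // U /sP Us y /Us; exact: us.
Qed.

Lemma locally_natural_closed U : Sub U -> closed [set r | locally_natural r U].
Proof.
move=> SU; apply: (agree_closed (Sub_finite fs SU)) => r r' rr' [u [Fu uU nu]].
exists u; split => // alpha beta; rewrite -nu rr' //; rewrite -uU; exact: lc_hull.
Qed.

Lemma natural_orderings_closed : closed A.
Proof.
have -> : A = \bigcap_(U in Sub) [set r | locally_natural r U].
  apply/seteqP; split => [r /AP[_ rS] U /rS//|r rS].
  by apply/AP; split; [exact: locally_natural_linear|].
by apply: closed_bigI => U SU; exact: locally_natural_closed.
Qed.

Lemma natural_ordering_ex u : Fr u -> exists r, natural_on r u.
Proof.
move=> Fu; exists (fun ab => `[< exists alpha beta,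
  ab = (lc u alpha, lc u beta) /\ lex ltK (size u) alpha beta >]) => alpha beta.
apply/asbool_equiv_eq; split; last by exists alpha, beta.
move=> [a [b [[ea eb]]]]; apply: eq_lex => i iu; apply/esym.
  exact: (lc_inj fs) ea i iu.
exact: (lc_inj fs) eb i iu.
Qed.

(** Finitely many members of [Sub] lie in one hull, and a lexicographic ordering of that hull is
    natural on all of them; compactness gives one ordering for the whole of [Sub]. *)
Lemma natural_orderings_nonempty : A !=set0.
Proof.
suff [r rS] : exists r, forall U, Sub U -> locally_natural r U.
  by exists r; apply/AP; split; [exact: locally_natural_linear|].
apply: (compact_fip (@relspace_compact T)) => [U|l lS]; first exact: locally_natural_closed.
have [u Fu ul] := frames_cofinal_Sub lS.
have [r nr] := natural_ordering_ex Fu; exists r => U Ul.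
have [k [S [Sk sS <-]]] := Sub_cmp fs Fu (lS _ Ul) (ul _ Ul).
by exists (cmp k u S); split => //; [exact: (cmp_frame fs) | exact: natural_cmp].
Qed.

(** A copy of [D] inside [hull b] maps the natural frame of [D] to a frame that is natural for [r];
    by uniqueness this is [cmp (size a) b S] for a parameter word [S]. So copies are words, and
    composing copies is composing words. *)
Lemma frames_ramsey_family : ramsey_family H A Sub.
Proof.
have nat_frame r U : A r -> Sub U -> exists u, [/\ Fr u, hull u = U & natural_on r u].
  by move=> /AP[_]; apply.
have copyP r t u (g : symg T) : natural_on r (map g u) -> natural_on t u -> subgroup_set H g ->
    forall a b, hull u a -> hull u b -> r (g a, g b) = t (a, b).
  move=> nr nt Hg _ _ [alpha _ <-] [beta _ <-].
  by rewrite !(aut_lc fs) // nr nt size_map.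
split.
- exact: (Sub_finite fs).
- move=> s; have [u Fu us] := frames_cofinal s.
  by exists (hull u) => //; exact: (Sub_hull fs).
- move=> r t U Ar At SU.
  have [u [Fu uU nu]] := nat_frame _ _ Ar SU.
  have [v [Fv vU nv]] := nat_frame _ _ At SU.
  have [g Hg gv] := frames_homogeneous Fv Fu (hull_size Fv Fu (etrans vU (esym uU))).
  by exists g; split => //; rewrite -vU; apply: copyP; rewrite ?gv.
move=> r t D B Ar At SD SB.
have [a [Fa aD na]] := nat_frame _ _ At SD.
have [b [Fb bB nb]] := nat_frame _ _ Ar SB.
have [n hn] := Ramsey_words sys (size a) bool (size b).
have bn : size b <= n.
  by have [R [<- Rw _]] := hn (fun=> true); exact: pword_size Rw.
(* [w0] supplies a hull of the right size; [w] is the frame of that hull that is natural for [r]. *)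
have [w0 Fw0 sw0] := frame_grow fs Fb bn.
have [w [Fw ww0 nw]] := nat_frame _ _ Ar (Sub_hull fs Fw0).
have sw : size w = n by rewrite -sw0; exact: hull_size.
exists (hull w); first exact: (Sub_hull fs).
move=> c cP.
(* A frame is coloured through any automorphism mapping [a] to it; the choice is immaterial because
   the colour depends only on the restriction to [D]. *)
pose pickg (v : seq T) : symg T := xget 1%g [set g | subgroup_set H g /\ map g a = v].
have [R [sR Rw [chi hchi]]] := hn (fun S => c (pickg (cmp (size a) w S))).
have sRw : size R = size w by rewrite sR.
have [g Hg gb] := frames_homogeneous Fb (cmp_frame fs Fw Rw sRw) (esym (size_cmp _ _ _)).
have gB y : hull b y -> hull w (g y).
  by move=> [alpha _ <-]; rewrite (aut_lc fs) // gb (lc_cmp fs) //; exact: lc_hull.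
exists g; first split => //; rewrite -?bB //.
  apply: (copyP _ _ b) => //; rewrite gb.
  exact: natural_cmp.
suff cE h : is_copy H r t D (hull b) h -> c (g * h)%g = chi.
  by move=> h h' /cE -> /cE ->.
move=> [Hh hD ht].
have Fh : Fr (map h a) by exact: (aut_frame fs).
have [k [S [Sk sS hS]]] : exists k S, [/\ pword 0 S k, size S = size b &
    hull (cmp k b S) = hull (map h a)].
  apply: (Sub_cmp fs Fb); first exact: (Sub_hull fs).
  by move=> _ [alpha _ <-]; rewrite -(aut_lc fs) //; apply: hD; rewrite -aD; exact: lc_hull.
have FS := cmp_frame fs Fb Sk sS.
have sk : k = size a by have := hull_size FS Fh hS; rewrite size_cmp size_map.
subst k.
have haS : map h a = cmp (size a) b S.
  apply: (@natural_unique r); rewrite ?hS //; [by have /AP[] := Ar| |exact: natural_cmp].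
  move=> alpha beta; rewrite -!(aut_lc fs) // ht ?na ?size_map // -aD; exact: lc_hull.
have ghS : map (g * h)%g a = cmp (size a) w (wcomp sub R S).
  by rewrite -(@cmp_comp w R S (size b)) // -gb -aut_cmp // -haS -map_comp.
have [Hp pE] : subgroup_set H (pickg (cmp (size a) w (wcomp sub R S))) /\
    map (pickg (cmp (size a) w (wcomp sub R S))) a = cmp (size a) w (wcomp sub R S).
  apply: (xgetPex 1%g (P := [set g | subgroup_set H g /\
    map g a = cmp (size a) w (wcomp sub R S)])).
  by exists (g * h)%g; split => //; exact: subgroupM.
rewrite -(hchi S) //; apply: cP => //; first exact: subgroupM.
move=> y; rewrite -aD => -[alpha _ <-].
by rewrite !(aut_lc fs) ?pE ?ghS //; exact: subgroupM.
Qed.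

Theorem frames_universal_minimal_flow : is_universal_minimal_flow (restricted_act A_inv).
Proof.
apply: (@ordering_universal_minimal_flow _ _ _ _ Sub).
- exact: natural_orderings_closed.
- exact: natural_orderings_nonempty.
- exact: frames_ramsey_family.
Qed.

End Frames.

(** * Equivalence relations *)

Definition bpar (j : nat) : nat := j.
Definition bletter (k : nat) : pred nat := fun a => a < k.
Definition bsub (S : seq nat) (a : nat) : nat := nth 0 S a.

Lemma bletters_pword i S k : pword bpar bletter i S k -> all (bletter k) S.
Proof. by apply: pword_letters => [j a /leqW|j] //; exact: ltnSn. Qed.

Lemma boolean_letters : parameter_system bpar bletter bsub.
Proof.
rewrite /bletter /bsub /bpar; split => //.
- by move=> S S1 a aS; rewrite nth_cat aS.
- by move=> S k a /bletters_pword/allP SA aS; apply: SA; rewrite mem_nth.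
- move=> S k b Sk bk; have [|S1 [S2 [eS _ _]]] := pwordP Sk (q := b); first by rewrite bk.
  exists (size S1); last by rewrite eS nth_cat ltnn subnn.
  by rewrite eS size_cat /= addnS ltnS leq_addr.
- by move=> T S k a _ _ aT; rewrite (nth_map 0).
- by move=> k; exists (iota 0 k) => a ak; rewrite mem_iota.
- by move=> k a /leqW.
- by move=> j q; rewrite -leqNgt.
Qed.

Lemma index_word (T : eqType) (l : seq T) : exists w, [/\ uniq w, w =i l &
  pword bpar bletter 0 [seq index a w | a <- l] (size w)].
Proof.
elim/last_ind: l => [|l a [w [uw wl lw]]]; first by exists [::]; split => //; exact: PwNil.
have [aw|aw] := boolP (a \in w).
  exists w; split => // [b|].
    by rewrite mem_rcons inE -wl; case: eqP => // ->.
  by rewrite map_rcons; apply: PwConst => //; rewrite /bletter index_mem.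
exists (rcons w a); split.
- by rewrite rcons_uniq aw.
- by move=> b; rewrite !mem_rcons !inE wl.
rewrite map_rcons size_rcons.
have -> : index a (rcons w a) = bpar (size w).
  by rewrite -cats1 index_cat (negPf aw) /= eqxx addn0.
rewrite (_ : [seq index b (rcons w a) | b <- l] = [seq index b w | b <- l]).
  exact: PwVar.
by apply/eq_in_map => b; rewrite -wl -cats1 index_cat => ->.
Qed.

Lemma count_ltn_iota t j : j <= t -> count (fun i => i < j) (iota 0 t) = j.
Proof.
move=> jt; rewrite -{1}(subnKC jt) iotaD count_cat.
have /eqP -> : count (fun i => i < j) (iota 0 j) == size (iota 0 j).
  by rewrite -all_count; apply/allP => i; rewrite mem_iota.
rewrite size_iota [X in _ + X](_ : _ = 0) ?addn0 //.
by apply/eqP; rewrite -leqn0 leqNgt -has_count; apply/hasPn => i; rewrite mem_iota; lia.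
Qed.

(** A [t]-subset of [m] is coded by the rigid surjection whose pivots are its
    elements, shifted by one because the first letter is always a pivot. *)
Lemma increasing_ramsey t m : exists n, forall c : seq nat -> bool,
  exists h : nat -> nat, [/\ forall i j, i < j < m -> h i < h j,
    forall i, i < m -> h i < n &
    exists chi, forall f : nat -> nat, (forall i j, i < j < t -> f i < f j) ->
      (forall i, i < t -> f i < m) -> c (mkseq (fun i => h (f i)) t) = chi].
Proof.
have [n hn] := Ramsey_words boolean_letters t.+1 bool m.+1; exists n => c.
have [R [sR Rw [chi hchi]]] := hn (fun S => c (mkseq (fun j => index j.+1 S) t)).
have piv q : q < m.+1 -> exists R1 R2, [/\ R = R1 ++ q :: R2, pword bpar bletter 0 R1 q &
    index q R = size R1].
  move=> qm; have [R1w [R2 [eR _]]] := pword_trunc boolean_letters Rw qm.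
  exists (trunc bpar q R), R2; split => //.
  rewrite {1}eR index_cat /= eqxx addn0 ifN //.
  exact: (pword_notin boolean_letters (leqnn q) R1w).
exists (fun i => index i.+1 R); split.
- move=> i j /andP[ij jm]; have [R1 [R2 [eR R1w ->]]] := piv j.+1 jm.
  have [|R3 [R4 [eR1 _ _]]] := pwordP R1w (q := i.+1); first by lia.
  rewrite eR eR1 -catA index_cat; case: ifP => iR3.
    by rewrite size_cat /= (leq_trans (n := size R3)) ?leq_addr // index_mem.
  by rewrite /bpar /= eqxx size_cat /=; lia.
- move=> i im; have [R1 [R2 [eR _ ->]]] := piv i.+1 im.
  by rewrite -sR eR size_cat /=; lia.
exists chi => f fincr fm.
(* [s l] is the number of values of [f] below [l]. It increases right after each value, so in the
   word of its values at [0, ..., m] the parameter [j.+1] first occurs at position [(f j).+1]. *)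
pose s l := count (fun j => f j < l) (iota 0 t).
have flt i j : i < t -> j < t -> (f i < f j) = (i < j).
  move=> it jt; case: (ltngtP i j) => [ij|ji|->]; last by rewrite ltnn.
    by rewrite fincr // ij.
  by apply/negbTE; rewrite -leqNgt ltnW // fincr // ji.
have sf j : j < t -> s (f j) = j.
  move=> jt; rewrite -[RHS](count_ltn_iota (ltnW jt)); apply: eq_in_count => i.
  by rewrite mem_iota => /= it; rewrite flt.
have finj : {in iota 0 t &, injective f}.
  move=> i j; rewrite !mem_iota /= => it jt fij.
  by case: (ltngtP i j) => // h; [have := flt i j it jt|have := flt j i jt it]; rewrite h fij ltnn.
have sS l : s l.+1 = s l + (l \in [seq f j | j <- iota 0 t]).
  rewrite -count_uniq_mem ?map_inj_in_uniq ?iota_uniq //.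
  rewrite count_map /s -count_predUI [X in _ + X](_ : _ = 0) ?addn0.
    by apply: eq_count => j /=; rewrite ltnS leq_eqVlt orbC.
  apply/eqP; rewrite -leqn0 leqNgt -has_count; apply/hasPn => j _ /=.
  by case: eqP => [->|]; rewrite ?ltnn ?andbF.
pose S := mkseq s m.+1.
have s0 : s 0 = 0.
  by apply/eqP; rewrite -leqn0 leqNgt -has_count; apply/hasPn.
have Sw : pword bpar bletter 0 S t.+1.
  have -> : t.+1 = (s m).+1.
    rewrite -[in LHS](size_iota 0 t); congr _.+1; apply/esym/eqP; rewrite -all_count.
    by apply/allP => j; rewrite mem_iota /= => /fm.
  rewrite /S; elim: (m) => [|l IHl].
    have -> : mkseq s 1 = rcons [::] (bpar 0) by rewrite /mkseq /= s0.
    by rewrite s0; apply: PwVar; exact: PwNil.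
  rewrite mkseqS sS; case: (l \in _); last first.
    by rewrite addn0; apply: PwConst; rewrite // /bletter ltnS.
  by rewrite addn1; exact: PwVar IHl.
rewrite -(hchi S) ?size_mkseq //; congr c; apply/eq_in_map => j; rewrite mem_iota => /= jt.
have [|R1 [R2 [eR R1w ->]]] := piv (f j).+1; first by rewrite ltnS fm.
have SE a : a < m.+1 -> bsub S a = s a by move=> am; rewrite /bsub nth_mkseq.
have e1 : bsub S (f j).+1 = j.+1.
  rewrite SE ?ltnS ?fm // sS sf // (_ : f j \in _) ?addn1 //.
  by rewrite map_f // mem_iota.
rewrite eR /wcomp map_cat index_cat map_cons e1 /= eqxx addn0 size_map ifN //; apply/negP => /mapP[a /(allP (bletters_pword R1w))]; rewrite /bletter ltnS => aj.
have := fm _ jt => fjm; rewrite SE; last by rewrite ltnS (leq_trans aj) // ltnW.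
move=> e; have : s a <= s (f j) by apply: sub_count => i /= /leq_trans; apply.
by rewrite -e sf // ltnn.
Qed.

Lemma sort_index (T : eqType) (r : rel T) n (f : nat -> T) : strict_linear_order r ->
  (forall i j, i < n -> j < n -> f i = f j -> i = j) ->
  exists s : nat -> nat, [/\ forall i, i < n -> s i < n,
    forall j, j < n -> exists2 i, i < n & j = s i &
    forall i j, i < j < n -> r (f (s i)) (f (s j))].
Proof.
move=> [irr tr tot] finj; pose le i j := ~~ r (f j) (f i).
have le_tot : total le.
  move=> i j; rewrite /le -negb_and; apply/negP => /andP[ji ij].
  by have := tr _ _ _ ij ji; rewrite irr.
have le_tr : transitive le.
  move=> j i k; rewrite /le => ij jk; apply/negP => ki.
  have [e|/tot[h|h]] := EM (f i = f j); [|by rewrite (tr _ _ _ ki h) in jk|by rewrite h in ij].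
  by rewrite -e ki in jk.
pose s := sort le (iota 0 n).
have ss : size s = n by rewrite size_sort size_iota.
have mems i : (i \in s) = (i < n) by rewrite mem_sort mem_iota.
exists (nth 0 s); split=> [i iln|j|i j /andP[ij jn]].
- by rewrite -mems mem_nth ?ss.
- by rewrite -mems => /(nthP 0)[i]; rewrite ss => iln <-; exists i.
have iln := ltn_trans ij jn.
have sij : nth 0 s i < n /\ nth 0 s j < n by rewrite -!mems !mem_nth ?ss.
have := sorted_ltn_nth le_tr 0 (sort_sorted le_tot (iota 0 n)).
move=> /(_ i j); rewrite !inE -/s ss => /(_ iln jn ij); rewrite /le => nr.
have [|//|h] := tot (f (nth 0 s i)) (f (nth 0 s j)); last by rewrite h in nr.
move=> /finj; rewrite !(sij.1, sij.2) => /(_ isT isT)/eqP.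
by rewrite nth_uniq ?ss ?sort_uniq ?iota_uniq // ltn_eqF.
Qed.

Section EqRel.
Variable E : rel nat.
Hypothesis E_eq : equivalence_rel E.
Hypothesis E_classes : infinite_set (range (fun x => [set y | E x y])).
Hypothesis E_class : forall x, infinite_set [set y | E x y].

Let E_refl x : E x x. Proof. by have [] := E_eq x x x. Qed.

Let E_sym x y : E x y = E y x.
Proof.
have imp a b : E a b -> E b a by move=> h; have [_ /(_ h) <-] := E_eq a b a.
by apply/idP/idP; exact: imp.
Qed.

Let E_trans x y z : E x y -> E x z = E y z.
Proof. by have [_] := E_eq x y z. Qed.

Lemma fresh_class (s : seq nat) : exists y, forall x, x \in s -> ~~ E x y.
Proof.
apply: contrapT => ny; apply: E_classes.
apply: (@sub_finite_set _ _ ((fun x => [set y | E x y]) @` [set` s])).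
  move=> _ [y _ <-]; apply: contrapT => nx; apply: ny; exists y => x xs.
  apply/negP => Exy; apply: nx; exists x => //.
  by apply/seteqP; split => z /=; rewrite (E_trans _ Exy).
by apply: finite_image; exact: finite_seq.
Qed.

Lemma fresh_member x (s : seq nat) : exists2 y, E x y & y \notin s.
Proof.
apply: contrapT => ny; apply: (E_class (x := x)).
apply: (@sub_finite_set _ _ [set` s]); last exact: finite_seq.
by move=> y /= Exy; apply: contrapT => /negP ys; apply: ny; exists y.
Qed.

(** * Grids: finitely many classes, equally many elements of each *)

Definition grid k l (c : nat -> nat -> nat) : Prop :=
  (forall i j i' j', i < k -> j < l -> i' < k -> j' < l ->
     E (c i j) (c i' j') = (i == i')) /\
  (forall i j j', i < k -> j < l -> j' < l -> c i j = c i j' -> j = j').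

Definition gridset k l (c : nat -> nat -> nat) : set nat :=
  [set y | exists i j, [/\ i < k, j < l & y = c i j]].

Lemma grid_inj k l c i j i' j' : grid k l c -> i < k -> j < l -> i' < k -> j' < l ->
  (c i j == c i' j') = (i == i') && (j == j').
Proof.
move=> [cE cinj] ik jl i'k j'l; apply/eqP/andP => [e|[/eqP-> /eqP->//]].
have /eqP ii' : i == i' by rewrite -(cE _ j _ j') // e.
by rewrite -ii' in e *; rewrite (cinj i j j').
Qed.

Definition partial_iso (s : seq (nat * nat)) : Prop := forall p q, p \in s -> q \in s ->
  (p.1 == q.1) = (p.2 == q.2) /\ E p.1 q.1 = E p.2 q.2.

(** A point outside the domain goes to a fresh element of the corresponding class if its class
    already meets the domain, and into a fresh class otherwise. *)
Lemma partial_iso_extend s x : partial_iso s -> exists y, partial_iso ((x, y) :: s).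
Proof.
move=> Ps.
have add y : (forall p, p \in s -> (p.1 == x) = (p.2 == y) /\ E p.1 x = E p.2 y) ->
    exists y, partial_iso ((x, y) :: s).
  move=> yP; exists y => p q; rewrite !inE => /predU1P[->|ps] /predU1P[->|qs] //=.
  - by rewrite !eqxx !E_refl.
  - by have [e1 e2] := yP _ qs; rewrite ![x == _]eq_sym ![y == _]eq_sym e1 ![E x _]E_sym ![E y _]E_sym e2.
  - exact: yP.
  - exact: Ps.
have [[q qs qx]|nx] := EM (exists2 q, q \in s & q.1 = x).
  by apply: (add q.2) => p ps; rewrite -qx; exact: Ps.
have nxE p : p \in s -> (p.1 == x) = false by move=> ps; apply/negP => /eqP px; apply: nx; exists p.
have [[q qs qx]|nEx] := EM (exists2 q, q \in s & E q.1 x).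
  have [y qy ys] := fresh_member q.2 [seq p.2 | p <- s].
  apply: (add y) => p ps; rewrite nxE //; split.
    by apply/esym/negbTE; apply: contraNneq ys => <-; exact: map_f.
  have [_ e] := Ps p q ps qs.
  by rewrite [LHS]E_sym [RHS]E_sym -(E_trans _ qx) -(E_trans _ qy) E_sym e E_sym.
have [y yP] := fresh_class [seq p.2 | p <- s].
apply: (add y) => p ps; have := yP _ (map_f _ ps) => /negbTE Ey; rewrite nxE // Ey; split.
  by apply/esym/negP => /eqP e; move: Ey; rewrite e E_refl.
by apply/negP => Ex; apply: nEx; exists p.
Qed.

Lemma partial_iso_swap s : partial_iso s -> partial_iso [seq (p.2, p.1) | p <- s].
Proof.
by move=> Ps _ _ /mapP[p ps ->] /mapP[q qs ->] /=; have [-> ->] := Ps p q ps qs.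
Qed.

Lemma grid_homogeneous k l c c' : grid k l c -> grid k l c' ->
  exists2 g : symg nat, eqrel_aut_set E g &
    forall i j, i < k -> j < l -> g (c i j) = c' i j.
Proof.
move=> gc gc'; pose s := [seq (c i j, c' i j) | i <- iota 0 k, j <- iota 0 l].
have Ps : partial_iso s.
  move=> _ _ /allpairsP[[i j] /= [ik jl ->]] /allpairsP[[i' j'] /= [i'k j'l ->]] /=.
  rewrite !mem_iota /= in ik jl i'k j'l.
  rewrite (grid_inj gc) // (grid_inj gc') //; split => //.
  by have [-> // _] := gc; have [-> // _] := gc'.
have [|||g [gE gP]] := @back_and_forth nat partial_iso (countableP _) _ _ _ s Ps.
- by move=> t p q Pt pt qt; have [] := Pt p q pt qt.
- by move=> t x; exact: partial_iso_extend.
- move=> t y /partial_iso_swap/(partial_iso_extend y)[x /partial_iso_swap].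
  rewrite /= -map_comp map_id_in => [|[]//]; by exists x.
exists g => [x y|i j ik jl].
  have [t Pt tP] := gP [:: x; y].
  have yt : (y, g y) \in t by apply: tP; rewrite !inE eqxx orbT.
  by have [_ /= ->] := Pt _ _ (tP x (mem_head _ _)) yt.
apply: (gE (c i j, c' i j)); apply/allpairsP; exists (i, j).
by rewrite !mem_iota.
Qed.

Definition natural_grid (r : relspace nat) k l c : Prop :=
  forall i j i' j', i < k -> j < l -> i' < k -> j' < l ->
  r (c i j, c i' j') = (i < i') || (i == i') && (j < j').

Lemma slo_asym (T : Type) (r : rel T) a b : strict_linear_order r -> r a b -> r b a = false.
Proof.
by move=> [irr tr _] ab; apply/negP => ba; have := tr _ _ _ ab ba; rewrite irr.
Qed.

Lemma natural_gridP r k l c : strict_linear_order (rel_of r) ->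
  (forall i j i' j', i < i' < k -> j < l -> j' < l -> r (c i j, c i' j')) ->
  (forall i j j', i < k -> j < j' < l -> r (c i j, c i j')) ->
  natural_grid r k l c.
Proof.
move=> rlin r1 r2 i j i' j' ik jl i'k j'l; have [irr _ _] := rlin.
case: (ltngtP i i') => [ii'|i'i|<-] /=.
- by rewrite r1 // ii'.
- by apply: (slo_asym rlin); apply: r1; rewrite // i'i.
case: (ltngtP j j') => [jj'|j'j|<-].
- by rewrite r2 // jj'.
- by apply: (slo_asym rlin); apply: r2; rewrite // j'j.
exact: irr.
Qed.

Lemma convex_classes r x x' y y' : convex_orderings E r -> E x x' -> E y y' ->
  ~~ E x y -> r (x, y) -> r (x', y').
Proof.
move=> [rlin conv] xx' yy' nxy xy; have [_ _ tot] := rlin.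
have x'y : r (x', y).
  have [e|//|yx'] := tot x' y; first by move: nxy; rewrite -e xx'.
  by move: nxy; rewrite (conv x y x').
have [e|//|y'x'] := tot x' y'; first by move: nxy; rewrite (E_trans _ xx') e E_sym yy'.
have : E y' x' by apply: (conv y' x' y) => //; rewrite E_sym.
by move: nxy; rewrite (E_trans _ xx') -(E_trans _ yy') [E x' _]E_sym => /negbTE ->.
Qed.

(** Rows are sorted by their entries in column 0, which exists because there are [l.+1] columns; by
    convexity this decides the order of whole classes. Then each row is sorted internally. *)
Lemma sort_grid r k l c : convex_orderings E r -> grid k l.+1 c -> exists c',
  [/\ grid k l.+1 c', gridset k l.+1 c' = gridset k l.+1 c & natural_grid r k l.+1 c'].
Proof.
move=> Ar gc; have [rlin _] := Ar.
have /choice[tau tauP] i : exists t : nat -> nat, i < k ->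
    [/\ forall j, j < l.+1 -> t j < l.+1,
    forall j, j < l.+1 -> exists2 j', j' < l.+1 & j = t j' &
    forall j j', j < j' < l.+1 -> r (c i (t j), c i (t j'))].
  have [ik|_] := boolP (i < k); last by exists id.
  have [|t tP] := sort_index (n := l.+1) (f := c i) rlin; last by exists t.
  by move=> j j' jl j'l; have [_] := gc; apply.
have [|s [s1 s2 s3]] := sort_index (n := k) (f := fun i => c i 0) rlin.
  by move=> i i' ik i'k /eqP; rewrite (grid_inj gc) // => /andP[/eqP].
exists (fun i j => c (s i) (tau (s i) j)); have [cE cinj] := gc.
have sE i i' : i < k -> i' < k -> (s i == s i') = (i == i').
  move=> ik i'k; apply/eqP/eqP => [e|->//]; have [irr _ _] := rlin.
  by case: (ltngtP i i') => // h; [have := s3 i i'|have := s3 i' i];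
    rewrite h ?ik ?i'k e => /(_ isT); rewrite /= irr.
have tinj i j j' : i < k -> j < l.+1 -> j' < l.+1 -> tau i j = tau i j' -> j = j'.
  move=> ik jl j'l e; have [_ _ t3] := tauP i ik; have [irr _ _] := rlin.
  have rirr a : r (a, a) = false by exact: irr.
  case: (ltngtP j j') => // h.
    by have := t3 j j'; rewrite h j'l e rirr => /(_ isT).
  by have := t3 j' j; rewrite h jl e rirr => /(_ isT).
have tlt i j : i < k -> j < l.+1 -> tau i j < l.+1 by move=> /tauP[t1 _ _]; exact: t1.
split.
- split=> [i j i' j' ik jl i'k j'l|i j j' ik jl j'l].
    by rewrite cE ?sE //; [exact: s1|apply: tlt => //; exact: s1|exact: s1|apply: tlt => //; exact: s1].
  by move=> /cinj e; apply: (tinj (s i)); rewrite ?s1 // e ?s1 ?tlt ?s1.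
- apply/seteqP; split=> [_ [i [j [ik jl ->]]]|_ [i [j [ik jl ->]]]].
    by exists (s i), (tau (s i) j); rewrite s1 // tlt // s1.
  have [i' i'k ->] := s2 i ik; have [_ t2 _] := tauP _ (s1 _ i'k).
  by have [j' j'l ->] := t2 j jl; exists i', j'.
- apply: natural_gridP => // [i j i' j' /andP[ii' i'k] jl j'l|i j j' ik jj'].
    have ik := ltn_trans ii' i'k; have si := s1 i ik; have si' := s1 i' i'k.
    apply: (@convex_classes r (c (s i) 0) _ (c (s i') 0)) => //.
    + by rewrite cE ?tlt.
    + by rewrite cE ?tlt.
    + by rewrite cE // sE // ltn_eqF.
    + by apply: s3; rewrite ii'.
  by have [_ _ t3] := tauP _ (s1 i ik); exact: t3.
Qed.

Lemma row_extend x (s : seq nat) n : uniq s -> all (E x) s -> size s <= n ->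
  exists w, [/\ uniq w, all (E x) w, size w = n & {subset s <= w}].
Proof.
move=> us sE /subnK <-; elim: (n - size s) => [|m [w [uw wE sw sub]]].
  by exists s; split => // z.
have [y xy yw] := fresh_member x w.
exists (y :: w); rewrite /= yw uw xy wE sw; split => // z /sub.
by rewrite inE orbC => ->.
Qed.

(** Row [i] consists of the elements of [s] in the class of the representative number [i], filled up
    with fresh elements of that class. *)
Lemma grid_of_reps (w s : seq nat) n : pairwise (fun a b => ~~ E a b) w -> size s <= n ->
  exists2 c, grid (size w) n c & forall i y, i < size w -> y \in s -> E (nth 0 w i) y ->
    exists2 j, j < n & y = c i j.
Proof.
move=> /(pairwiseP 0) pw sn.
have /choice[row rowP] i : exists v, [/\ uniq v, all (E (nth 0 w i)) v, size v = n &
    {subset [seq y <- undup s | E (nth 0 w i) y] <= v}].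
  apply: row_extend; rewrite ?filter_uniq ?undup_uniq ?filter_all //.
  by rewrite size_filter (leq_trans (count_size _ _)) // (leq_trans (size_undup _)).
exists (fun i j => nth 0 (row i) j).
  split=> [i j i' j' ik jn i'k j'n|i j j' ik jn j'n].
    have [_ /allP iE si _] := rowP i; have [_ /allP i'E si' _] := rowP i'.
    have e := iE _ (mem_nth 0 (n := j) _); have e' := i'E _ (mem_nth 0 (n := j') _).
    rewrite -(E_trans _ (e _)) ?si // E_sym -(E_trans _ (e' _)) ?si' //.
    case: (ltngtP i i') => [ii'|i'i|->]; last exact: E_refl.
      by rewrite E_sym; apply/negbTE; exact: pw.
    by apply/negbTE; exact: pw.
  have [ui _ si _] := rowP i => /eqP; rewrite nth_uniq ?si //.
  by move=> /eqP.
move=> i y ik ys Ey; have [_ _ si sub] := rowP i.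
have : y \in row i by apply: sub; rewrite mem_filter Ey mem_undup.
by move=> /(nthP 0)[j]; rewrite si => jn <-; exists j.
Qed.

Lemma reps_cover (s : seq nat) : exists w, pairwise (fun a b => ~~ E a b) w /\
  forall y, y \in s -> exists2 i, i < size w & E (nth 0 w i) y.
Proof.
elim: s => [|y s [w [pw ws]]]; first by exists [::].
have [/(has_nthP 0)[i iw Ey]|/hasPn ny] := boolP (has (fun a => E a y) w).
  by exists w; split => // z; rewrite inE => /predU1P[->|/ws//]; exists i.
exists (y :: w); split.
  rewrite /= pw andbT; apply/allP => a /ny; by rewrite E_sym.
move=> z; rewrite inE => /predU1P[->|/ws[i iw Ez]]; first by exists 0.
by exists i.+1.
Qed.

Lemma grid_ex k l : exists c, grid k l c.
Proof.
have [w pw <-] : exists2 w, pairwise (fun a b => ~~ E a b) w & size w = k.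
  elim: k => [|k [w pw sw]]; first by exists [::].
  have [y yw] := fresh_class w; exists (y :: w); rewrite /= ?sw // pw andbT.
  by apply/allP => a /yw; rewrite E_sym.
by have [c gc _] := grid_of_reps pw (leq0n l : size [::] <= l); exists c.
Qed.

Definition grid_family : set (set nat) :=
  [set D | exists k l c, grid k l.+1 c /\ D = gridset k l.+1 c].

Lemma grid_cofinal (s : seq nat) : exists2 D, grid_family D & forall a, a \in s -> D a.
Proof.
have [w [pw ws]] := reps_cover s.
have [c gc cs] := grid_of_reps pw (leqnSn (size s)).
exists (gridset (size w) (size s).+1 c); first by exists (size w), (size s), c.
move=> y ys; have [i iw Ey] := ws _ ys; have [j jn ->] := cs i y iw ys Ey.
by exists i, j.
Qed.

Lemma grid_finite D : grid_family D -> finite_set D.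
Proof.
move=> [k [l [c [_ ->]]]].
apply: (@sub_finite_set _ _ [set` [seq c i j | i <- iota 0 k, j <- iota 0 l.+1]]).
  by move=> _ [i [j [ik jl ->]]]; apply/allpairsP; exists (i, j); rewrite !mem_iota.
exact: finite_seq.
Qed.

Lemma natural_grid_family r D : convex_orderings E r -> grid_family D -> exists k l c,
  [/\ grid k l.+1 c, D = gridset k l.+1 c & natural_grid r k l.+1 c].
Proof.
move=> Ar [k [l [c [gc ->]]]]; have [c' [gc' e nc']] := sort_grid Ar gc.
by exists k, l, c'.
Qed.

(** The subgrid with rows [phi] and columns [psi] is coded by an increasing sequence of blocks:
    block [i] starts where block [phi i] of the large grid starts, which names the row, and then
    visits the columns [psi i], shifted by one to make room for that first entry. *)
Lemma grid_pieces (h : nat -> nat) k l p t phi (psi : nat -> nat -> nat) : 0 < l ->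
  (forall i j, i < j < p * l.+1 -> h i < h j) ->
  (forall i i', i < i' < k -> phi i < phi i') -> (forall i, i < k -> phi i < p) ->
  (forall i j j', i < k -> j < j' < t -> psi i j < psi i j') ->
  (forall i j, i < k -> j < t -> psi i j < l) ->
  exists f : nat -> nat, [/\ forall i j, i < j < k * t.+1 -> f i < f j,
    forall i, i < k * t.+1 -> f i < p * l.+1,
    forall i, i < k -> f (i * t.+1) = phi i * l.+1 &
    forall i j, i < k -> j < t -> f (i * t.+1 + j.+1) = phi i * l.+1 + (psi i j).+1].
Proof.
move=> l0 hincr phi1 phi2 psi1 psi2.
pose psi' i j := if j is j'.+1 then (psi i j').+1 else 0.
pose f q := phi (q %/ t.+1) * l.+1 + psi' (q %/ t.+1) (q %% t.+1).
have fE i j : j < t.+1 -> f (i * t.+1 + j) = phi i * l.+1 + psi' i j.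
  by move=> jt; rewrite /f divnMDl // divn_small // addn0 modnMDl modn_small.
have psi'l i j : i < k -> j < t.+1 -> psi' i j < l.+1.
  by case: j => // j ik; rewrite ltnS => jt; rewrite /= ltnS psi2.
have psi'i i j j' : i < k -> j < j' < t.+1 -> psi' i j < psi' i j'.
  case: j' => [|j'] ik; first by lia.
  by case: j => [|j] //= jj'; rewrite ltnS psi1.
have dec q : q < k * t.+1 -> exists i j, [/\ q = i * t.+1 + j, i < k & j < t.+1].
  move=> qk; exists (q %/ t.+1), (q %% t.+1); split; last exact: ltn_pmod.
    exact: divn_eq.
  by rewrite ltn_divLR.
exists f; split=> [q q' /andP[qq' q'k]|q /dec[i [j [-> ik jt]]]|i ik|i j ik jt].
- have [i [j [eq ik jt]]] := dec q (ltn_trans qq' q'k).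
  have [i' [j' [eq' i'k j't]]] := dec q' q'k.
  have b := psi'l i j ik jt; rewrite eq eq' !fE //.
  case: (ltngtP i i') => [ii'|i'i|ii'].
  + have := phi1 i i'; rewrite ii' i'k => /(_ isT); nia.
  + by exfalso; nia.
  + rewrite -ii' in eq' *; rewrite ltn_add2l psi'i // j't andbT.
    by move: qq'; rewrite eq eq' ltn_add2l.
- rewrite fE //; have := phi2 i ik; have := psi'l i j ik jt; nia.
- by rewrite -[i * _]addn0 fE // !addn0.
- by rewrite fE.
Qed.

(** One increasing sequence codes a whole subgrid: in a block of length [l.+2] the first entry is a
    row and the other [l.+1] entries are columns. This replaces a product of Ramsey theorems by a
    single one; that different rows use different columns does no harm. *)
Lemma convex_orderings_ramsey : ramsey_family (eqrel_aut E) (convex_orderings E) grid_family.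
Proof.
split.
- exact: grid_finite.
- exact: grid_cofinal.
- move=> r t D Ar At [k [l [c [gc ->]]]].
  have [u [gu _ nu]] := sort_grid Ar gc; have [v [gv <- nv]] := sort_grid At gc.
  have [g Hg gE] := grid_homogeneous gv gu; exists g; split => // a b.
  move=> [i [j [ik jl ->]]] [i' [j' [i'k j'l ->]]].
  by rewrite !gE // nu // nv.
move=> r t D B Ar At fD fB; have [rlin _] := Ar.
have [k [l [a [ga -> na]]]] := natural_grid_family At fD.
have [p [q [b [gb -> nb]]]] := natural_grid_family Ar fB.
have [n hn] := increasing_ramsey (k * l.+2) (p * q.+2).
have [e0 ge0] := grid_ex n n.+1; have [e [ge _ ne]] := sort_grid Ar ge0.
exists (gridset n n.+1 e) => [|c cP]; first by exists n, n, e.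
pose good z g := eqrel_aut_set E g /\ forall i j, i < k -> j < l.+1 ->
  g (a i j) = e (nth 0 z (i * l.+2)) (nth 0 z (i * l.+2 + j.+1)).
have [h [h1 h2 [chi hchi]]] := hn (fun z => c (xget 1%g [set g | good z g])).
pose be I J := e (h (I * q.+2)) (h (I * q.+2 + J.+1)).
have beb I J : I < p -> J < q.+1 -> h (I * q.+2) < n /\ h (I * q.+2 + J.+1) < n.+1.
  by move=> Ip Jq; split; [|apply: leqW]; apply: h2; nia.
have hI I I' : I < I' < p -> h (I * q.+2) < h (I' * q.+2) by move=> II'; apply: h1; nia.
have hJ I J J' : I < p -> J < J' < q.+1 -> h (I * q.+2 + J.+1) < h (I * q.+2 + J'.+1).
  by move=> Ip JJ'; apply: h1; nia.
have gbe : grid p q.+1 be.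
  have [eE einj] := ge; split=> [I J I' J' Ip Jq I'p J'q|I J J' Ip Jq J'q].
    have [h3 h4] := beb I J Ip Jq; have [h5 h6] := beb I' J' I'p J'q.
    rewrite eE //; case: (ltngtP I I') => [II'|I'I|->]; last by rewrite eqxx.
      by rewrite ltn_eqF // hI // II'.
    by rewrite gtn_eqF // hI // I'I.
  have [h3 h4] := beb I J Ip Jq; have [h5 h6] := beb I J' Ip J'q.
  move=> /einj; rewrite !h3 !h4 !h6 => /(_ isT isT isT) hh.
  case: (ltngtP J J') => // JJ'.
    by have := hJ I J J' Ip; rewrite JJ' J'q hh ltnn => /(_ isT).
  by have := hJ I J' J Ip; rewrite JJ' Jq hh ltnn => /(_ isT).
have [g Hg gE] := grid_homogeneous gb gbe.
exists g.
  split => // [_ [I [J [Ip Jq ->]]]|_ _ [I [J [Ip Jq ->]]] [I' [J' [I'p J'q ->]]]].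
    have [h3 h4] := beb I J Ip Jq; rewrite gE //.
    by exists (h (I * q.+2)), (h (I * q.+2 + J.+1)).
  have [h3 h4] := beb I J Ip Jq; have [h5 h6] := beb I' J' I'p J'q.
  rewrite !gE // ne // nb //.
  case: (ltngtP I I') => [II'|I'I|II'] /=.
  - by rewrite hI // II'.
  - by rewrite ltnNge ltnW ?hI ?I'I //= gtn_eqF ?hI ?I'I.
  rewrite II' ltnn eqxx /=; case: (ltngtP J J') => [JJ'|J'J|->]; last by rewrite ltnn.
    by rewrite hJ // JJ'.
  by rewrite ltnNge ltnW // hJ // J'J.
suff cE x : is_copy (eqrel_aut E) r t (gridset k l.+1 a) (gridset p q.+1 b) x ->
    c (g * x)%g = chi by move=> x x' /cE -> /cE ->.
move=> [Hx xB xt].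
have /choice[pos posP] (ij : nat * nat) : exists IJ : nat * nat,
    ij.1 < k -> ij.2 < l.+1 ->
    [/\ IJ.1 < p, IJ.2 < q.+1 & x (a ij.1 ij.2) = b IJ.1 IJ.2].
  have [/andP[ik jl]|nij] := boolP ((ij.1 < k) && (ij.2 < l.+1)).
    have [|I [J [Ip Jq xE]]] := xB (a ij.1 ij.2); first by exists ij.1, ij.2.
    by exists (I, J).
  by exists (0, 0) => ik jl; move: nij; rewrite ik jl.
pose phi i := (pos (i, 0)).1; pose psi i j := (pos (i, j)).2.
have xE i j : i < k -> j < l.+1 -> [/\ phi i < p, psi i j < q.+1 & x (a i j) = b (phi i) (psi i j)].
  move=> ik jl; have [/= P1 P2 P3] := posP (i, j) ik jl.
  have [/= Q1 Q2 Q3] := posP (i, 0) ik (ltn0Sn l).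
  (* Equivalent points stay equivalent, so the row of the image depends on [i] only. *)
  have /eqP phiE : (pos (i, j)).1 == phi i.
    have [bE _] := gb; rewrite -(bE _ _ _ _ P1 P2 Q1 Q2) -P3 -Q3 Hx.
    by have [aE _] := ga; rewrite aE.
  by rewrite -phiE.
have ord i j i' j' : i < k -> j < l.+1 -> i' < k -> j' < l.+1 ->
    (phi i < phi i') || (phi i == phi i') && (psi i j < psi i' j') =
    (i < i') || (i == i') && (j < j').
  move=> ik jl i'k j'l; have [P1 P2 P3] := xE i j ik jl; have [Q1 Q2 Q3] := xE i' j' i'k j'l.
  by rewrite -nb // -P3 -Q3 xt ?na //; [exists i, j | exists i', j'].
have phiE i i' : i < k -> i' < k -> (phi i == phi i') = (i == i').
  move=> ik i'k; have [P1 P2 P3] := xE i 0 ik isT; have [Q1 Q2 Q3] := xE i' 0 i'k isT.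
  have [bE _] := gb; have [aE _] := ga.
  by rewrite -(bE _ _ _ _ P1 P2 Q1 Q2) -P3 -Q3 Hx aE.
have [||||f [f1 f2 f3 f4]] := grid_pieces (h := h) (k := k) (l := q.+1) (p := p) (t := l.+1)
    (phi := phi) (psi := psi) isT h1.
- move=> i i' /andP[ii' i'k]; have ik := ltn_trans ii' i'k.
  by have := ord i 0 i' 0 ik isT i'k isT; rewrite phiE // ii' (ltn_eqF ii') orbF.
- by move=> i ik; have [] := xE i 0 ik isT.
- move=> i j j' ik /andP[jj' j'l]; have jl := ltn_trans jj' j'l.
  by have := ord i j i j' ik jl ik j'l; rewrite !ltnn !eqxx /= jj'.
- by move=> i j ik jl; have [] := xE i j ik jl.
pose z := mkseq (fun i => h (f i)) (k * l.+2).
have gz : good z (g * x)%g.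
  split; first exact: eqrel_autM.
  move=> i j ik jl; have [P1 P2 P3] := xE i j ik jl.
  rewrite symgME P3 gE // /be /z !nth_mkseq; [|nia|nia].
  by rewrite f3 // f4.
have [Hy yE] : good z (xget 1%g [set g | good z g]).
  by apply: (xgetPex 1%g (P := [set g | good z g])); exists (g * x)%g.
rewrite -(hchi f) //; apply: cP => //; first exact: eqrel_autM.
move=> _ [i [j [ik jl ->]]]; have [_ gxE] := gz.
by rewrite yE // gxE.
Qed.

Lemma convex_orderings_closed : closed (convex_orderings E).
Proof.
pose ok (r : relspace nat) x y z := [/\ r (x, x) = false,
  r (x, y) -> r (y, z) -> r (x, z), x <> y -> r (x, y) \/ r (y, x) &
  E x z -> r (x, y) -> r (y, z) -> E x y].
have -> : convex_orderings E = \bigcap_(w in [set: nat * nat * nat])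
    [set r | ok r w.1.1 w.1.2 w.2].
  apply/seteqP; split=> [r [[irr tr tot] conv] [[x y] z] _ /=|r okr].
    split; [exact: irr|exact: tr|exact: tot|exact: conv].
  have {}okr x y z : ok r x y z by exact: (okr (x, y, z)).
  split; last by move=> x y z; have [] := okr x y z.
  split=> [x|y x z|x y]; first by have [] := okr x x x.
    by have [_ H _ _] := okr x y z; exact: H.
  by have [] := okr x y y.
apply: closed_bigI => -[[x y] z] _ /=.
apply: (@agree_closed _ _ [set` [:: x; y; z]]); first exact: finite_seq.
move=> r r' rr'.
have e a b : a \in [:: x; y; z] -> b \in [:: x; y; z] -> r' (a, b) = r (a, b).
  by move=> ai bi; rewrite rr'.
by rewrite /ok /= !e // !inE eqxx ?orbT.
Qed.

(** Order the classes by their least elements and each class by the usual order. *)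
Lemma convex_orderings_nonempty : convex_orderings E !=set0.
Proof.
have repE x : exists y, E x y by exists x; exact: E_refl.
pose rep x := ex_minn (repE x).
have rep1 x : E x (rep x) by rewrite /rep; case: ex_minnP.
have rep2 x y : E x y -> rep x = rep y.
  move=> xy; apply: eq_ex_minn => z; exact: E_trans.
have rep3 x y : rep x = rep y -> E x y.
  by move=> e; rewrite (E_trans _ (rep1 x)) e E_sym rep1.
exists (fun xy => (rep xy.1 < rep xy.2) || (rep xy.1 == rep xy.2) && (xy.1 < xy.2)).
split; first split; rewrite /rel_of /=.
- by move=> x; rewrite /= !ltnn andbF.
- by move=> y x z /=; lia.
- by move=> x y /= xy; lia.
move=> x y z /rep2 xz; rewrite /rel_of /= => xy yz; apply: rep3.
by move: xz xy yz; lia.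
Qed.

Theorem eqrel_universal_minimal_flow : is_universal_minimal_flow (@convex_act nat E).
Proof.
apply: (@ordering_universal_minimal_flow _ _ _ _ grid_family).
- exact: convex_orderings_closed.
- exact: convex_orderings_nonempty.
- exact: convex_orderings_ramsey.
Qed.

End EqRel.

(** * Vector spaces *)

Import GRing.Theory.

Section VectorSpaces.
Local Open Scope ring_scope.

(** * Polynomials as coordinate vectors *)

Section PolyComb.
Variables (F : fieldType) (V : lmodType F).
Implicit Types (p q : {poly F}) (f : nat -> V).

(** A polynomial is a coordinate vector of unspecified length, so that the vectors of length [k] are
    literally contained in those of length [k.+1], as [letter_mono] wants. *)
Definition polycomb f p : V := \sum_(i < size p) p`_i *: f i.

Lemma polycombE n f p : (size p <= n)%N -> polycomb f p = \sum_(i < n) p`_i *: f i.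
Proof.
move=> pn; rewrite /polycomb (big_ord_widen n (fun i => p`_i *: f i)) // big_mkcond.
apply: eq_bigr => i _; case: ltnP => // /(nth_default 0) ->.
by rewrite scale0r.
Qed.

Lemma polycombP f a p q : polycomb f (a *: p + q) = a *: polycomb f p + polycomb f q.
Proof.
pose n := maxn (size (a *: p + q)) (maxn (size p) (size q)).
have [n1 n2 n3] : [/\ size (a *: p + q)%R <= n, size p <= n & size q <= n]%N.
  by rewrite /n !leq_max !leqnn !orbT.
rewrite !(@polycombE n) // scaler_sumr -big_split /=; apply: eq_bigr => i _.
by rewrite coefD coefZ scalerDl scalerA.
Qed.

Lemma polycombX f i : polycomb f 'X^i = f i.
Proof.
rewrite (@polycombE i.+1) ?size_polyXn // big_ord_recr /= coefXn eqxx scale1r.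
by rewrite big1 ?add0r // => j _; rewrite coefXn ltn_eqF ?scale0r.
Qed.

Lemma eq_polycomb f g p : (forall i, (i < size p)%N -> f i = g i) ->
  polycomb f p = polycomb g p.
Proof. by move=> fg; apply: eq_bigr => i _; rewrite fg. Qed.

End PolyComb.

Lemma linear_polycomb (F : fieldType) (V W : lmodType F) (phi : V -> W) f p :
  linear phi -> phi (polycomb f p) = polycomb (phi \o f) p.
Proof.
move=> lin; have phi0 : phi 0 = 0.
  by have := lin (-1) 0 0; rewrite scaler0 addr0 scaleN1r addNr.
have phiD : {morph phi : u v / u + v}.
  by move=> u v; have := lin 1 u v; rewrite !scale1r.
rewrite /polycomb (big_morph phi phiD phi0); apply: eq_bigr => i _ /=.
by have := lin p`_i (f i) 0; rewrite phi0 !addr0.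
Qed.

Section Letters.
Variable F : finFieldType.

Definition vpar (j : nat) : {poly F} := 'X^j.
Definition vletter (k : nat) : pred {poly F} := fun p => (size p <= k)%N.
Definition vsub (S : seq {poly F}) (p : {poly F}) : {poly F} := polycomb (nth 0 S) p.

Lemma vletters_pword i S k : pword vpar vletter i S k -> all (vletter k) S.
Proof.
apply: pword_letters => [j a /leqW//|j].
by rewrite /vletter /vpar size_polyXn.
Qed.

Lemma polycomb_size f n (p : {poly F}) : (forall i, (i < size p)%N -> (size (f i : {poly F}) <= n)%N) ->
  (size (polycomb f p) <= n)%N.
Proof.
move=> fn; apply: (big_ind (fun q : {poly F} => (size q <= n)%N)) => [|q q' qn q'n|i _].
- by rewrite size_poly0.
- by apply: leq_trans (size_polyD _ _) _; rewrite geq_max qn.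
- by apply: leq_trans (size_scale_leq _ _) _; exact: fn.
Qed.

Lemma vector_letters : parameter_system vpar vletter vsub.
Proof.
split.
- move=> S i iS; rewrite /vsub /vpar polycombX; exact: set_nth_default.
- move=> S S1 p; rewrite /vletter => pS; apply: eq_polycomb => i ip.
  by rewrite nth_cat (leq_trans ip pS).
- move=> S k p /vletters_pword/allP SA; rewrite /vletter => pS.
  apply: polycomb_size => i ip; have := SA _ (mem_nth 0 (leq_trans ip pS)).
  by rewrite /vletter.
- move=> S k + Sk; elim: Sk => [|{}S {}k a Sk IH _|{}S {}k Sk IH] b; rewrite /vletter.
  + by move=> b0; exists b => //; rewrite /vsub /polycomb (size_poly_leq0P _ b0) size_poly0 big_ord0.
  + move=> /IH[a' aS <-]; rewrite /vletter in aS; exists a'; first by rewrite /vletter size_rcons leqW.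
    by apply: eq_polycomb => i ia; rewrite nth_rcons (leq_trans ia aS).
  (* The top coordinate of [b] is produced by the new row [vpar k], the others by the induction
     hypothesis. *)
  move=> bk; pose b' := \poly_(i < k) b`_i.
  have [a' aS ab] := IH b' (size_poly _ _); rewrite /vletter in aS.
  exists (b`_k *: 'X^(size S) + a').
    rewrite /vletter size_rcons (leq_trans (size_polyD _ _)) // geq_max (leqW aS) andbT.
    by rewrite (leq_trans (size_scale_leq _ _)) // size_polyXn.
  rewrite /vsub polycombP polycombX nth_rcons ltnn eqxx.
  have -> : polycomb (nth 0 (rcons S (vpar k))) a' = b'.
    rewrite -ab; apply: eq_polycomb => i ia.
    by rewrite nth_rcons (leq_trans ia aS).
  apply/polyP => i; rewrite coefD coefZ coefXn coef_poly.
  case: (ltngtP i k) => [ik|ki|->]; rewrite ?mulr0 ?add0r ?addr0 ?mulr1 //.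
  by rewrite nth_default // (leq_trans bk).
- move=> T S k a _ _ aT; rewrite /vletter in aT.
  rewrite /vsub (linear_polycomb (V := {poly F}) (W := {poly F})); last first.
    by move=> c p q; exact: polycombP.
  by apply: eq_polycomb => i ia /=; rewrite (nth_map 0) // (leq_trans ia).
- move=> k; exists [seq \poly_(i < k) (if insub i is Some j then t j else 0) | t : {ffun 'I_k -> F}] => p.
  rewrite /vletter => pk; apply/mapP; exists [ffun i : 'I_k => p`_i].
    by rewrite mem_enum.
  apply/polyP => i; rewrite coef_poly; case: ltnP => [ik|ki].
    by rewrite insubT ffunE.
  by rewrite nth_default // (leq_trans pk).
- by move=> k p; rewrite /vletter => /leqW.
- by move=> k; rewrite /vletter size_polyXn.
- by move=> j q jq; rewrite /vletter size_polyXn -ltnNge ltnS.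
- by move=> a b; rewrite /vletter => /size_poly_leq0P -> /size_poly_leq0P ->.
Qed.

End Letters.

(** * Bases of finite-dimensional subspaces as frames *)

Section VectorFrames.
Variables (F : finFieldType) (V : lmodType F).
Implicit Types (u v : seq V) (alpha beta : nat -> F).

Definition vlc u alpha : V := \sum_(i < size u) alpha i *: nth 0 u i.
(** The dot product of the coefficients of [p] with [alpha]. *)
Definition vev alpha (p : {poly F}) : F := polycomb (alpha : nat -> F^o) p.
Definition vunit (j i : nat) : F := (i == j)%:R.
Definition vframe u : Prop :=
  forall alpha, vlc u alpha = 0 -> forall i, (i < size u)%N -> alpha i = 0.

Local Notation vhull := (hull vlc).
Local Notation vcmp := (cmp vunit (@vpar F) vev vlc).

Lemma vlc_ext u alpha beta : (forall i, (i < size u)%N -> alpha i = beta i) ->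
  vlc u alpha = vlc u beta.
Proof. by move=> ab; apply: eq_bigr => i _; rewrite ab. Qed.

Lemma vlcP u a alpha beta :
  vlc u (fun i => a * alpha i + beta i) = a *: vlc u alpha + vlc u beta.
Proof.
rewrite /vlc scaler_sumr -big_split; apply: eq_bigr => i _.
by rewrite scalerDl scalerA.
Qed.

Lemma vlc0 u : vlc u (fun=> 0) = 0.
Proof. by rewrite /vlc big1 // => i _; rewrite scale0r. Qed.

Lemma vlc_inj u alpha beta : vframe u -> vlc u alpha = vlc u beta ->
  forall i, (i < size u)%N -> alpha i = beta i.
Proof.
move=> Fu ab i iu; apply/eqP; rewrite -subr_eq0 addrC -mulN1r; apply/eqP.
by apply: (Fu (fun i => -1 * beta i + alpha i)) => //; rewrite vlcP ab scaleN1r addNr.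
Qed.

Lemma vlc_unit u j : (j < size u)%N -> vlc u (vunit j) = nth 0 u j.
Proof.
move=> ju; rewrite /vlc (bigD1 (Ordinal ju)) //= /vunit eqxx scale1r.
rewrite big1 ?addr0 // => i ij; rewrite (_ : (_ == _) = false) ?scale0r //.
exact: negbTE ij.
Qed.

Lemma vlc_rcons u t alpha : vlc (rcons u t) alpha = vlc u alpha + alpha (size u) *: t.
Proof.
rewrite /vlc size_rcons big_ord_recr /= nth_rcons ltnn eqxx; congr (_ + _).
by apply: eq_bigr => i _; rewrite nth_rcons ltn_ord.
Qed.

Lemma vev_par alpha j : vev alpha (@vpar F j) = alpha j.
Proof. exact: (@polycombX F F^o). Qed.

Lemma vevE n alpha (p : {poly F}) : (size p <= n)%N -> vev alpha p = \sum_(i < n) p`_i * alpha i.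
Proof. exact: (@polycombE F F^o). Qed.

Lemma vev_ext k (p : {poly F}) alpha beta : vletter k p -> (forall i, (i < k)%N -> alpha i = beta i) ->
  vev alpha p = vev beta p.
Proof.
rewrite /vletter => pk ab; apply: (@eq_polycomb F F^o) => i ip.
by rewrite ab // (leq_trans ip).
Qed.

Lemma vev_unit j (p : {poly F}) : vev (vunit j) p = p`_j.
Proof.
rewrite (@vevE (maxn (size p) j.+1)) ?leq_maxl //.
rewrite (bigD1 (Ordinal (leq_maxr (size p) j.+1))) //= /vunit eqxx mulr1.
rewrite big1 ?addr0 // => i ij; rewrite (_ : (_ == _) = false) ?mulr0 //.
exact: negbTE ij.
Qed.

Lemma vlc_cmp u S k alpha : vframe u -> pword (@vpar F) (@vletter F) 0 S k ->
  size S = size u ->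
  vlc (vcmp k u S) alpha = vlc u (fun i => vev alpha (nth (vpar F 0) S i)).
Proof.
move=> _ /vletters_pword/allP SA sS.
rewrite /vlc size_cmp.
under eq_bigr => j _ do rewrite nth_mkseq // scaler_sumr.
rewrite exchange_big; apply: eq_bigr => i _ /=.
have Si : (size (nth (vpar F 0) S i) <= k)%N by apply: SA; rewrite mem_nth // sS.
rewrite (vevE _ Si) scaler_suml; apply: eq_bigr => j _.
by rewrite vev_unit scalerA mulrC.
Qed.

Lemma vcmp_frame u S k : vframe u -> pword (@vpar F) (@vletter F) 0 S k ->
  size S = size u -> vframe (vcmp k u S).
Proof.
move=> Fu Sk sS alpha; rewrite vlc_cmp // size_cmp => /Fu a0 j jk.
have [|S1 [S2 [eS _ _]]] := pwordP Sk (q := j); first by rewrite jk.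
have S1u : (size S1 < size u)%N by rewrite -sS eS size_cat /= addnS ltnS leq_addr.
by have := a0 _ S1u; rewrite eS nth_cat ltnn subnn /= vev_par.
Qed.

Lemma vev_sub S k alpha (p : {poly F}) : pword (@vpar F) (@vletter F) 0 S k -> vletter (size S) p ->
  vev alpha (vsub S p) = vev (fun l => vev alpha (nth (vpar F 0) S l)) p.
Proof.
rewrite /vletter => _ pS.
rewrite /vev /vsub (linear_polycomb (V := {poly F}) (W := F^o)); last first.
  by move=> c q q'; exact: (@polycombP F F^o).
apply: (@eq_polycomb F F^o) => i ip /=; congr (vev _ _).
by apply: set_nth_default; exact: leq_trans pS.
Qed.

Lemma vlincomb u alpha : vlc u alpha = lincomb (fun i : 'I_(size u) => nth 0 u i)
  (fun i => alpha i).
Proof. by []. Qed.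

Lemma nat_of_ords (K : Type) (k0 : K) n (a : 'I_n -> K) : exists alpha : nat -> K,
  forall i : 'I_n, alpha i = a i.
Proof.
by exists (fun i => if insub i is Some j then a j else k0) => i; rewrite valK.
Qed.

Lemma vhull_fin_dim u : vframe u -> fin_dim_subspace (vhull u).
Proof.
move=> Fu; exists (size u), (fun i => nth 0 u i); split.
  move=> a a0 i; have [alpha aE] := nat_of_ords 0 a.
  rewrite -aE; apply: Fu => //; rewrite -[RHS]a0; apply: eq_bigr => j _.
  by rewrite aE.
apply/seteqP; split => _ [a _ <-]; last by exists (fun i => a i).
have [alpha aE] := nat_of_ords 0 a; exists alpha => //.
by apply: eq_bigr => j _; rewrite aE.
Qed.

Lemma fin_dim_finite (U : set V) : fin_dim_subspace U -> finite_set U.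
Proof.
move=> [n [b [_ <-]]].
apply: (@sub_finite_set _ _ [set` [seq lincomb b a | a : {ffun 'I_n -> F}]]).
  move=> _ [a _ <-] /=; apply/mapP; exists [ffun i => a i]; first by rewrite mem_enum.
  by apply: eq_bigr => i _; rewrite ffunE.
exact: finite_seq.
Qed.

Definition submodule (U : set V) : Prop :=
  U 0 /\ forall a y z, U y -> U z -> U (a *: y + z).

Lemma fin_dim_submodule U : fin_dim_subspace U -> submodule U.
Proof.
move=> [n [b [_ <-]]]; split.
  by exists (fun=> 0) => //; rewrite /lincomb big1 // => i _; rewrite scale0r.
move=> a _ _ [c _ <-] [d _ <-]; exists (fun i => a * c i + d i) => //.
rewrite /lincomb scaler_sumr -big_split; apply: eq_bigr => i _.
by rewrite scalerDl scalerA.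
Qed.

Lemma submodule_sum U n (a : 'I_n -> F) (y : 'I_n -> V) : submodule U ->
  (forall i, U (y i)) -> U (\sum_(i < n) a i *: y i).
Proof.
move=> [U0 Ulin] Uy; apply: (big_ind U) => // [w z Uw Uz|i _].
  by rewrite -[w]scale1r; exact: Ulin.
by rewrite -[_ *: _]addr0; exact: Ulin.
Qed.

Lemma vframe_rcons u t : vframe (rcons u t) -> vframe u /\ ~ vhull u t.
Proof.
move=> Fut; have Fu : vframe u.
  move=> alpha a0 i iu.
  have := Fut (fun j => if (j < size u)%N then alpha j else 0).
  rewrite vlc_rcons ltnn scale0r addr0 => /(_ _ i); rewrite iu size_rcons; apply.
    by rewrite -[RHS]a0; apply: vlc_ext => j ->.
  exact: leqW.
split=> // -[alpha _ at_]; have := Fut (fun j => if (j < size u)%N then alpha j else -1).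
rewrite vlc_rcons ltnn scaleN1r => /(_ _ (size u)); rewrite ltnn size_rcons leqnn.
have -> : vlc u (fun j => if (j < size u)%N then alpha j else -1) = t.
  by rewrite -[RHS]at_; apply: vlc_ext => j ->.
by rewrite subrr => /(_ erefl isT)/eqP; rewrite oppr_eq0 oner_eq0.
Qed.

Lemma rcons_vframe u t : vframe u -> ~ vhull u t -> vframe (rcons u t).
Proof.
move=> Fu ut alpha; rewrite vlc_rcons size_rcons => a0.
have an0 : alpha (size u) = 0.
  apply: contrapT => /eqP an; apply: ut.
  exists (fun i => - (alpha (size u))^-1 * alpha i + 0) => //.
  rewrite vlcP vlc0 addr0; move/eqP: a0; rewrite addr_eq0 => /eqP->.
  by rewrite scalerN scaleNr opprK scalerA mulVf // scale1r.
move=> i; rewrite ltnS leq_eqVlt => /orP[/eqP->//|]; apply: Fu.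
by move: a0; rewrite an0 scale0r addr0.
Qed.

(** Reduced echelon form: reading the basis [u] from its last element on, each
    element of [u] contributes either a new pivot or a row expressed through the
    previous pivots. *)
Lemma echelon u U : vframe u -> submodule U -> U `<=` vhull u -> exists k S,
  [/\ pword (@vpar F) (@vletter F) 0 S k, size S = size u &
      vhull (vcmp k u S) = U].
Proof.
elim/last_ind: u U => [|u t IHu] U Fut Umod Uu.
  exists 0%N, [::]; split => //; first exact: PwNil.
  have [U0 _] := Umod; apply/seteqP; split => [_ [a _ <-]|y /Uu[a _ <-]].
    by rewrite /vlc big_ord0.
  by exists a => //; rewrite /vlc !big_ord0.
have [Fu nut] := vframe_rcons Fut; have [U0 Ulin] := Umod.
(* The projection of [U] to the span of [u] along [t]. *)
pose U' := [set w | vhull u w /\ exists c, U (w + c *: t)].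
have U'mod : submodule U'.
  split.
    split; first by exists (fun=> 0) => //; exact: vlc0.
    by exists 0; rewrite scale0r addr0.
  move=> a y z [[b _ yb] [c Uc]] [[b' _ zb] [c' Uc']]; split.
    by exists (fun i => a * b i + b' i) => //; rewrite vlcP yb zb.
  exists (a * c + c'); rewrite scalerDl addrACA -scalerA -scalerDr.
  exact: Ulin.
have [k [S [Sk sS SU']]] := IHu U' Fu U'mod (fun w => @proj1 _ _).
have SA := allP (vletters_pword Sk).
pose w alpha := vlc u (fun i => vev alpha (nth (vpar F 0) S i)).
have wU' alpha : U' (w alpha).
  by rewrite -SU' /w -(vlc_cmp _ Fu Sk sS); exact: lc_hull.
have U'w y : U' y -> exists alpha, y = w alpha.
  by rewrite -SU' => -[alpha _ <-]; exists alpha; rewrite (vlc_cmp _ Fu Sk sS).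
have lcS s alpha :
    vlc (rcons u t) (fun i => vev alpha (nth (vpar F 0) (rcons S s) i)) =
    w alpha + vev alpha s *: t.
  rewrite vlc_rcons nth_rcons sS ltnn eqxx; congr (_ + _); apply: vlc_ext => i iu.
  by rewrite nth_rcons sS iu.
have Uw y : U y -> exists alpha c, y = w alpha + c *: t.
  move=> Uy; have [b _ yb] := Uu _ Uy; rewrite vlc_rcons in yb.
  have [|alpha wb] := U'w (vlc u b); last by exists alpha, (b (size u)); rewrite -wb.
  split; first exact: lc_hull.
  by exists (b (size u)); rewrite yb.
have [Ut|Ut] := EM (U t).
  have Sk' : pword (@vpar F) (@vletter F) 0 (rcons S (vpar F k)) k.+1 by exact: PwVar.
  have sS' : size (rcons S (vpar F k)) = size (rcons u t) by rewrite !size_rcons sS.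
  exists k.+1, (rcons S (vpar F k)); split => //.
  apply/seteqP; split=> [_ [alpha _ <-]|y Uy].
    rewrite (vlc_cmp _ Fut Sk' sS') lcS vev_par.
    have [_ [c Uc]] := wU' alpha.
    have -> : w alpha + alpha k *: t = (alpha k - c) *: t + (w alpha + c *: t).
      by rewrite scalerBl addrACA addNr addr0 addrC.
    exact: Ulin.
  have [alpha [c ->]] := Uw _ Uy.
  exists (fun j => if (j < k)%N then alpha j else c) => //.
  rewrite (vlc_cmp _ Fut Sk' sS') lcS vev_par ltnn; congr (_ + _).
  apply: vlc_ext => i iu; apply: (@vev_ext k) => [|j ->//].
  by apply: SA; rewrite mem_nth // sS.
(* As [t] is not in [U], the coefficient of [t] in an element of [U] is a linear function of its
   projection; the row [s] lists the values of this function on the frame of [U']. *)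
have /choice[c cP] (j : 'I_k) : exists c, U (w (vunit j) + c *: t).
  by have [_] := wU' (vunit j).
have [gam gamE] := nat_of_ords 0 c.
pose s := \poly_(j < k) gam j.
have sk : vletter k s by exact: size_poly.
have Sk' : pword (@vpar F) (@vletter F) 0 (rcons S s) k by exact: PwConst.
have sS' : size (rcons S s) = size (rcons u t) by rewrite !size_rcons sS.
have wUs alpha : U (w alpha + vev alpha s *: t).
  have -> : w alpha = \sum_(j < k) alpha j *: w (vunit j).
    rewrite {1}/w -(vlc_cmp _ Fu Sk sS) /vlc size_cmp; apply: eq_bigr => j _.
    by rewrite nth_mkseq.
  rewrite (vevE _ sk) scaler_suml -big_split /=.
  under eq_bigr => j _ do rewrite coef_poly ltn_ord mulrC -scalerA -scalerDr gamE.
  exact: submodule_sum.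
exists k, (rcons S s); split => //.
apply/seteqP; split=> [_ [alpha _ <-]|y Uy].
  by rewrite (vlc_cmp _ Fut Sk' sS') lcS.
have [alpha [b yE]] := Uw _ Uy; exists alpha => //.
rewrite (vlc_cmp _ Fut Sk' sS') lcS yE; congr (_ + _ *: _).
apply/eqP; rewrite -subr_eq0; apply/negPn/negP => nz; apply: Ut.
have := Ulin (-1) _ _ Uy (wUs alpha); rewrite yE scaleN1r opprD addrACA addNr add0r.
rewrite addrC -scalerBl => /(Ulin (vev alpha s - b)^-1 _ _)/(_ U0).
by rewrite addr0 scalerA mulVf // scale1r.
Qed.

Hypothesis V_dim : dim_aleph0 V.

Lemma vframe_ex n : exists2 u, vframe u & size u = n.
Proof.
have [b [bfree _]] := V_dim; exists (mkseq b n); last exact: size_mkseq.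
move=> alpha; rewrite /vlc size_mkseq => a0 i ilt.
apply: (bfree n (fun i => alpha i) _ (Ordinal ilt)).
by rewrite -[RHS]a0; apply: eq_bigr => j _; rewrite nth_mkseq.
Qed.

Lemma vector_countable : countable [set: V].
Proof.
have [b [_ bspan]] := V_dim.
have ex (y : V) : exists s : seq F, y = \sum_(i < size s) nth 0 s i *: b i.
  have [n [a _ <-]] := bspan y; exists [seq a i | i <- enum 'I_n].
  rewrite size_map size_enum_ord; apply: eq_bigr => i _.
  by rewrite (nth_map i) ?size_enum_ord // nth_ord_enum.
have [f fP] := choice ex; apply/countable_injP; exists (pickle \o f) => y z _ _ /= yz.
by rewrite (fP y) (fP z) (pcan_inj (@pickleK _) yz).
Qed.

Lemma vector_infinite (d : seq V) : exists z, z \notin d.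
Proof.
have [b [bfree _]] := V_dim.
have blt i j : (i < j)%N -> b i <> b j.
  move=> ij bij; have j1 : (j < j.+1)%N by [].
  have i1 : (i < j.+1)%N by exact: leqW.
  have := bfree j.+1 (fun l => (nat_of_ord l == i)%:R - (nat_of_ord l == j)%:R).
  move=> /(_ _ (Ordinal j1)) /=; rewrite eqxx (gtn_eqF ij) sub0r => H.
  have /eqP : (-1 : F) = 0.
    apply: H; rewrite /lincomb; under eq_bigr => l _ do rewrite scalerBl.
    rewrite sumrB (bigD1 (Ordinal i1)) //= eqxx scale1r big1 => [|l li]; last first.
      by rewrite (_ : (_ == _) = false) ?scale0r //; exact: negbTE li.
    rewrite (bigD1 (Ordinal j1)) //= eqxx scale1r big1 => [|l lj]; last first.
      by rewrite (_ : (_ == _) = false) ?scale0r //; exact: negbTE lj.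
    by rewrite !addr0 bij subrr.
  by rewrite oppr_eq0 oner_eq0.
have binj : injective b.
  by move=> i j bij; case: (ltngtP i j) => // /blt; rewrite bij.
apply: contrapT => nz.
have sub : {subset mkseq b (size d).+1 <= d}.
  by move=> z _; apply: contrapT => /negP zd; apply: nz; exists z.
by have := uniq_leq_size (mkseq_uniq _ binj) sub; rewrite size_mkseq ltnn.
Qed.

Lemma vframe_extend u v y : vframe u -> vframe v -> size u = size v -> exists u' v',
  [/\ vframe u', vframe v', size u' = size v',
    forall alpha, exists alpha', vlc u alpha = vlc u' alpha' /\ vlc v alpha = vlc v' alpha'
    & vhull u' y].
Proof.
move=> Fu Fv suv; have [uy|uy] := EM (vhull u y).
  by exists u, v; split => // alpha; exists alpha.
have [d dE] : exists d : seq V, vhull v = [set` d].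
  by apply/finite_seqP/fin_dim_finite/vhull_fin_dim.
have [z zd] := vector_infinite d.
exists (rcons u y), (rcons v z); split.
- exact: rcons_vframe.
- by apply: rcons_vframe; rewrite // dE; exact/negP.
- by rewrite !size_rcons suv.
- move=> alpha; exists (fun i => if (i < size u)%N then alpha i else 0).
  rewrite !vlc_rcons -suv ltnn !scale0r !addr0.
  by split; apply: vlc_ext => i; rewrite -?suv => ->.
- exists (vunit (size u)) => //.
  by rewrite vlc_unit ?size_rcons // nth_rcons ltnn eqxx.
Qed.

Lemma gl_vlc g u alpha : gl_set (V := V) g -> g (vlc u alpha) = vlc (map g u) alpha.
Proof.
move=> glg; rewrite vlincomb gl_lincomb // /lincomb /vlc size_map.
by apply: eq_bigr => i _; rewrite (nth_map 0) //.
Qed.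

Lemma gl_vframe g u : gl_set (V := V) g -> vframe u -> vframe (map g u).
Proof.
move=> glg Fu alpha; rewrite -gl_vlc // size_map => ga0; apply: Fu.
apply: (can_inj (symgK g)); rewrite ga0; apply/esym.
rewrite -(vlc0 [::]) gl_vlc //.
Qed.

Lemma gl_local (g : symg V) : (forall l : seq V, exists u v,
    [/\ vframe u, vframe v, size u = size v &
      forall y, y \in l -> exists alpha, y = vlc u alpha /\ g y = vlc v alpha]) ->
  gl_set (V := V) g.
Proof.
move=> gP a y z; have [u [v [Fu Fv suv uv]]] := gP [:: a *: y + z; y; z].
have [|c [cE gc]] := uv (a *: y + z); first by rewrite inE eqxx.
have [|b [yE gy]] := uv y; first by rewrite !inE eqxx orbT.
have [|b' [zE gz]] := uv z; first by rewrite !inE eqxx !orbT.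
have e : vlc u c = vlc u (fun i => a * b i + b' i) by rewrite vlcP -cE -yE -zE.
rewrite gc gy gz -vlcP; apply: vlc_ext => i; rewrite -suv; exact: vlc_inj e i.
Qed.

Variable ltF : rel F.
Hypothesis ltF_slo : strict_linear_order ltF.

Lemma vector_frame_system : frame_system 0 (gl V) ltF vunit (@vpar F) (@vletter F)
  (@vsub F) vev vlc vframe (@fin_dim_subspace F V).
Proof.
split.
- exact: vector_letters.
- exact: vector_countable.
- exact: ltF_slo.
- by apply/card_gt1P; exists 0, 1; rewrite eq_sym oner_eq0.
- exact: vlc_ext.
- exact: vlc_inj.
- exact: vlc_unit.
- exact: vlc_cmp.
- exact: vcmp_frame.
- exact: vev_par.
- exact: vev_ext.
- exact: vev_sub.
- by have [u Fu _] := vframe_ex 0; exists u.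
- by move=> _ n _ _; exact: vframe_ex.
- exact: vhull_fin_dim.
- exact: fin_dim_finite.
- by move=> u U Fu /fin_dim_submodule; exact: echelon.
- exact: vframe_extend.
- by move=> g u alpha; exact: gl_vlc.
- by move=> g u; exact: gl_vframe.
- exact: gl_local.
Qed.

Lemma lincomb_rev u n (b : 'I_n -> V) (a : 'I_n -> F) alpha : size u = n ->
  (forall i : 'I_n, nth 0 u i = b (rev_ord i)) ->
  (forall i : 'I_n, alpha i = a (rev_ord i)) -> lincomb b a = vlc u alpha.
Proof.
move=> sn ub aE; rewrite /lincomb /vlc sn (reindex_inj rev_ord_inj) /=.
by apply: eq_bigr => i _; rewrite ub aE.
Qed.

Lemma natural_vect_frame (r : relspace V) (W : set V) :
  natural_vect_on ltF (rel_of r) W <->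
  exists u, [/\ vframe u, vhull u = W & natural_on ltF vlc r u].
Proof.
have [irr _ _] := ltF_slo.
have equiv u n (b : 'I_n -> V) : size u = n -> (forall i : 'I_n, nth 0 u i = b (rev_ord i)) ->
    [/\ lin_indep b <-> vframe u, range (lincomb b) = vhull u &
    (forall alpha beta : 'I_n -> F,
      rel_of r (lincomb b alpha) (lincomb b beta) <-> antilex ltF alpha beta) <->
    natural_on ltF vlc r u].
  move=> sn ub.
  have fw alpha : lincomb b (fun i => alpha (nat_of_ord (rev_ord i))) = vlc u alpha.
    by apply: lincomb_rev => // i; rewrite rev_ordK.
  split.
  - split=> [bfree alpha|Fu a a0 i].
      rewrite -fw => /bfree a0 i; rewrite sn => iu.
      by have := a0 (rev_ord (Ordinal iu)); rewrite rev_ordK.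
    have [alpha aE] := rev_coords 0 a.
    rewrite -[i]rev_ordK -aE; apply: Fu; rewrite ?sn //.
    by rewrite -(lincomb_rev sn ub aE).
  - apply/seteqP; split => _ [a _ <-]; last by rewrite -fw; exists (fun i => a (nat_of_ord (rev_ord i))).
    by have [alpha aE] := rev_coords 0 a; rewrite (lincomb_rev sn ub aE); exact: lc_hull.
  - split=> [rP alpha beta|nat_u a c].
      rewrite -!fw sn.
      have <- : antilex ltF (fun i : 'I_n => alpha (nat_of_ord (rev_ord i)))
          (fun i : 'I_n => beta (nat_of_ord (rev_ord i))) = lex ltF n alpha beta.
        by apply/propext/antilex_lex => // i; rewrite rev_ordK.
      by apply/idP/asboolP => /rP.
    have [alpha aE] := rev_coords 0 a; have [gam cE] := rev_coords 0 c.
    rewrite (lincomb_rev sn ub aE) (lincomb_rev sn ub cE) /rel_of nat_u sn.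
    by rewrite (antilex_lex irr aE cE); split => /asboolP.
split=> [[n [b [[bfree bW] rP]]]|[u [Fu uW nat_u]]].
  have [|i|e1 e2 e3] := equiv [seq b (rev_ord i) | i <- enum 'I_n] n b.
  - by rewrite size_map size_enum_ord.
  - by rewrite (nth_map i) ?size_enum_ord // nth_ord_enum.
  by exists [seq b (rev_ord i) | i <- enum 'I_n]; rewrite -e2; split => //; [exact/e1 | exact/e3].
have [//|i|e1 e2 e3] := equiv u (size u) (fun i => nth 0 u (rev_ord i)).
  by rewrite rev_ordK.
exists (size u), (fun i => nth 0 u (rev_ord i)); split; last exact/e3.
by split; [exact/e1 | rewrite e2].
Qed.

Theorem vector_universal_minimal_flow :
  is_universal_minimal_flow (@natural_vect_act F V ltF).
Proof.
apply: (frames_universal_minimal_flow vector_frame_system) => r.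
by split=> -[rlin rW]; split => // W /rW /natural_vect_frame.
Qed.

End VectorFrames.

End VectorSpaces.

(** * Boolean algebras *)

Import Order.Theory.

Section BooleanFrames.
Local Open Scope order_scope.
Context {d : Order.disp_t} (B : ctbDistrLatticeType d).
Implicit Types (u v w : seq B) (alpha beta : nat -> bool) (y z : B).

Definition blc u alpha : B := \join_(i < size u | alpha i) nth \bot u i.
Definition bev alpha (a : nat) : bool := alpha a.
Definition bunit (j i : nat) : bool := (i == j)%N.
Definition disj y z : bool := y `&` z == \bot.
(** A partition of unity into nonzero elements, that is, the atoms of a finite subalgebra in some
    order. *)
Definition bframe u : Prop :=
  [/\ \bot \notin u, pairwise disj u & blc u (fun=> true) = \top].

Local Notation bhull := (hull blc).
Local Notation bcmp := (cmp bunit bpar bev blc).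
Local Notation bword := (pword bpar bletter).

Lemma disjC y z : disj y z = disj z y.
Proof. by rewrite /disj meetC. Qed.

Lemma blc_ext u alpha beta : (forall i, (i < size u)%N -> alpha i = beta i) ->
  blc u alpha = blc u beta.
Proof. by move=> ab; apply: eq_bigl => i; rewrite ab. Qed.

Lemma blc_leP u alpha y : reflect (forall i, (i < size u)%N -> alpha i -> nth \bot u i <= y)
  (blc u alpha <= y).
Proof.
apply: (iffP (joinsP _ _ _)) => [H i iu ai|H i ai]; last exact: H.
exact: (H (Ordinal iu)).
Qed.

Lemma blc_sup u alpha i : (i < size u)%N -> alpha i -> nth \bot u i <= blc u alpha.
Proof. by move=> iu ai; exact: (@joins_sup _ _ _ (Ordinal iu)). Qed.

Lemma blcU u alpha beta :
  blc u alpha `|` blc u beta = blc u (fun i => alpha i || beta i).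
Proof.
apply/le_anti/andP; split.
  by rewrite leUx; apply/andP; split; apply/blc_leP => i iu h; apply: blc_sup;
    rewrite ?h ?orbT.
apply/blc_leP => i iu /orP[h|h].
  by apply: le_trans (leUl _ _); exact: blc_sup.
by apply: le_trans (leUr _ _); exact: blc_sup.
Qed.

Lemma blc0 u : blc u (fun=> false) = \bot.
Proof. by rewrite /blc big_pred0. Qed.

Lemma disj_blc u z : all (disj z) u = disj z (blc u (fun=> true)).
Proof.
rewrite /disj meetC disj_leC; apply/allP/blc_leP => [H i iu _|H y /(nthP \bot)[i iu <-]].
  by have := H _ (mem_nth \bot iu); rewrite /disj meetC disj_leC.
by rewrite /disj meetC disj_leC; exact: H.
Qed.

Lemma bunit_blc u j : (j < size u)%N -> blc u (bunit j) = nth \bot u j.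
Proof.
move=> ju; apply/le_anti/andP; split.
  by apply/blc_leP => i iu /eqP->.
by apply: blc_sup => //; exact: eqxx.
Qed.

Definition scons (b : bool) alpha (i : nat) : bool := if i is j.+1 then alpha j else b.

Lemma blc_cons y u alpha :
  blc (y :: u) alpha = (if alpha 0%N then y else \bot) `|` blc u (fun i => alpha i.+1).
Proof.
by rewrite /blc big_mkcond big_ord_recl /= -big_mkcond.
Qed.

Lemma disjW y z y' z' : y' <= y -> z' <= z -> disj y z -> disj y' z'.
Proof.
rewrite /disj -!lex0 => yy zz; apply: le_trans; exact: leI2.
Qed.

Section Frame.
Variable u : seq B.
Hypothesis Fu : bframe u.

Lemma bframe_neq0 i : (i < size u)%N -> nth \bot u i != \bot.
Proof.
by move=> iu; have [u0 _ _] := Fu; apply: contraNneq u0 => <-; exact: mem_nth.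
Qed.

Lemma bframe_disj i j : (i < size u)%N -> (j < size u)%N -> i != j ->
  disj (nth \bot u i) (nth \bot u j).
Proof.
move=> iu ju; have [_ /(pairwiseP \bot) pw _] := Fu.
by case: (ltngtP i j) => // [ij|ji] _; [exact: pw | rewrite disjC; exact: pw].
Qed.

Lemma bframe_uniq : uniq u.
Proof.
apply/(uniqP \bot) => i j iu ju ij; apply/eqP; apply: contraTT isT => nij.
have := bframe_disj iu ju nij; rewrite /disj ij meetxx.
by have := bframe_neq0 ju => /negPf->.
Qed.

(** A frame element is nonzero and disjoint from the others, so it lies below a join of frame
    elements only if it takes part in it. *)
Lemma le_blc i alpha : (i < size u)%N -> (nth \bot u i <= blc u alpha) = alpha i.
Proof.
move=> iu; case ai: (alpha i); first exact: blc_sup.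
apply/negbTE/negP => le; have := bframe_neq0 iu; case/negP.
rewrite -(meetxx (nth _ _ _)) disj_leC; apply: le_trans le _.
apply/blc_leP => j ju aj; rewrite -disj_leC; apply: bframe_disj => //.
by apply: contraTneq aj => ->; rewrite ai.
Qed.

Lemma blc_inj alpha beta : blc u alpha = blc u beta ->
  forall i, (i < size u)%N -> alpha i = beta i.
Proof. by move=> ab i iu; rewrite -le_blc // ab le_blc. Qed.

Lemma blcC alpha : ~` blc u alpha = blc u (fun i => ~~ alpha i).
Proof.
have [_ _ top] := Fu.
apply/le_anti/andP; split; last first.
  apply/blc_leP => i iu ai; rewrite lexC; apply/blc_leP => j ju aj.
  rewrite -disj_leC; apply: bframe_disj => //.
  by apply: contraTneq aj => ->; rewrite (negPf ai).
have : blc u (fun i => ~~ alpha i) `|` blc u alpha = \top.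
  by rewrite blcU -top; apply: blc_ext => i _; case: (alpha i).
move=> e; have := meetx1 (~` blc u alpha); rewrite -e meetUr meetCx joinx0 => <-.
exact: leIr.
Qed.

Lemma blcI alpha beta :
  blc u alpha `&` blc u beta = blc u (fun i => alpha i && beta i).
Proof.
rewrite -[LHS]complK complI !blcC blcU blcC; apply: blc_ext => i _.
by rewrite negb_or !negbK.
Qed.

Lemma blcT : blc u (fun=> true) = \top. Proof. by have [] := Fu. Qed.

Lemma bhull_subalgebra : finite_subalgebra (bhull u).
Proof.
split.
- apply: (@sub_finite_set _ _ [set` [seq blc u (fun i => nth false t i)
      | t : (size u).-tuple bool]]); last exact: finite_seq.
  move=> _ [alpha _ <-] /=; apply/mapP; exists [tuple of mkseq alpha (size u)].
    by rewrite mem_enum.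
  by apply: blc_ext => i iu; rewrite nth_mkseq.
- by split; [exists (fun=> false) => //; exact: blc0 | exists (fun=> true) => //; exact: blcT].
- by move=> _ _ [a _ <-] [b _ <-]; rewrite blcI; exact: lc_hull.
- by move=> _ _ [a _ <-] [b _ <-]; rewrite blcU; exact: lc_hull.
- by move=> _ [a _ <-]; rewrite blcC; exact: lc_hull.
Qed.

Lemma bhull_atoms : atoms (bhull u) = [set` u].
Proof.
apply/seteqP; split=> [y [[alpha _ <-] y0 ymin]|_ /(nthP \bot)[i iu <-]].
  have [i iu ai] : exists2 i, (i < size u)%N & alpha i.
    apply: contrapT => na; move: y0; rewrite (_ : blc u alpha = \bot) ?ltxx //.
    rewrite -(blc0 u); apply: blc_ext => i iu; apply/negP => ai.
    by apply: na; exists i.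
  rewrite -(ymin (nth \bot u i)) ?mem_nth //=.
  - by rewrite mem_nth.
  - by rewrite -bunit_blc //; exact: lc_hull.
  - by rewrite lt0x bframe_neq0.
  - by rewrite le_blc.
split; first by rewrite -bunit_blc //; exact: lc_hull.
  by rewrite lt0x bframe_neq0.
move=> _ [alpha _ <-] a0 le; apply/le_anti; rewrite le /= le_blc //.
apply/negPn/negP => nai; move: a0; rewrite (_ : blc u alpha = \bot) ?ltxx //.
rewrite -(blc0 u); apply: blc_ext => j ju; apply/negP => aj.
have ij : i != j by apply: contraNneq nai => ->.
have := le_trans (blc_sup ju aj) le; rewrite -bunit_blc // bunit_blc // => leji.
have := bframe_neq0 ju; rewrite -[X in X != _]meetxx => /negP[].
by apply: disjW (bframe_disj iu ju ij).
Qed.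

Lemma bword_pivot S k j : bword 0 S k -> (j < k)%N -> exists2 i, (i < size S)%N &
  nth 0%N S i = j.
Proof.
move=> Sk jk; have [|S1 [S2 [eS _ _]]] := pwordP Sk (q := j); first by rewrite jk.
exists (size S1); last by rewrite eS nth_cat ltnn subnn.
by rewrite eS size_cat /= addnS ltnS leq_addr.
Qed.

Lemma blc_cmp S k alpha : bword 0 S k -> size S = size u ->
  blc (bcmp k u S) alpha = blc u (fun i => bev alpha (nth (bpar 0) S i)).
Proof.
move=> Sk sS; have /allP SA := bletters_pword Sk.
apply/le_anti/andP; split; apply/blc_leP => j.
  rewrite size_cmp => jk aj; rewrite nth_mkseq //; apply/blc_leP => i iu /eqP Si.
  by apply: blc_sup; rewrite // /bev Si.
move=> ju aj; have jk : (nth 0 S j < k)%N by apply: SA; rewrite mem_nth ?sS.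
apply: (@le_trans _ _ (nth \bot (bcmp k u S) (nth 0%N S j))); last first.
  by apply: blc_sup => //; rewrite size_cmp.
by rewrite nth_mkseq //; apply: blc_sup => //; exact: eqxx.
Qed.

Lemma bcmp_frame S k : bword 0 S k -> size S = size u -> bframe (bcmp k u S).
Proof.
move=> Sk sS; split.
- apply/negP => /(nthP \bot)[j]; rewrite size_cmp => jk; rewrite nth_mkseq //.
  have [i iS Si] := bword_pivot Sk jk; rewrite sS in iS.
  move=> e; have := bframe_neq0 iS; case/negP; rewrite -lex0 -[leRHS]e.
  by apply: blc_sup => //; rewrite /bev /= Si; exact: eqxx.
- apply/(pairwiseP \bot) => i j; rewrite !inE size_cmp => ik jk ij.
  rewrite !nth_mkseq // /disj blcI -(blc0 u); apply/eqP/blc_ext => l _.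
  by rewrite /bev /bunit; case: eqP => // ->; rewrite (ltn_eqF ij).
- by rewrite blc_cmp // -blcT.
Qed.

Lemma subalgebra_blc U w alpha : finite_subalgebra U -> (forall y, y \in w -> U y) ->
  U (blc w alpha).
Proof.
move=> [_ [U0 _] _ UU _] wU; apply: (big_ind U) => // i _.
by apply: wU; rewrite mem_nth.
Qed.

(** For a member [y] of [u], the least element [f y] of [U] above [y] is an atom of [U]. The word
    tells for each member of [u] which atom of [U] is above it, the atoms being numbered by first
    appearance. *)
Lemma subalgebra_word U : finite_subalgebra U -> U `<=` bhull u ->
  exists k S, [/\ bword 0 S k, size S = size u & bhull (bcmp k u S) = U].
Proof.
move=> Usub Uu; have [/finite_seqP[s sE] [U0 U1] UI UU UC] := Usub.
pose f y := \meet_(z <- s | y <= z) z.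
have fU y : U (f y).
  by rewrite /f big_seq_cond; apply: (big_ind U) => // z /andP[zs _]; rewrite sE.
have f_ge y : y <= f y by apply/meetsP_seq.
have f_le y z : U z -> y <= z -> f y <= z.
  by rewrite {1}sE => zs yz; exact: meets_inf_seq.
have atomP i z : (i < size u)%N -> U z -> ~~ (nth \bot u i <= z) -> nth \bot u i <= ~` z.
  by move=> iu /Uu[a _ <-]; rewrite blcC !le_blc.
have f_eq i j : (i < size u)%N -> (j < size u)%N ->
    nth \bot u i <= f (nth \bot u j) -> f (nth \bot u i) = f (nth \bot u j).
  move=> iu ju ij; apply/le_anti/andP; split; first exact: f_le.
  (* Otherwise member [j], and with it [f] of it, would lie below the complement of [f] of member
     [i], which would force member [i] to be zero. *)
  apply: (f_le) => //; apply/negPn/negP => nle.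
  have le := le_trans ij (f_le _ _ (UC _ (fU _)) (atomP _ _ ju (fU _) nle)).
  have := bframe_neq0 iu; case/negP; rewrite -lex0.
  by rewrite -[leRHS](meetxC (f (nth \bot u i))) lexI le andbT.
have [w [uw wl lw]] := index_word [seq f y | y <- u].
pose S := [seq index a w | a <- [seq f y | y <- u]].
have sS : size S = size u by rewrite !size_map.
have SE i : (i < size u)%N -> nth 0%N S i = index (f (nth \bot u i)) w.
  by move=> iu; rewrite (nth_map \bot) ?size_map // (nth_map \bot).
have fw i : (i < size u)%N -> f (nth \bot u i) \in w.
  by move=> iu; rewrite wl; apply/map_f/mem_nth.
have cmpw : bcmp (size w) u S = w.
  apply: (@eq_from_nth _ \bot); rewrite size_cmp // => j jw; rewrite nth_mkseq //.
  have : nth \bot w j \in [seq f y | y <- u] by rewrite -wl mem_nth.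
  move=> /mapP[_ /(nthP \bot)[i0 i0u <-] wj]; rewrite wj.
  have [beta _ be] := Uu _ (fU (nth \bot u i0)); rewrite -be.
  apply: blc_ext => i iu; rewrite -(le_blc beta) // be /bev /bunit SE //.
  apply/eqP/idP => [ij|/f_eq-> //].
    by rewrite -wj -ij nth_index ?fw.
  by rewrite -wj index_uniq.
exists (size w), S; rewrite cmpw; split => //.
apply/seteqP; split=> [_ [alpha _ <-]|y Uy].
  apply: subalgebra_blc => // y; rewrite wl => /mapP[z _ ->]; exact: fU.
have [beta _ yb] := Uu _ Uy.
exists (fun j => nth \bot w j <= y) => //.
rewrite -cmpw blc_cmp // cmpw -[RHS]yb; apply: blc_ext => i iu.
rewrite /bev SE // nth_index ?fw // -(le_blc beta) // yb.
by apply/idP/idP => [/(le_trans (f_ge _))|/(f_le _ _ Uy)].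
Qed.

End Frame.

Hypothesis B_neq : \bot <> \top :> B.
Hypothesis B_atomless : atomless B.

(** Induction on [u] cannot keep the condition that the join is [\top], so the joins are merely
    preserved. A member [p] of [u] is cut by [y] if both parts are nonzero; its partner [q] in [v]
    is then cut as well, which atomlessness permits. *)
Lemma bframe_refine u v y : \bot \notin u -> \bot \notin v -> pairwise disj u -> pairwise disj v ->
  size u = size v -> exists u' v',
  [/\ \bot \notin u', \bot \notin v', pairwise disj u', pairwise disj v' & size u' = size v'] /\
  [/\ blc u' (fun=> true) = blc u (fun=> true), blc v' (fun=> true) = blc v (fun=> true),
    forall alpha, exists alpha', blc u alpha = blc u' alpha' /\ blc v alpha = blc v' alpha'
    & exists beta, blc u' beta = blc u (fun=> true) `&` y].
Proof.
elim: u v => [|p u IHu] [|q v] //=.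
  move=> _ _ _ _ _; exists [::], [::]; split => //; split => //.
    by move=> alpha; exists alpha.
  by exists (fun=> false); rewrite /blc !big_ord0 meet0x.
rewrite !inE !negb_or => /andP[p0 u0] /andP[q0 v0] /andP[pu pwu] /andP[qv pwv] [suv].
have [u' [v' [[u'0 v'0 pwu' pwv' suv'] [u'T v'T uv [beta ub]]]]] :=
  IHu v u0 v0 pwu pwv suv.
have pu' z : z <= p -> all (disj z) u'.
  by move=> zp; rewrite disj_blc u'T; rewrite disj_blc in pu; exact: disjW zp (lexx _) pu.
have qv' z : z <= q -> all (disj z) v'.
  by move=> zq; rewrite disj_blc v'T; rewrite disj_blc in qv; exact: disjW zq (lexx _) qv.
(* [b] records whether [p] lies below [y] or is disjoint from it. *)
have noSplit b : (if b then p else \bot) = p `&` y -> exists u'' v'',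
  [/\ \bot \notin u'', \bot \notin v'', pairwise disj u'', pairwise disj v'' &
      size u'' = size v''] /\
  [/\ blc u'' (fun=> true) = blc (p :: u) (fun=> true),
    blc v'' (fun=> true) = blc (q :: v) (fun=> true),
    forall alpha, exists alpha', blc (p :: u) alpha = blc u'' alpha' /\
      blc (q :: v) alpha = blc v'' alpha'
    & exists beta, blc u'' beta = blc (p :: u) (fun=> true) `&` y].
  move=> bE; exists (p :: u'), (q :: v'); split.
    by rewrite !inE !negb_or /= p0 q0 u'0 v'0 pu' ?qv' // pwu' pwv' suv'.
  split; rewrite ?blc_cons ?u'T ?v'T //.
    move=> alpha; have [a' [e1 e2]] := uv (fun i => alpha i.+1).
    by exists (scons (alpha 0%N) a'); rewrite !blc_cons /= e1 e2.
  by exists (scons b beta); rewrite blc_cons /= bE ub meetUl.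
have [py|py] := eqVneq (p `&` y) \bot; first by apply: (noSplit false).
have [pNy|pNy] := eqVneq (p `&` ~` y) \bot.
  by apply: (noSplit true); apply/esym/meet_idPl; rewrite -[y]complK -disj_leC pNy.
have qpos : \bot < q by rewrite lt0x eq_sym.
have [q1 [q10 q1q]] := B_atomless qpos.
have q1N : q `&` ~` q1 != \bot.
  by rewrite disj_leC complK (lt_geF q1q).
have split2 a b : a `&` b `|` a `&` ~` b = a by rewrite -meetUr joinxC meetx1.
have disj2 a b c : disj (a `&` b) (c `&` ~` b).
  by apply: (@disjW b (~` b)); rewrite ?leIr // /disj meetxC.
have q1E : q `&` q1 = q1 by apply/meet_idPr/ltW.
exists [:: p `&` y, p `&` ~` y & u'], [:: q `&` q1, q `&` ~` q1 & v']; split.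
  rewrite !inE !negb_or /= u'0 v'0 suv' !disj2 !pu' ?leIl // !qv' ?leIl // pwu' pwv'.
  by rewrite ![\bot == _]eq_sym py pNy q1E q1N -lt0x q10.
split; rewrite ?blc_cons /= ?u'T ?v'T ?joinA ?split2 //.
  move=> alpha; have [a' [e1 e2]] := uv (fun i => alpha i.+1).
  exists (scons (alpha 0%N) (scons (alpha 0%N) a')).
  rewrite !blc_cons /= e1 e2 !joinA; case: (alpha 0%N); last by rewrite !joinxx.
  by rewrite !split2.
by exists (scons true (scons false beta)); rewrite !blc_cons /= ub join0x meetUl.
Qed.

Lemma bframe_extend u v y : bframe u -> bframe v -> size u = size v -> exists u' v',
  [/\ bframe u', bframe v', size u' = size v',
    forall alpha, exists alpha', blc u alpha = blc u' alpha' /\ blc v alpha = blc v' alpha'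
    & bhull u' y].
Proof.
move=> [u0 pu uT] [v0 pv vT] suv.
have [u' [v' [[u'0 v'0 pwu' pwv' suv'] [u'T v'T uv [beta ub]]]]] :=
  bframe_refine y u0 v0 pu pv suv.
exists u', v'; split => //; [by split; rewrite ?u'T|by split; rewrite ?v'T|].
by exists beta; rewrite // ub uT meet1x.
Qed.

Lemma bframe_top : bframe [:: \top].
Proof.
split => //; first by rewrite inE; exact/eqP.
by rewrite blc_cons /= joinC joinx1.
Qed.

Lemma bframe_succ u : bframe u -> exists2 v, bframe v & size v = (size u).+1.
Proof.
move=> [u0 pu uT]; case: u u0 pu uT => [|p u].
  by move=> _ _; rewrite /blc big_ord0 => /B_neq.
rewrite inE negb_or pairwise_cons => /andP[p0 u0] /andP[pu pwu] uT.
have [|q [q0 qp]] := B_atomless (x := p); first by rewrite lt0x eq_sym.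
exists [:: p `&` q, p `&` ~` q & u] => //.
have pu' z : z <= p -> all (disj z) u.
  by move=> zp; rewrite disj_blc; rewrite disj_blc in pu; exact: disjW zp (lexx _) pu.
have pq : p `&` q = q by apply/meet_idPr/ltW.
have pNq : p `&` ~` q != \bot by rewrite disj_leC complK (lt_geF qp).
split.
- by rewrite !inE !negb_or u0 pq !(eq_sym \bot) pNq -lt0x q0.
- rewrite !pairwise_cons [all _ (_ :: u)]/= !pu' ?leIl // pwu !andbT.
  by apply: (@disjW q (~` q)); rewrite ?leIr // /disj meetxC.
- by rewrite !blc_cons /= joinA -meetUr joinxC meetx1 -uT blc_cons.
Qed.

Lemma bframe_grow u n : bframe u -> (size u <= n)%N -> exists2 v, bframe v & size v = n.
Proof.
move=> Fu /subnK <-; elim: (n - size u)%N => [|m [v Fv sv]]; first by exists u.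
by have [w Fw sw] := bframe_succ Fv; exists w; rewrite // sw sv.
Qed.

Lemma baut_blc g u alpha : boolalg_aut_set (B := B) g -> g (blc u alpha) = blc (map g u) alpha.
Proof.
case=> [g0 _ _ gU _]; rewrite /blc (big_morph g gU g0) size_map.
by apply: eq_bigr => i _; rewrite (nth_map \bot).
Qed.

Lemma baut_bframe g u : boolalg_aut_set (B := B) g -> bframe u -> bframe (map g u).
Proof.
move=> gaut [u0 pu uT]; have [g0 g1 gI _ _] := gaut; split.
- apply/negP => /mapP[y yu e]; move: yu.
  by rewrite -(can_inj (symgK g) (etrans g0 e)) (negPf u0).
- rewrite pairwise_map; apply: sub_pairwise pu => y z /eqP yz.
  by apply/eqP; rewrite -[LHS](gI y z) yz.
- by rewrite -baut_blc // uT g1.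
Qed.

Lemma baut_local (g : symg B) : (forall l : seq B, exists u v,
    [/\ bframe u, bframe v, size u = size v &
      forall y, y \in l -> exists alpha, y = blc u alpha /\ g y = blc v alpha]) ->
  boolalg_aut_set (B := B) g.
Proof.
move=> gP.
have mem0 (l : seq B) (y : B) : y \in y :: l by rewrite inE eqxx.
have gU : {morph g : y z / y `|` z}.
  move=> y z; have [u [v [Fu Fv suv uv]]] := gP [:: y `|` z; y; z].
  have [|c [cE gc]] := uv (y `|` z); first by rewrite !inE eqxx.
  have [|a [aE ga]] := uv y; first by rewrite !inE eqxx orbT.
  have [|b [bE gb]] := uv z; first by rewrite !inE eqxx !orbT.
  have e : blc u c = blc u (fun i => a i || b i) by rewrite -blcU -cE -aE -bE.
  rewrite gc ga gb blcU; apply: blc_ext => i; rewrite -suv; exact: blc_inj e i.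
have gC : {morph g : y / ~` y}.
  move=> y; have [u [v [Fu Fv suv uv]]] := gP [:: ~` y; y].
  have [|c [cE gc]] := uv (~` y); first by rewrite !inE eqxx.
  have [|a [aE ga]] := uv y; first by rewrite !inE eqxx orbT.
  have e : blc u c = blc u (fun i => ~~ a i) by rewrite -blcC // -cE -aE.
  rewrite gc ga blcC //; apply: blc_ext => i; rewrite -suv; exact: blc_inj e i.
have gI : {morph g : y z / y `&` z}.
  by move=> y z; rewrite -[y `&` z]complK complI gC gU !gC complU !complK.
have g0 : g \bot = \bot by rewrite -[X in g X](meetxC \bot) gI gC meetxC.
have g1 : g \top = \top by rewrite -[X in g X](joinxC \bot) gU gC joinxC.
by split.
Qed.

Hypothesis B_countable : countable [set: B].

Lemma boolean_frame_system : frame_system \bot (boolalg_aut B) (<%O : rel bool) bunit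
  bpar bletter bsub bev blc bframe (@finite_subalgebra d B).
Proof.
split => //.
- exact: boolean_letters.
- by split; [case | case=> [] [] [] | case=> [] [] // _; [right|left]].
- by rewrite card_bool.
- exact: blc_ext.
- by move=> u alpha beta Fu; exact: blc_inj.
- exact: bunit_blc.
- by move=> u S k alpha Fu; exact: blc_cmp.
- by move=> u S k Fu; exact: bcmp_frame.
- by move=> k a alpha beta ak; apply.
- by exists [:: \top]; exact: bframe_top.
- exact: bframe_grow.
- by move=> u Fu; exact: bhull_subalgebra.
- by move=> U [].
- by move=> u U Fu; exact: subalgebra_word.
- exact: bframe_extend.
- by move=> g u alpha; exact: baut_blc.
- by move=> g u; exact: baut_bframe.
- exact: baut_local.
Qed.

(** The enumeration of the atoms for which an ordering is natural need not be the frame that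
    [Sub_frame] provides, but has the same members. *)
Lemma eq_mem_bframe u w : bframe w -> uniq u -> u =i w -> bframe u.
Proof.
move=> Fw uu uw; have [w0 pw wT] := Fw.
have pu : perm_eq u w by apply: uniq_perm => //; exact: bframe_uniq.
split; first by rewrite uw.
- apply/(pairwiseP \bot) => i j iu ju ij; rewrite !inE in iu ju.
  have : nth \bot u i != nth \bot u j by rewrite nth_uniq // ltn_eqF.
  have /(nthP \bot)[i' i'w <-] : nth \bot u i \in w by rewrite -uw mem_nth.
  have /(nthP \bot)[j' j'w <-] : nth \bot u j \in w by rewrite -uw mem_nth.
  by move=> ne; apply: bframe_disj => //; apply: contraNneq ne => ->.
- rewrite -wT; apply/le_anti/andP; split; apply/blc_leP => i iu _.
    have /(nthP \bot)[j jw <-] : nth \bot u i \in w by rewrite -uw mem_nth.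
    exact: blc_sup.
  have /(nthP \bot)[j jw <-] : nth \bot w i \in u by rewrite uw mem_nth.
  exact: blc_sup.
Qed.

Lemma eq_mem_bhull u w : bframe u -> bframe w -> u =i w -> bhull u = bhull w.
Proof.
suff sub u' w' : bframe w' -> u' =i w' -> bhull u' `<=` bhull w'.
  by move=> Fu Fw uw; apply/seteqP; split; apply: sub.
move=> Fw' uw _ [alpha _ <-]; apply: subalgebra_blc (bhull_subalgebra Fw') _.
move=> y; rewrite uw => /(nthP \bot)[i iw <-].
by rewrite -bunit_blc //; exact: lc_hull.
Qed.

Lemma blc_rev u n (a : 'I_n -> B) (delta : 'I_n -> bool) alpha : size u = n ->
  (forall i : 'I_n, nth \bot u i = a (rev_ord i)) ->
  (forall i : 'I_n, alpha i = delta (rev_ord i)) ->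
  \join_(i < n | delta i) a i = blc u alpha.
Proof.
move=> sn ua aE; rewrite /blc sn (reindex_inj rev_ord_inj) /=.
by apply: eq_big => i; rewrite ?aE // ua.
Qed.

Lemma natural_bool_frame (r : relspace B) (U : set B) : finite_subalgebra U ->
  natural_bool_on (rel_of r) U <->
  exists u, [/\ bframe u, bhull u = U & natural_on (<%O : rel bool) blc r u].
Proof.
move=> Usub; have irr : irreflexive (<%O : rel bool) by case.
have equiv u n (a : 'I_n -> B) : size u = n ->
    (forall i : 'I_n, nth \bot u i = a (rev_ord i)) ->
    (forall alpha beta : 'I_n -> bool,
      rel_of r (\join_(i < n | alpha i) a i) (\join_(i < n | beta i) a i) <->
      antilex <%O alpha beta) <-> natural_on (<%O : rel bool) blc r u.
  move=> sn ua; split=> [rP alpha beta|nat_u a' c].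
    have fw gam : \join_(i < n | gam (nat_of_ord (rev_ord i))) a i = blc u gam.
      by apply: (@blc_rev u n a (fun i => gam (nat_of_ord (rev_ord i)))) => // i; rewrite rev_ordK.
    rewrite -!fw sn.
    have <- : antilex <%O (fun i : 'I_n => alpha (nat_of_ord (rev_ord i)))
        (fun i : 'I_n => beta (nat_of_ord (rev_ord i))) = lex <%O n alpha beta.
      by apply/propext/antilex_lex => // i; rewrite rev_ordK.
    by apply/idP/asboolP => /rP.
  have [alpha aE] := rev_coords false a'; have [gam cE] := rev_coords false c.
  rewrite (blc_rev sn ua aE) (blc_rev sn ua cE) /rel_of nat_u sn.
  by rewrite (antilex_lex irr aE cE); split => /asboolP.
split=> [[n [a [ainj aU rP]]]|[u [Fu uU nat_u]]].
  pose u := [seq a (rev_ord i) | i <- enum 'I_n].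
  have sn : size u = n by rewrite size_map size_enum_ord.
  have ua (i : 'I_n) : nth \bot u i = a (rev_ord i).
    by rewrite (nth_map i) ?size_enum_ord // nth_ord_enum.
  have [w Fw wU] := Sub_frame boolean_frame_system Usub.
  have uu : uniq u.
    by rewrite map_inj_uniq ?enum_uniq // => i j /ainj/rev_ord_inj.
  have uw : u =i w.
    move=> y; have : atoms U y <-> y \in w by rewrite -wU bhull_atoms.
    rewrite -aU => -[H1 H2]; apply/idP/idP => [/mapP[i _ e]|/H2[i _ <-]].
      by apply: H1; rewrite e; exists (rev_ord i).
    by rewrite -[i]rev_ordK; apply: map_f; rewrite mem_enum.
  have Fu := eq_mem_bframe Fw uu uw.
  exists u; split => //; first by rewrite (eq_mem_bhull Fu Fw uw).
  exact/(equiv u n a).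
exists (size u), (fun i => nth \bot u (rev_ord i)); split.
- move=> i j /eqP; rewrite nth_uniq ?bframe_uniq //.
  by move=> /eqP/val_inj/rev_ord_inj.
- rewrite -uU bhull_atoms //; apply/seteqP; split=> [_ [i _ <-]|_ /(nthP \bot)[i iu <-]].
    exact: (mem_nth \bot (ltn_ord (rev_ord i))).
  by exists (rev_ord (Ordinal iu)) => //; rewrite rev_ordK.
- apply/(equiv u (size u)) => // i.
  by rewrite rev_ordK.
Qed.

Theorem boolean_universal_minimal_flow :
  is_universal_minimal_flow (@natural_bool_act d B).
Proof.
apply: (frames_universal_minimal_flow boolean_frame_system) => r.
by split=> -[rlin rU]; split => // U Usub; have /natural_bool_frame := rU U Usub; apply.
Qed.

End BooleanFrames.

Theorem theorem8p2 :
  (forall E : rel nat,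
     equivalence_rel E ->
     infinite_set (range (fun x => [set y | E x y])) ->
     (forall x, infinite_set [set y | E x y]) ->
     is_universal_minimal_flow (@convex_act nat E))
  /\
  (forall (F : finFieldType) (ltF : rel F) (V : lmodType F),
     strict_linear_order ltF ->
     (forall x : F, x <> 0%R -> ltF 0%R x) ->
     dim_aleph0 V ->
     is_universal_minimal_flow (@natural_vect_act F V ltF))
  /\
  (forall (d : Order.disp_t) (B : ctbDistrLatticeType d),
     countable [set: B] ->
     (\bot <> \top :> B)%O ->
     atomless B ->
     is_universal_minimal_flow (@natural_bool_act d B)).
Proof.
split; first by move=> E; exact: eqrel_universal_minimal_flow.
split; first by move=> F ltF V lt_slo _ V_dim; exact: vector_universal_minimal_flow.
by move=> d B B_count B_neq B_atomless; exact: boolean_universal_minimal_flow.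
Qed.
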